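(* There is a polynomial-time $k$-approximation algorithm for the Fault-Tolerant Path problem on instances with $k\geq 1$.
   Context: Fault-Tolerant Path (FTP): given a directed graph $D=(V,A)$ with non-negative arc weights $w$, two vertices $s,t\in V$, a set $M\subseteq A$ of vulnerable arcs and an integer $k\in\mathbb{Z}_{\geq 0}$, find a minimum-weight set $S\subseteq A$ such that $S\setminus F$ contains an $s$-$t$ path for every $F\subseteq M$ with $|F|\leq k$. *)

(* Defs.v *)
From mathcomp Require Import all_boot all_order all_algebra.
Set Implicit Arguments.
Unset Strict Implicit.
Unset Printing Implicit Defensive.
Import Order.TTheory GRing.Theory Num.Theory.

(** * Random access machine with logarithmic cost

    Time is measured on the random access machine of Aho, Hopcroft and Ullman
    under the logarithmic cost criterion, which is polynomially equivalent to
    the Turing machine.  Registers hold natural numbers; programs are written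
    with structured control flow instead of jumps, and operands may be nested
    expressions, every operation inside them being charged. *)

Definition memory := nat -> nat.

Definition update (mem : memory) (x v : nat) : memory :=
  fun y => if y == x then v else mem y.

(* Number of binary digits, with [bitlen 0 = 1]. *)
Definition bitlen (n : nat) : nat := (trunc_log 2 n).+1.

(* [Sub] is truncated, and [Div] by zero yields zero. *)
Inductive binop := Add | Sub | Mul | Div.

Definition binop_sem (o : binop) : nat -> nat -> nat :=
  match o with Add => addn | Sub => subn | Mul => muln | Div => divn end.

(* [Read e] is the content of the register whose address is the value of [e]:
   [Read (Const x)] is direct and [Read (Read (Const x))] indirect addressing. *)
Inductive expr :=
  | Const of nat
  | Read of expr
  | Binop of binop & expr & expr.

Fixpoint value (mem : memory) (e : expr) : nat :=
  match e with
  | Const n => n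
  | Read e1 => mem (value mem e1)
  | Binop o e1 e2 => binop_sem o (value mem e1) (value mem e2)
  end.

Fixpoint cost (mem : memory) (e : expr) : nat :=
  match e with
  | Const n => bitlen n
  | Read e1 => cost mem e1 + bitlen (value mem e1) + bitlen (value mem e)
  | Binop _ e1 e2 => cost mem e1 + cost mem e2 +
                     bitlen (value mem e1) + bitlen (value mem e2)
  end.

(* [Write e1 e2] stores the value of [e2] at the address given by [e1];
   a test succeeds when its value is nonzero. *)
Inductive program :=
  | Skip
  | Write of expr & expr
  | Seq of program & program
  | If of expr & program & program
  | While of expr & program.

(* [exec c mem mem' T]: started on [mem], the program [c] halts with memory
   [mem'] after time [T]. *)
Inductive exec : program -> memory -> memory -> nat -> Prop :=
  | exec_skip mem : exec Skip mem mem 1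
  | exec_write e1 e2 mem :
      exec (Write e1 e2) mem (update mem (value mem e1) (value mem e2))
        (cost mem e1 + cost mem e2 +
         bitlen (value mem e1) + bitlen (value mem e2))
  | exec_seq c1 c2 mem mem1 mem2 T1 T2 :
      exec c1 mem mem1 T1 -> exec c2 mem1 mem2 T2 ->
      exec (Seq c1 c2) mem mem2 (T1 + T2)
  | exec_if_true e c1 c2 mem mem1 T :
      value mem e != 0 -> exec c1 mem mem1 T ->
      exec (If e c1 c2) mem mem1 (cost mem e + bitlen (value mem e) + T)
  | exec_if_false e c1 c2 mem mem1 T :
      value mem e = 0 -> exec c2 mem mem1 T ->
      exec (If e c1 c2) mem mem1 (cost mem e + bitlen (value mem e) + T)
  | exec_while_true e c mem mem1 mem2 T1 T2 :
      value mem e != 0 -> exec c mem mem1 T1 ->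
      exec (While e c) mem1 mem2 T2 ->
      exec (While e c) mem mem2
        (cost mem e + bitlen (value mem e) + T1 + T2)
  | exec_while_false e c mem :
      value mem e = 0 ->
      exec (While e c) mem mem (cost mem e + bitlen (value mem e)).

Lemma exec_det c mem mem1 mem2 T1 T2 :
  exec c mem mem1 T1 -> exec c mem mem2 T2 -> mem1 = mem2 /\ T1 = T2.
Proof.
move=> E1; elim: E1 mem2 T2 => {c mem mem1 T1}.
- by move=> mem mem2 T2 E; inversion E.
- by move=> e1 e2 mem mem2 T2 E; inversion E.
- move=> c1 c2 mem mem1 mem2 T1 T2 _ IH1 _ IH2 mem' T' E.
  inversion E as [| |? ? ? m1 m2 U1 U2 F1 F2| | | |]; subst.
  have [? ?] := IH1 _ _ F1; subst m1 U1.
  by have [? ?] := IH2 _ _ F2; subst.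
- move=> e c1 c2 mem mem1 T ne0 _ IH mem' T' E.
  inversion E as [| | |? ? ? ? ? U ? F|? ? ? ? ? U eq0 F| |]; subst.
    by have [? ?] := IH _ _ F; subst.
  by rewrite eq0 in ne0.
- move=> e c1 c2 mem mem1 T eq0 _ IH mem' T' E.
  inversion E as [| | |? ? ? ? ? U ne0 F|? ? ? ? ? U ? F| |]; subst.
    by rewrite eq0 in ne0.
  by have [? ?] := IH _ _ F; subst.
- move=> e c mem mem1 mem2 T1 T2 ne0 _ IH1 _ IH2 mem' T' E.
  inversion E as [| | | | |? ? ? m1 m2 U1 U2 ? F1 F2|? ? ? eq0]; subst.
    have [? ?] := IH1 _ _ F1; subst m1 U1.
    by have [? ?] := IH2 _ _ F2; subst.
  by rewrite eq0 in ne0.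
- move=> e c mem eq0 mem' T' E.
  inversion E as [| | | | |? ? ? m1 m2 U1 U2 ne0 F1 F2|? ? ? ?]; subst => //.
  by rewrite eq0 in ne0.
Qed.

(** * The Fault-Tolerant Path problem *)

(* The vertices are ['I_nV] and the arcs ['I_nA]; loops and parallel arcs are
   permitted. *)
Record instance := Instance {
  nV : nat;
  nA : nat;
  arc_tail : 'I_nA -> 'I_nV;
  arc_head : 'I_nA -> 'I_nV;
  weight : 'I_nA -> rat;
  weight_ge0 : forall a, (0 <= weight a)%R;
  source : 'I_nV;
  target : 'I_nV;
  vulnerable : {set 'I_nA};
  faults : nat
}.

Section Problem.
Variable I : instance.
Implicit Types (B S F : {set 'I_(nA I)}).

Definition adjacent B : rel 'I_(nV I) :=
  fun u v => [exists a in B, (arc_tail a == u) && (arc_head a == v)].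

Definition contains_st_path B : Prop :=
  exists p : seq 'I_(nV I),
    [/\ path (adjacent B) (source I) p,
        uniq (source I :: p)
      & last (source I) p = target I].

Definition feasible S : Prop :=
  forall F, F \subset vulnerable I -> #|F| <= faults I ->
    contains_st_path (S :\: F).

Definition total_weight S : rat := (\sum_(a in S) weight a)%R.

Definition optimal S : Prop :=
  feasible S /\ forall S', feasible S' -> (total_weight S <= total_weight S')%R.

(* [None] is the answer "there is no feasible set". *)
Definition approx_answer (alpha : rat) (ans : option {set 'I_(nA I)}) : Prop :=
  match ans with
  | Some B => feasible B /\
      forall S, optimal S -> (total_weight B <= alpha * total_weight S)%R
  | None => forall S, ~ feasible S
  end.

(* Weights are given by numerator and denominator in lowest terms. *)
Definition encode_arc (a : 'I_(nA I)) : seq nat :=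
  [:: val (arc_tail a); val (arc_head a); `|numq (weight a)|%N; `|denq (weight a)|%N;
      nat_of_bool (a \in vulnerable I)].

Definition encode : seq nat :=
  [:: nV I; nA I; val (source I); val (target I); faults I]
    ++ flatten [seq encode_arc a | a <- enum 'I_(nA I)].

(* The number of vertices counts in unary, as for any explicit description of
   a graph; all other data, including the number of faults, count in binary. *)
Definition input_size : nat := nV I + \sum_(x <- encode) bitlen x.

Definition input_memory : memory := nth 0 encode.

(* Register 0 tells whether there is a solution, register [a + 1] whether the
   arc [a] belongs to it. *)
Definition answer (mem : memory) : option {set 'I_(nA I)} :=
  if mem 0 == 0 then None else Some [set a : 'I_(nA I) | mem (val a).+1 != 0].

End Problem.

(* [alg] runs in polynomial time and is an [alpha]-approximation on the
   instances satisfying [P], where [alpha] may depend on the instance. *)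
Definition polytime_approximation
    (P : instance -> Prop) (alpha : instance -> rat) (alg : program) : Prop :=
  exists c d : nat, forall I : instance, P I ->
    exists (mem : memory) (T : nat),
      [/\ exec alg (input_memory I) mem T,
          T <= c * input_size I ^ d + c
        & approx_answer (alpha I) (answer I mem)].

(* Main.v *)
Require Import Defs.
From mathcomp Require Import all_boot all_order all_algebra.
From mathcomp Require Import zify.
From Stdlib Require Import FunctionalExtensionality Classical.
Set Implicit Arguments.
Unset Strict Implicit.
Unset Printing Implicit Defensive.

(** A feasible set of an instance with [k >= 1] is found in two phases.

    First an optimal solution for a single fault is computed.  Call a set of
    arcs tolerant from [x] to [y] if it survives one fault.  If every [x]-[y] cut
    of a tolerant set has two arcs, the set contains two arc-disjoint paths, of
    least weight a minimum cost flow of value two; otherwise some cut consists of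
    a single safe arc, which splits the set into two tolerant parts.  Hence the
    optimum is a shortest path in the auxiliary graph made of the safe arcs and,
    for every pair of vertices, of an arc whose cost is that of two
    arc-disjoint paths.

    Then [k + 1] units of flow are sent from [s] to [t], vulnerable arcs having
    capacity one and safe arcs being unbounded; arcs already bought are free, and
    so is cancelling flow.  If [d] is the distance in this residual graph, every
    cut [{d <= th}] with [th < d t] is saturated by the current flow, so a feasible
    set must cross it with an arc not yet bought; therefore a shortest augmenting
    path costs at most the optimum.  The first two units are free because the
    initial solution tolerates one fault, so the total is at most [1 + (k - 1)]
    times the optimum.

    The lower bounds for augmenting paths and for two arc-disjoint paths count the
    arcs of a competitor that cross the level cuts of a distance function; no
    decomposition of flows into paths is needed. *)

(** * A structured language compiled to the random access machine *)

(** Two obstacles are arithmetic. The budget [k] is written in binary, so [k + 1] augmentations may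
    be exponentially many; but a set with at most [m] arcs that survives [m] faults survives any
    number, so polynomially many units suffice. Time is charged by bit length, so assigned values
    are clipped at a number [B] that exceeds the total weight after clearing denominators; the same
    [B] plays infinity for distances and capacities.

    Cancelling flow brings neither charge nor refund, because bought arcs stay bought. Residual
    costs are thus never negative and Dijkstra's method applies. For two arc-disjoint paths genuine
    refunds matter, and reduced costs restore nonnegativity there.

    The two free units come from the level-cut bound itself: it may be applied with the bought set
    as its own competitor. That set survives one fault, so while at most one unit has been sent the
    distance must be zero. *)

(* [st i x] is the cell [x] of array [i]: arrays below 32 are interleaved behind the
   input, array 32 is the part of the memory that holds the input. *)
Definition store := nat -> nat -> nat.

Definition upd (st : store) (i x v : nat) : store :=
  fun j y => if Nat.eqb j i && (y == x) then v else st j y.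

Inductive aexp :=
  | Cst of nat
  | Arr of nat & aexp
  | Low of aexp
  | Op of binop & aexp & aexp.

(** Input addresses are cut off at [5m + 4], the last register of the input, so reading the input
    never meets an array cell. *)
Fixpoint ev (st : store) (e : aexp) : nat :=
  match e with
  | Cst n => n
  | Arr i e1 => st i (ev st e1)
  | Low e1 => st 32 (minn (ev st e1) (5 * st 32 1 + 4))
  | Op o e1 e2 => binop_sem o (ev st e1) (ev st e2)
  end.

(* Every loop [CFor i c] runs for as many rounds as cell 0 of array 1 tells, with
   its counter in cell 0 of array [i]. *)
Inductive cmd :=
  | CSet of nat & aexp & aexp
  | CLow of aexp & aexp
  | CSeq of cmd & cmd
  | CIf of aexp & cmd & cmd
  | CFor of nat & cmd
  | CSkip.

Fixpoint loop (F : store -> nat -> store) (st : store) (x : nat) : store :=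
  if x is x'.+1 then F (loop F st x') x' else st.

(* Register 1, the number of arcs, determines where the arrays are stored; hence
   [CLow] writes from register 2 on. *)
Fixpoint sem (c : cmd) (st : store) : store :=
  match c with
  | CSet i a e => upd st i (ev st a) (ev st e)
  | CLow a e => upd st 32 (2 + minn (ev st a) (5 * st 32 1 + 2)) (ev st e)
  | CSeq c1 c2 => sem c2 (sem c1 st)
  | CIf e c1 c2 => if ev st e != 0 then sem c1 st else sem c2 st
  | CFor i c1 =>
      upd (loop (fun s x => sem c1 (upd s i 0 x)) st (st 1 0)) i 0 (st 1 0)
  | CSkip => st
  end.

Fixpoint writes (c : cmd) : seq nat :=
  match c with
  | CSet i _ _ => [:: i]
  | CLow _ _ => [:: 32]
  | CSeq c1 c2 | CIf _ c1 c2 => writes c1 ++ writes c2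
  | CFor i c1 => i :: writes c1
  | CSkip => [::]
  end.

Fixpoint wfe (e : aexp) : bool :=
  match e with
  | Cst _ => true
  | Arr i e1 => (i < 32) && wfe e1
  | Low e1 => wfe e1
  | Op _ e1 e2 => wfe e1 && wfe e2
  end.

(** A loop body may write neither its own counter nor array 1, so the number of rounds is fixed on
    entry. *)
Fixpoint wfc (c : cmd) : bool :=
  match c with
  | CSet i a e => [&& i < 32, wfe a & wfe e]
  | CLow a e => wfe a && wfe e
  | CSeq c1 c2 => wfc c1 && wfc c2
  | CIf e c1 c2 => [&& wfe e, wfc c1 & wfc c2]
  | CFor i c1 => [&& i < 32, i != 1, i \notin writes c1, 1 \notin writes c1 & wfc c1]
  | CSkip => true
  end.

Fixpoint depth (c : cmd) : nat :=
  match c with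
  | CSeq c1 c2 | CIf _ c1 c2 => maxn (depth c1) (depth c2)
  | CFor _ c1 => (depth c1).+1
  | _ => 0
  end.

(** Only stored values must fit into [b] bits; addresses and tests are expressions in stored values
    and are longer by at most a constant factor. *)
Fixpoint safe (M b : nat) (c : cmd) (st : store) : Prop :=
  match c with
  | CSet _ _ e | CLow _ e => ev st e < 2 ^ b
  | CSeq c1 c2 => safe M b c1 st /\ safe M b c2 (sem c1 st)
  | CIf e c1 c2 => if ev st e != 0 then safe M b c1 st else safe M b c2 st
  | CFor i c1 => st 1 0 <= M /\ forall x, x < st 1 0 ->
      safe M b c1 (upd (loop (fun s x => sem c1 (upd s i 0 x)) st x) i 0 x)
  | CSkip => True
  end.

(** * Stores and frame properties *)

Lemma nat_eqbE i j : Nat.eqb i j = (i == j).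
Proof. by elim: i j => [|i IH] [|j] //=; rewrite IH. Qed.

Lemma updE st i x v j y :
  upd st i x v j y = if (j == i) && (y == x) then v else st j y.
Proof. by rewrite /upd nat_eqbE. Qed.

Lemma upd_eq st i x v : upd st i x v i x = v.
Proof. by rewrite updE !eqxx. Qed.

Lemma upd_id st i x v j y : j != i -> upd st i x v j y = st j y.
Proof. by rewrite updE => /negPf ->. Qed.

Lemma sem_frame c st j y : j \notin writes c -> sem c st j y = st j y.
Proof.
elim: c st j y => [i a e|a e|c1 IH1 c2 IH2|e c1 IH1 c2 IH2|i c IH|] st j y /=.
- by rewrite inE => ne; rewrite upd_id.
- by rewrite inE => ne; rewrite upd_id.
- by rewrite mem_cat negb_or => /andP[n1 n2]; rewrite IH2 // IH1.
- by rewrite mem_cat negb_or => /andP[n1 n2]; case: ifP; rewrite ?IH1 ?IH2.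
- rewrite inE negb_or => /andP[n1 n2]; rewrite upd_id //.
  by elim: (st 1 0) => //= x IHx; rewrite IH // upd_id.
- by [].
Qed.

(** * Translation into machine programs *)

Definition baseE := Binop Add (Const 5) (Binop Mul (Const 5) (Read (Const 1))).
Definition addrE i e := Binop Add baseE (Binop Add (Const i) (Binop Mul (Const 32) e)).
(* [a - (a - b)] is the minimum of [a] and [b]. *)
Definition minE a b := Binop Defs.Sub a (Binop Defs.Sub a b).

Fixpoint compe (e : aexp) : expr :=
  match e with
  | Cst n => Const n
  | Arr i e1 => Read (addrE i (compe e1))
  | Low e1 => Read (minE (compe e1) (Binop Defs.Sub baseE (Const 1)))
  | Op o e1 e2 => Binop o (compe e1) (compe e2)
  end.

Fixpoint compc (c : cmd) : program :=
  match c with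
  | CSet i a e => Write (addrE i (compe a)) (compe e)
  | CLow a e => Write (Binop Add (Const 2) (minE (compe a) (Binop Defs.Sub baseE (Const 3)))) (compe e)
  | CSeq c1 c2 => Seq (compc c1) (compc c2)
  | CIf e c1 c2 => If (compe e) (compc c1) (compc c2)
  | CFor i c1 =>
      Seq (Write (addrE i (Const 0)) (Const 0))
          (While (Binop Defs.Sub (compe (Arr 1 (Cst 0))) (compe (Arr i (Cst 0))))
             (Seq (compc c1)
                (Write (addrE i (Const 0)) (compe (Op Add (Arr i (Cst 0)) (Cst 1))))))
  | CSkip => Skip
  end.

(** The encoded input has length [5m + 5], with [m] in register 1; cell [x] of array [i] lies at
    offset [i + 32 * x] behind it. *)
Definition rep (mem : memory) (st : store) : Prop :=
  (forall y, y < 5 * st 32 1 + 5 -> mem y = st 32 y) /\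
  (forall i x, i < 32 -> mem (5 * st 32 1 + 5 + (i + 32 * x)) = st i x).

Lemma rep_base mem st : rep mem st -> mem 1 = st 32 1.
Proof. by case=> h _; apply: h; lia. Qed.

Lemma value_addrE mem st i e : rep mem st ->
  value mem (addrE i e) = 5 * st 32 1 + 5 + (i + 32 * value mem e).
Proof. by move=> h /=; rewrite (rep_base h); lia. Qed.

Lemma value_comp mem st e : rep mem st -> wfe e -> value mem (compe e) = ev st e.
Proof.
move=> h; elim: e => [n|i e IH|e IH|o e1 IH1 e2 IH2] //.
- move=> /= /andP[ilt we]; rewrite (rep_base h) IH // -(proj2 h i (ev st e)) //.
  by congr mem; lia.
- move=> /= we; rewrite (rep_base h) IH // -(proj1 h (minn _ _)); last lia.
  by congr mem; lia.
- by move=> /= /andP[w1 w2]; rewrite IH1 // IH2.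
Qed.

Lemma rep_set mem st i x v : rep mem st -> i < 32 ->
  rep (update mem (5 * st 32 1 + 5 + (i + 32 * x)) v) (upd st i x v).
Proof.
move=> h ilt; have [h1 h2] := h; split.
  move=> y; rewrite !upd_id ?(gtn_eqF ilt) // => ylt; rewrite /update.
  case: eqP => [e|_]; [lia | exact: h1].
move=> j y jlt; rewrite upd_id ?(gtn_eqF ilt) // updE /update.
have -> : (5 * st 32 1 + 5 + (j + 32 * y) == 5 * st 32 1 + 5 + (i + 32 * x)) =
  (j == i) && (y == x).
  by apply/eqP/andP => [e|[/eqP-> /eqP->]] //; split; apply/eqP; lia.
by case: ifP => // _; exact: h2.
Qed.

Lemma rep_low mem st x v : rep mem st -> x != 1 -> x < 5 * st 32 1 + 5 ->
  rep (update mem x v) (upd st 32 x v).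
Proof.
move=> [h1 h2] ne xlt; rewrite /rep.
have -> : upd st 32 x v 32 1 = st 32 1 by rewrite updE eq_sym (negPf ne).
split.
  by move=> y ylt; rewrite updE /update; case: eqP => //= _; exact: h1.
move=> i y ilt; rewrite upd_id ?(ltn_eqF ilt) // /update.
by case: eqP => [e|_]; [lia | exact: h2].
Qed.

(** * Bit lengths and costs *)

Definition sbnd (b : nat) (st : store) := forall i x, st i x < 2 ^ b.

Lemma rep_bound b mem st : rep mem st -> sbnd b st -> forall y, mem y < 2 ^ b.
Proof.
move=> [h1 h2] hb y; case: (ltnP y (5 * st 32 1 + 5)) => hy.
  by rewrite h1.
have -> : y = 5 * st 32 1 + 5 +
  ((y - (5 * st 32 1 + 5)) %% 32 + 32 * ((y - (5 * st 32 1 + 5)) %/ 32)) by lia.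
by rewrite h2 // ltn_pmod.
Qed.

Lemma sbnd_upd b st i x v : sbnd b st -> v < 2 ^ b -> sbnd b (upd st i x v).
Proof. by move=> hb hv j y; rewrite updE; case: ifP. Qed.

Lemma bitlen_leq b n : 0 < b -> n < 2 ^ b -> bitlen n <= b.
Proof.
move=> b0 nb; rewrite /bitlen; case: (posnP n) => [->|n0]; first by rewrite trunc_log0.
have := trunc_logP (isT : 1 < 2) n0 => h.
by rewrite -(ltn_exp2l _ _ (isT : 1 < 2)); apply: leq_ltn_trans h nb.
Qed.

Lemma ltn_bitlen n : n < 2 ^ bitlen n.
Proof. exact: trunc_log_ltn. Qed.

(** An operation yields at most one bit more than its operands have together, so for a fixed
    expression both the length of the value and the cost are linear in [b]. *)
Lemma expr_bound e : exists C, forall mem b, 0 < b -> (forall y, mem y < 2 ^ b) ->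
  value mem e < 2 ^ (C * b) /\
  cost mem e + bitlen (value mem e) <= C * b.
Proof.
have key e' C : (forall mem b, 0 < b -> (forall y, mem y < 2 ^ b) ->
    value mem e' < 2 ^ (C * b) /\ cost mem e' <= C * b) ->
  exists C, forall mem b, 0 < b -> (forall y, mem y < 2 ^ b) ->
  value mem e' < 2 ^ (C * b) /\ cost mem e' + bitlen (value mem e') <= C * b.
  move=> h; exists (C + C.+1) => mem b b0 hb; have [h1 h2] := h mem b b0 hb.
  have le : value mem e' < 2 ^ (C.+1 * b).
    by apply: leq_trans h1 _; rewrite leq_exp2l // leq_mul2r leqnSn orbT.
  split; first by apply: leq_trans le _; rewrite leq_exp2l // leq_mul2r leq_addl orbT.
  by rewrite mulnDl leq_add // bitlen_leq // muln_gt0.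
elim: e => [n|e [C IH]|o e1 [C1 IH1] e2 [C2 IH2]].
- apply: (key _ (bitlen n)) => mem b b0 _ /=; split.
    apply: leq_trans (ltn_bitlen n) _.
    by rewrite leq_exp2l // leq_pmulr.
  by rewrite leq_pmulr.
- apply: (key _ (C + 1)) => mem b b0 hb; have [h1 h2] := IH mem b b0 hb.
  rewrite [value _ _]/= [cost _ _]/=; split.
    by apply: leq_trans (hb _) _; rewrite leq_exp2l // mulnDl mul1n leq_addl.
  by rewrite mulnDl mul1n leq_add // bitlen_leq.
apply: (key _ (C1 + C2 + 1)) => mem b b0 hb.
have [h1 h2] := IH1 mem b b0 hb; have [h3 h4] := IH2 mem b b0 hb.
(* The factor 2 leaves room for the carry of a sum and is paid by the [1] in the constant, as [b] is
   positive. *)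
have hb1 : 2 ^ (C1 * b) * 2 ^ (C2 * b) * 2 <= 2 ^ ((C1 + C2 + 1) * b).
  by rewrite -!expnD -expnSr leq_exp2l // !mulnDl mul1n -addn1 leq_add.
have p1 : 0 < 2 ^ (C1 * b) by rewrite expn_gt0.
have p2 : 0 < 2 ^ (C2 * b) by rewrite expn_gt0.
split; last by move=> /=; nia.
apply: leq_trans hb1; move=> {key IH1 IH2 h2 h4 hb}.
set x := value mem e1 in h1 *; set y := value mem e2 in h3 *.
have -> : value mem (Binop o e1 e2) = binop_sem o x y by [].
move: (2 ^ (C1 * b)) (2 ^ (C2 * b)) h1 h3 p1 p2 => P Q h1 h3 p1 p2.
have hP : P <= P * Q by rewrite leq_pmulr.
have hQ : Q <= P * Q by rewrite leq_pmull.
case: o => /=.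
- lia.
- lia.
- by have : x * y < P * Q by [apply: ltn_mul]; lia.
- by have := leq_div x y; lia.
Qed.

Lemma write_bound e1 e2 : exists C, forall mem b, 0 < b -> (forall y, mem y < 2 ^ b) ->
  cost mem e1 + cost mem e2 + bitlen (value mem e1) + bitlen (value mem e2) <= C * b.
Proof.
have [C1 h1] := expr_bound e1; have [C2 h2] := expr_bound e2.
exists (C1 + C2) => mem b b0 hb.
have [_ ?] := h1 mem b b0 hb; have [_ ?] := h2 mem b b0 hb.
by rewrite mulnDl; lia.
Qed.

Lemma expn_mono M x y : x <= y -> M.+1 ^ x <= M.+1 ^ y.
Proof. by case: M => [|M] h; rewrite ?exp1n // leq_exp2l. Qed.

Definition runs (C M b : nat) (c : cmd) (st : store) (mem : memory) :=
  exists mem' T, [/\ exec (compc c) mem mem' T, rep mem' (sem c st),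
    sbnd b (sem c st) & T <= C * M.+1 ^ depth c * b].

(** Induction on the number [r] of rounds left: each pays for body, increment and test, and the
    final [Ct] pays for the failing test. *)
Lemma compc_loop C M i c b : wfc (CFor i c) -> 0 < b ->
  (forall st mem, rep mem st -> sbnd b st -> safe M b c st -> runs C M b c st mem) ->
  forall Cw, (forall mem, (forall y, mem y < 2 ^ b) ->
     cost mem (addrE i (Const 0)) + cost mem (compe (Op Add (Arr i (Cst 0)) (Cst 1))) +
     bitlen (value mem (addrE i (Const 0))) +
     bitlen (value mem (compe (Op Add (Arr i (Cst 0)) (Cst 1)))) <= Cw * b) ->
  let e := Binop Defs.Sub (compe (Arr 1 (Cst 0))) (compe (Arr i (Cst 0))) in
  forall Ct, (forall mem, (forall y, mem y < 2 ^ b) ->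
     cost mem e + bitlen (value mem e) <= Ct * b) ->
  forall st, safe M b (CFor i c) st ->
  let s x := loop (fun s x => sem c (upd s i 0 x)) st x in
  forall r x mem, x + r = st 1 0 -> rep mem (upd (s x) i 0 x) ->
    sbnd b (upd (s x) i 0 x) ->
  exists mem' T, [/\ exec (While e (Seq (compc c) (Write (addrE i (Const 0))
      (compe (Op Add (Arr i (Cst 0)) (Cst 1)))))) mem mem' T,
    rep mem' (upd (s (st 1 0)) i 0 (st 1 0)), sbnd b (upd (s (st 1 0)) i 0 (st 1 0))
    & T <= (r * (C * M.+1 ^ depth c + Cw + Ct) + Ct) * b].
Proof.
move=> wf; have /and5P[ilt i1 iw w1 wc] := wf.
move=> b0 IH Cw hCw e Ct hCt st [NM hs] s.
have s1 x : s x 1 0 = st 1 0.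
  by rewrite /s; elim: x => //= x IHx; rewrite sem_frame // upd_id // eq_sym.
have val mem x : rep mem (upd (s x) i 0 x) ->
  value mem e = st 1 0 - x.
  move=> hr; have := @value_comp _ _ (Op Defs.Sub (Arr 1 (Cst 0)) (Arr i (Cst 0))) hr.
  by rewrite /= ilt upd_eq upd_id ?[1 == i]eq_sym // s1 => -> .
elim=> [|r IHr] x mem hx hr hb.
  rewrite addn0 in hx; subst x.
  have v0 : value mem e = 0.
    by rewrite (val _ _ hr) subnn.
  exists mem; eexists; split; [exact: exec_while_false | by [] | by [] |].
  by rewrite mul0n add0n; apply: hCt; apply: rep_bound hr hb.
have xlt : x < st 1 0 by lia.
have [mem1 [T1 [e1 r1 b1 t1]]] := IH _ _ hr hb (hs _ xlt).
have vi : ev (sem c (upd (s x) i 0 x)) (Op Add (Arr i (Cst 0)) (Cst 1)) = x.+1.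
  by rewrite /= sem_frame // upd_eq addn1.
have wi : wfe (Op Add (Arr i (Cst 0)) (Cst 1)) by rewrite /= ilt.
have r2 := rep_set 0 x.+1 r1 ilt.
have x1b : x.+1 < 2 ^ b.
  by apply: leq_ltn_trans xlt _; rewrite -(s1 x); have := hb 1 0; rewrite upd_id // eq_sym.
have b2 := sbnd_upd i 0 b1 x1b.
have [mem2 [T2 [e2 r3 b3 t2]]] := IHr x.+1 _ (etrans (addSnnS _ _) hx) r2 b2.
have vaddr : value mem1 (addrE i (Const 0)) = _ + (i + 32 * 0) := value_addrE i (Const 0) r1.
exists mem2; eexists; split; [|exact: r3|exact: b3|].
  apply: exec_while_true e2; last first.
    apply: exec_seq e1 _.
    rewrite -vi -(value_comp r1 wi) -vaddr.
    exact: exec_write.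
  by rewrite (val _ _ hr); lia.
have c1 := hCt mem (rep_bound hr hb).
have c2 := hCw mem1 (rep_bound r1 b1).
set X := C * _ + Cw + Ct in t2 *.
have -> : (r.+1 * X + Ct) * b = X * b + (r * X + Ct) * b by rewrite mulSn -addnA mulnDl.
have -> : X * b = C * M.+1 ^ depth c * b + Cw * b + Ct * b by rewrite /X !mulnDl.
lia.
Qed.

(** The constant depends on the program text alone. Each level of nesting multiplies the time by at
    most a constant times [M.+1], whence the exponent [depth c]. *)
Theorem compc_correct c : wfc c -> exists C, forall M b st mem, 0 < b ->
  rep mem st -> sbnd b st -> safe M b c st -> runs C M b c st mem.
Proof.
have pos M d : 0 < M.+1 ^ d by rewrite expn_gt0.
elim: c => [i a e|a e|c1 IH1 c2 IH2|e c1 IH1 c2 IH2|i c IH|].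
- move=> /and3P[ilt wa we].
  have [C hC] := write_bound (addrE i (compe a)) (compe e).
  exists C => M b st mem b0 hr hb hs; do 2 eexists; split; first exact: exec_write.
  + by rewrite (value_addrE _ _ hr) !(value_comp hr) //; exact: rep_set.
  + exact: sbnd_upd.
  + by rewrite expn0 muln1; apply: hC => //; apply: rep_bound hr hb.
- move=> /andP[wa we].
  have [C hC] := write_bound (Binop Add (Const 2) (minE (compe a) (Binop Defs.Sub baseE (Const 3)))) (compe e).
  exists C => M b st mem b0 hr hb hs; do 2 eexists; split; first exact: exec_write.
  + rewrite (value_comp hr) //.
    have -> : value mem (Binop Add (Const 2) (minE (compe a) (Binop Defs.Sub baseE (Const 3)))) =
      2 + minn (ev st a) (5 * st 32 1 + 2).
      by rewrite /= (value_comp hr) // (rep_base hr); lia.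
    by apply: rep_low => //; lia.
  + exact: sbnd_upd.
  + by rewrite expn0 muln1; apply: hC => //; apply: rep_bound hr hb.
- move=> /= /andP[/IH1[C1 h1] /IH2[C2 h2]]; exists (C1 + C2) => M b st mem b0 hr hb [s1 s2].
  have [mem1 [T1 [e1 r1 b1 t1]]] := h1 M b st mem b0 hr hb s1.
  have [mem2 [T2 [e2 r2 b2 t2]]] := h2 M b _ mem1 b0 r1 b1 s2.
  exists mem2, (T1 + T2); split=> //; first exact: exec_seq e1 e2.
  rewrite !mulnDl leq_add //.
    by apply: leq_trans t1 _; rewrite leq_mul2r leq_mul2l expn_mono ?orbT ?leq_maxl.
  by apply: leq_trans t2 _; rewrite leq_mul2r leq_mul2l expn_mono ?orbT ?leq_maxr.
- move=> /= /and3P[we /IH1[C1 h1] /IH2[C2 h2]]; have [C hC] := expr_bound (compe e).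
  exists (C + C1 + C2) => M b st mem b0 hr hb.
  have [_ te] := hC mem b b0 (rep_bound hr hb).
  have le d1 d2 : d1 <= d2 -> forall D T, T <= D * M.+1 ^ d1 * b -> T <= D * M.+1 ^ d2 * b.
    move=> d12 D T h; apply: leq_trans h _.
    by rewrite leq_mul2r leq_mul2l expn_mono ?orbT.
  have te' : cost mem (compe e) + bitlen (value mem (compe e)) <=
     C * M.+1 ^ maxn (depth c1) (depth c2) * b.
    by apply: leq_trans te _; rewrite leq_mul2r leq_pmulr ?orbT.
  rewrite /runs /=; case: ifP => ce hs.
    have [mem1 [T1 [e1 r1 b1 t1]]] := h1 M b st mem b0 hr hb hs.
    exists mem1; eexists; split; [|exact: r1|exact: b1|].
      by apply: exec_if_true; last exact: e1; rewrite (value_comp hr).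
    have := le _ _ (leq_maxl (depth c1) (depth c2)) _ _ t1; rewrite !mulnDl; lia.
  have [mem1 [T1 [e1 r1 b1 t1]]] := h2 M b st mem b0 hr hb hs.
  exists mem1; eexists; split; [|exact: r1|exact: b1|].
    by apply: exec_if_false; last exact: e1; rewrite (value_comp hr) //; apply/eqP/negbFE.
  have := le _ _ (leq_maxr (depth c1) (depth c2)) _ _ t1; rewrite !mulnDl; lia.
- move=> wf; have /and5P[ilt i1 iw w1 wc] := wf.
  have {IH}[C IH] := IH wc.
  have [C0 h0] := write_bound (addrE i (Const 0)) (Const 0).
  have [Cw hw] := write_bound (addrE i (Const 0)) (compe (Op Add (Arr i (Cst 0)) (Cst 1))).
  have [Ct ht] := expr_bound (Binop Defs.Sub (compe (Arr 1 (Cst 0))) (compe (Arr i (Cst 0)))).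
  exists (C0 + (C + Cw + Ct + Ct)) => M b st mem b0 hr hb hs.
  have r0 := rep_set 0 0 hr ilt.
  have b00 : sbnd b (upd st i 0 0) by apply: sbnd_upd; rewrite ?expn_gt0.
  have hCw mem' := hw mem' b b0.
  have hCt mem' (h : forall y, mem' y < 2 ^ b) := proj2 (ht mem' b b0 h).
  have IH' st' mem' := IH M b st' mem' b0.
  have [mem1 [T1 [e1 r1 b1 t1]]] :=
    compc_loop wf b0 IH' hCw hCt hs (add0n (st 1 0)) r0 b00.
  exists mem1; eexists; split; [|exact: r1|exact: b1|].
    apply: exec_seq e1.
    have <- : value mem (addrE i (Const 0)) = _ + (i + 32 * 0) := value_addrE i (Const 0) hr.
    exact: exec_write.
  have c0 := h0 mem b b0 (rep_bound hr hb).
  have NM : st 1 0 <= M by case: hs.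
  rewrite mulnDl mulnDl leq_add //.
    by apply: leq_trans c0 _; rewrite leq_mul2r leq_pmulr ?orbT.
  apply: leq_trans t1 _; rewrite leq_mul2r; apply/orP; right.
  rewrite /= expnS; have := pos M (depth c); move: (M.+1 ^ depth c) => P Pp.
  apply: (@leq_trans (M.+1 * (C * P + Cw + Ct + Ct))).
    rewrite mulSn; apply: (@leq_trans (M * (C * P + Cw + Ct) + Ct)).
      by rewrite leq_add2r leq_mul2r NM orbT.
    by rewrite addnC leq_add ?leq_addl // leq_mul2l leq_addr orbT.
  rewrite [_ * (M.+1 * P)]mulnCA leq_mul2l !mulnDl -!addnA !leq_add //; try by rewrite leq_pmulr.
- by exists 1 => M b st mem b0 hr hb _; exists mem, 1; split; [exact: exec_skip|by []|by []|rewrite expn0 !mul1n].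
Qed.

(* Clipping every assigned value at the bound kept in cell 0 of array 0 bounds the
   cost of each step without any knowledge of the values computed. *)
Definition clip (e : aexp) : aexp := Op Defs.Sub e (Op Defs.Sub e (Arr 0 (Cst 0))).

Lemma ev_clip st e : ev st (clip e) = minn (ev st e) (st 0 0).
Proof. by rewrite /clip /=; lia. Qed.

Arguments clip : simpl never.

(** Excluding arrays 0 and 1 as targets keeps the bound on values and the number of rounds constant
    during the run, so both are checked on entry only. *)
Fixpoint clipped (c : cmd) : Prop :=
  match c with
  | CSet i _ e => (1 < i) /\ (forall st, ev st e <= st 0 0)
  | CLow _ e => forall st, ev st e <= st 0 0
  | CSeq c1 c2 | CIf _ c1 c2 => clipped c1 /\ clipped c2
  | CFor i c1 => (1 < i) /\ clipped c1
  | CSkip => True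
  end.

Lemma clipped_frame c st i y : clipped c -> i < 2 -> sem c st i y = st i y.
Proof.
move=> cc ilt; apply: sem_frame; apply: contraTN ilt; rewrite -leqNgt.
elim: c cc => [j a e|a e|c1 IH1 c2 IH2|e c1 IH1 c2 IH2|j c IH|] //=.
- by case=> ? _; rewrite inE => /eqP ->.
- by rewrite inE => _ /eqP ->.
- by case=> h1 h2; rewrite mem_cat => /orP[/IH1|/IH2]; apply.
- by case=> h1 h2; rewrite mem_cat => /orP[/IH1|/IH2]; apply.
- by case=> h1 h2; rewrite inE => /orP[/eqP->|/IH]; last apply.
Qed.

Lemma clipped_safe M b c st : clipped c -> st 0 0 < 2 ^ b -> st 1 0 <= M -> safe M b c st.
Proof.
elim: c st => [j a e|a e|c1 IH1 c2 IH2|e c1 IH1 c2 IH2|j c IH|] st //=.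
- by case=> _ h h1 _; apply: leq_ltn_trans h1.
- by move=> h h1 _; apply: leq_ltn_trans h1.
- by case=> h1 h2 hB hM; split; [exact: IH1|apply: IH2; rewrite ?clipped_frame].
- by case=> h1 h2 hB hM; case: ifP => _; [exact: IH1|exact: IH2].
case=> j1 h hB hM; split=> // x _.
have fr i : i < 2 -> loop (fun s x => sem c (upd s j 0 x)) st x i 0 = st i 0.
  move=> i2; elim: x => //= x IHx; rewrite clipped_frame // upd_id //.
  by rewrite ltn_eqF // (leq_trans i2).
by apply: IH => //; rewrite upd_id ?fr // ltn_eqF // (leq_trans _ j1).
Qed.

(** * Proof rules for loops *)

Lemma sem_framef c st j : j \notin writes c -> sem c st j = st j.
Proof. by move=> h; apply: functional_extensionality => y; exact: sem_frame. Qed.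

Section ForRules.
Variables (i : nat) (c : cmd) (Q : nat -> store -> Prop) (st : store).
Hypothesis Qi : forall x s v, Q x s -> Q x (upd s i 0 v).
Hypothesis Q0 : Q 0 st.
Hypothesis QS : forall x s, x < st 1 0 ->
  (forall j, j \notin i :: writes c -> s j = st j) -> s i 0 = x -> Q x s -> Q x.+1 (sem c s).

(** The frame travels with the invariant, so [Q] has to mention only what the body changes. *)
Lemma loop_inv x : x <= st 1 0 ->
  let s := upd (loop (fun s x => sem c (upd s i 0 x)) st x) i 0 x in
  Q x s /\ (forall j, j \notin i :: writes c -> s j = st j).
Proof.
have fr s v j : j \notin i :: writes c -> upd s i 0 v j = s j.
  rewrite inE negb_or => /andP[h _]; apply: functional_extensionality => y.
  exact: upd_id.
elim: x => [|x IHx] xlt /=; first by split=> [|j /fr ->//]; exact: Qi.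
have [Qx frx] := IHx (ltnW xlt); split; first by apply: Qi; apply: QS => //; rewrite upd_eq.
move=> j h; rewrite fr // sem_framef; first exact: frx.
by move: h; rewrite inE negb_or => /andP[].
Qed.

Lemma for_rule : Q (st 1 0) (sem (CFor i c) st).
Proof. by case: (loop_inv (leqnn _)). Qed.

Lemma for_safe M b : st 1 0 <= M ->
  (forall x s, x < st 1 0 -> (forall j, j \notin i :: writes c -> s j = st j) ->
     s i 0 = x -> Q x s -> safe M b c s) ->
  safe M b (CFor i c) st.
Proof.
move=> NM h; split=> // x xN; have [Qx fr] := loop_inv (ltnW xN).
by apply: h fr _ Qx => //; rewrite upd_eq.
Qed.
End ForRules.

(** * Cuts, flows and lower bounds *)

Section Cuts.
Variables (N : nat) (T H : nat -> nat).
Implicit Types (U S vul : pred nat) (f W d : nat -> nat).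

Definition crosses U e := U (T e) && ~~ U (H e).

(* Conservation tested against every potential [p]; the vertices need not be
   enumerated, and cuts are the case of an indicator. *)
Definition is_flow f s t j := forall p : nat -> nat,
  \sum_(e < N) f e * p (T e) + j * p t = \sum_(e < N) f e * p (H e) + j * p s.

Definition cut_size S U := \sum_(e < N) (S e && crosses U e).

Definition wt W S := \sum_(e < N) S e * W e.

(** The cut form of tolerating [k] faults: faults can empty a cut only if it has no safe arc and at
    most [k] arcs. *)
Definition surv (vul : pred nat) k S s t := forall U, U s -> ~~ U t ->
  (exists e, [/\ e < N, S e, crosses U e & ~~ vul e]) \/ k < cut_size S U.

Definition two_cut S s t := forall U, U s -> ~~ U t -> 1 < cut_size S U.

Lemma flow_cut f s t j U : is_flow f s t j -> U s -> ~~ U t ->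
  \sum_(e < N) f e * crosses U e =
  \sum_(e < N) f e * (~~ U (T e) && U (H e)) + j.
Proof.
move=> hf Us Ut; have := hf (fun v => U v : nat).
rewrite Us (negPf Ut) muln0 addn0 muln1.
have -> : \sum_(e < N) f e * U (T e) = \sum_(e < N) f e * crosses U e +
   \sum_(e < N) f e * (U (T e) && U (H e)).
  rewrite -big_split; apply: eq_bigr => e _; rewrite /= /crosses -mulnDr; congr muln.
  by case: (U (T e)) (U (H e)) => [] [].
have -> : \sum_(e < N) f e * U (H e) = \sum_(e < N) f e * (~~ U (T e) && U (H e)) +
   \sum_(e < N) f e * (U (T e) && U (H e)).
  rewrite -big_split; apply: eq_bigr => e _; rewrite /= -mulnDr; congr muln.
  by case: (U (T e)) (U (H e)) => [] [].
by lia.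
Qed.

Lemma flow_cut_size f s t j S U : is_flow f s t j -> U s -> ~~ U t ->
  (forall e, e < N -> crosses U e -> f e <= S e) -> j <= cut_size S U.
Proof.
move=> hf Us Ut h; apply: (@leq_trans (\sum_(e < N) f e * crosses U e)).
  by rewrite (flow_cut hf Us Ut) leq_addl.
apply: leq_sum => e _; case: (boolP (crosses U e)) => [/h|_]; last by rewrite muln0.
by rewrite muln1 andbT; apply.
Qed.

(** If no safe arc of [S] leaves the cut, every arc leaving it carries at most one unit, so [k + 1]
    units need [k + 1] arcs. *)
Lemma flow_surv vul f s t k S : is_flow f s t k.+1 ->
  (forall e, e < N -> 0 < f e -> S e) -> (forall e, e < N -> vul e -> f e <= 1) ->
  surv vul k S s t.
Proof.
move=> hf fS fv U Us Ut.
case: (boolP [exists e : 'I_N, [&& S e, crosses U e & ~~ vul e]]).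
  by case/existsP=> e /and3P[h1 h2 h3]; left; exists e.
rewrite negb_exists => /forallP h; right; apply: flow_cut_size hf Us Ut _ => e elt ce.
have := h (Ordinal elt); rewrite /= ce /=.
case: (boolP (S e)) => [_|nS _]; first by rewrite negbK => /fv; apply.
by case: (posnP (f e)) => [->|/fS]; last rewrite (negPf nS) => /(_ elt).
Qed.

Lemma flow_two_cut f s t : is_flow f s t 2 -> (forall e, e < N -> f e <= 1) ->
  two_cut (fun e => 0 < f e) s t.
Proof.
move=> hf f1 U Us Ut; apply: flow_cut_size hf Us Ut _ => e elt _.
by have := f1 e elt; case: (f e) => [|[]].
Qed.

Lemma sum_gt0 (F : nat -> nat) : 0 < \sum_(e < N) F e -> exists2 e, e < N & 0 < F e.
Proof.
rewrite lt0n sum_nat_eq0 negb_forall => /existsP[e]; rewrite implyTb -lt0n => h.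
by exists e.
Qed.

Lemma sum_ge (F : nat -> nat) e : e < N -> F e <= \sum_(i < N) F i.
Proof. by move=> elt; rewrite (bigD1 (Ordinal elt)) //= leq_addr. Qed.

(** Some arc used by [h] leaves the cut. Either it is a safe arc of [S], or the cut separates its
    ends and is therefore crossed twice by [S]. *)
Lemma path_surv vul h s t S : is_flow h s t 1 ->
  (forall e, e < N -> 0 < h e -> (S e /\ ~~ vul e) \/ two_cut S (T e) (H e)) ->
  surv vul 1 S s t.
Proof.
move=> hf hh U Us Ut.
have : 0 < \sum_(e < N) h e * crosses U e by rewrite (flow_cut hf Us Ut) addn1.
case/(@sum_gt0 (fun e => h e * crosses U e)) => e elt; rewrite muln_gt0 => /andP[h0]; case ce: (crosses U e) => // _.
case: (hh e elt h0) => [[Se ve]|]; first by left; exists e.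
by move: ce => /andP[c1 c2] /(_ U c1 c2); right.
Qed.

(** * Lower bounds from level cuts *)

Lemma sum_between p q K : \sum_(th < K) (p <= th < q) = minn q K - p.
Proof. by elim: K => [|K IH]; rewrite ?big_ord0 ?big_ord_recr /= ?IH; lia. Qed.

(** Double counting: an arc crosses the level cut of [th] exactly when [th] lies between the values
    of [d] at its ends, hence at most [d (H e) - d (T e)] times. *)
Lemma threshold S d m K :
  (forall th, th < K -> m <= cut_size S (fun v => d v <= th)) ->
  m * K <= \sum_(e < N) S e * (d (H e) - d (T e)).
Proof.
move=> h; apply: (@leq_trans (\sum_(th < K) cut_size S (fun v => d v <= th))).
  rewrite -[X in m * X]card_ord mulnC -sum_nat_const.
  by apply: leq_sum => th _; apply: h.
rewrite exchange_big; apply: leq_sum => e _.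
apply: (@leq_trans (S e * \sum_(th < K) (d (T e) <= th < d (H e)))); last first.
  by rewrite leq_mul2l sum_between; apply/orP; right; lia.
rewrite big_distrr; apply: leq_sum => th _.
by rewrite /crosses -ltnNge; case: (S e); rewrite /= ?mul1n.
Qed.

(** Since [d] never decreases along flow, no flow returns through a level cut and exactly [j] units
    leave it. An arc of [S] leaving the cut is vulnerable and carries flow, so there are at most
    [j <= k] of these, and [S'] must bring a new arc. *)
Lemma stage_bound vul W S S' f d s t j k :
  is_flow f s t j -> j <= k -> d s = 0 ->
  (forall e, e < N -> 0 < f e -> d (T e) <= d (H e)) ->
  (forall e, e < N -> S e -> ~~ vul e || (f e == 0) -> d (H e) <= d (T e)) ->
  (forall e, e < N -> S' e -> ~~ S e -> d (H e) <= d (T e) + W e) ->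
  surv vul k S' s t -> d t <= wt W (fun e => S' e && ~~ S e).
Proof.
move=> hf jk ds hb hS hW sv; rewrite -[d t]mul1n.
have thr : 1 * d t <= \sum_(e < N) (S' e && ~~ S e) * (d (H e) - d (T e)).
  apply: (@threshold (fun e => S' e && ~~ S e)) => th tht; set U := fun v => d v <= th.
  have Us : U s by rewrite /U ds.
  have Ut : ~~ U t by rewrite /U -ltnNge.
  case: (sv U Us Ut) => [[e [elt S'e ce ve]]|kc].
    apply: leq_trans (sum_ge (fun e => (S' e && ~~ S e) && crosses U e) elt).
    rewrite S'e ce andbT /= lt0b; apply/negP => Se.
    by have := hS e elt Se; rewrite ve; move: ce; rewrite /crosses /U; lia.
  have cj : \sum_(e < N) f e * crosses U e = j.
    rewrite (flow_cut hf Us Ut) big1 // => e _; case: (posnP (f e)) => [->//|fe].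
    by have := hb e (ltn_ord e) fe; rewrite /U; case: leqP; case: leqP; lia.
  have : cut_size S' U <= cut_size (fun e => S' e && ~~ S e) U + j.
    rewrite -cj /cut_size -big_split; apply: leq_sum => e _ /=.
    case: (boolP (crosses U e)) => ce; rewrite ?andbF // !andbT muln1.
    case: (boolP (S e)) => Se; last by rewrite andbT leq_addr.
    case: (posnP (f e)) => fe; last by case: (S' e); lia.
    have := hS e (ltn_ord e) Se; rewrite fe orbT => /(_ isT).
    by move: ce; rewrite /crosses /U; lia.
  by lia.
apply: leq_trans thr _; apply: leq_sum => e _.
case: (boolP (S' e && ~~ S e)) => // /andP[S'e nS]; rewrite !mul1n leq_subLR.
exact: hW.
Qed.

(** Conservation tested against [d] itself; the truncated differences are exact on arcs that carry
    flow. *)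
Lemma flow_potential f s t d : is_flow f s t 1 -> d s = 0 ->
  (forall e, e < N -> 0 < f e -> d (T e) <= d (H e)) ->
  \sum_(e < N) f e * (d (H e) - d (T e)) = d t.
Proof.
move=> hf ds hb; have := hf d; rewrite ds muln0 addn0 mul1n.
have -> : \sum_(e < N) f e * d (H e) =
  \sum_(e < N) f e * (d (H e) - d (T e)) + \sum_(e < N) f e * d (T e).
  rewrite -big_split; apply: eq_bigr => e _ /=; case: (posnP (f e)) => [->//|fe].
  by rewrite -mulnDr subnK // hb.
lia.
Qed.

(* Linear programming duality for two arc-disjoint paths: the potential [d1 + d2] is optimal,
   and only the arcs of the first path can violate it. *)
Lemma two_flow_bound W S f d1 d2 s t :
  is_flow f s t 1 -> d1 s = 0 -> d2 s = 0 ->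
  (forall e, e < N -> f e <= 1) ->
  (forall e, e < N -> 0 < f e -> d1 (H e) = d1 (T e) + W e) ->
  (forall e, e < N -> 0 < f e -> d2 (T e) <= d2 (H e)) ->
  (forall e, e < N -> S e -> f e = 0 ->
     d2 (H e) + d1 (H e) <= d2 (T e) + (W e + d1 (T e))) ->
  two_cut S s t -> 2 * d1 t + d2 t <= wt W S.
Proof.
move=> hf d1s d2s f1 tight hb hr tc.
have thr : 2 * (d1 t + d2 t) <=
    \sum_(e < N) S e * ((d1 (H e) + d2 (H e)) - (d1 (T e) + d2 (T e))).
  apply: (@threshold S (fun v => d1 v + d2 v)) => th tht; apply: tc.
    by rewrite d1s d2s.
  by rewrite -ltnNge.
(* Off the first path [d1 + d2] grows by at most [W]. On it the growth exceeds [W] by that of [d2],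
   and these excesses add up to at most [d2 t]. *)
have : \sum_(e < N) S e * ((d1 (H e) + d2 (H e)) - (d1 (T e) + d2 (T e))) <=
   wt W S + d2 t.
  rewrite -(flow_potential hf d2s hb) -big_split; apply: leq_sum => e _ /=.
  case: (boolP (S e)) => // Se; rewrite !mul1n.
  case: (posnP (f e)) => fe; first by have := hr e (ltn_ord e) Se fe; lia.
  have := tight e (ltn_ord e) fe; have := f1 e (ltn_ord e).
  have -> : f e = 1 by have := f1 e (ltn_ord e); lia.
  lia.
lia.
Qed.

(** * Decomposition of one-fault solutions *)

Lemma cut_size_le S S' U U' :
  (forall e, e < N -> S e -> crosses U e -> S' e && crosses U' e) ->
  cut_size S U <= cut_size S' U'.
Proof.
move=> h; apply: leq_sum => e _; case: (boolP (S e && _)) => // /andP[h1 h2].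
by rewrite h.
Qed.

(* If some cut is crossed by a single arc, that arc is safe and splits [S] into two
   survivable parts; otherwise every cut is crossed twice. *)
Lemma one_fault_bound (V A : pred nat) vul W d :
  (forall e, e < N -> A e -> V (T e) /\ V (H e)) ->
  (forall e, e < N -> A e -> ~~ vul e -> d (H e) <= d (T e) + W e) ->
  (forall s t S, V s -> V t -> (forall e, e < N -> S e -> A e) -> two_cut S s t ->
     d t <= d s + wt W S) ->
  forall S s t, V s -> V t -> (forall e, e < N -> S e -> A e) -> surv vul 1 S s t ->
     d t <= d s + wt W S.
Proof.
move=> AV hs h2 S; move: {2}(\sum_(e < N) S e) (leqnn (\sum_(e < N) S e)) => m.
elim/ltn_ind: m S => m IH S Sm s t Vs Vt SA sv.
(* Cuts are arbitrary predicates on numbers, so whether all of them are crossed twice is decided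
   classically. *)
case: (classic (two_cut S s t)) => [tc|]; first exact: h2.
move=> ntc; have [U hU] := not_all_ex_not _ _ ntc.
have [Us hU'] := imply_to_and _ _ hU; have [Ut /negP] := imply_to_and _ _ hU'.
rewrite -leqNgt => cU {ntc hU hU'}.
have [a [alt Sa ca va]] : exists e, [/\ e < N, S e, crosses U e & ~~ vul e].
  by case: (sv U Us Ut) => // h; rewrite leqNgt h in cU.
have uniq e : e < N -> S e -> crosses U e -> e = a.
  move=> elt Se ce; apply/eqP; apply: contraLR cU => ne; rewrite -ltnNge /cut_size.
  rewrite (bigD1 (Ordinal alt)) //= (bigD1 (Ordinal elt)) //=.
  by rewrite Sa Se ca ce.
pose S1 e := [&& S e, U (T e) & U (H e)].
pose S2 e := [&& S e, ~~ U (T e) & ~~ U (H e)].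
have /andP[aT aH] := ca.
have [VT VH] := AV a alt (SA a alt Sa).
have lt1 : \sum_(e < N) S1 e < m.
  apply: leq_trans Sm; rewrite (bigD1 (Ordinal alt)) //= [X in _ < X](bigD1 (Ordinal alt)) //=.
  rewrite /S1 (negPf aH) !andbF Sa add0n add1n ltnS; apply: leq_sum => e _.
  by case: (S e); case: (U _); case: (U _).
have lt2 : \sum_(e < N) S2 e < m.
  apply: leq_trans Sm; rewrite (bigD1 (Ordinal alt)) //= [X in _ < X](bigD1 (Ordinal alt)) //=.
  rewrite /S2 aT !andbF Sa add0n add1n ltnS; apply: leq_sum => e _.
  by case: (S e); case: (U _); case: (U _).
(* A cut [U'] of the first part is intersected with [U]. The arc [a] does not leave the intersection
   because its tail is outside [U'], so whatever leaves it belongs to [S1]. *)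
have sv1 : surv vul 1 S1 s (T a).
  move=> U' U's U't; pose U2 v := U v && U' v.
  have key e : e < N -> S e -> crosses U2 e -> S1 e && crosses U' e.
    move=> elt Se /andP[/andP[u1 u2]]; rewrite negb_and => /orP[n1|n2].
      by move: U't; rewrite -(uniq e elt Se) ?u2 // /crosses u1.
    case u3: (U (H e)); first by rewrite /S1 Se u1 u3 /crosses u2.
    by move: U't; rewrite -(uniq e elt Se) ?u2 // /crosses u1 u3.
  case: (sv U2) => [|||h].
  - by rewrite /U2 Us.
  - by rewrite /U2 (negPf Ut).
  - by case=> e [e1 e2 e3 e4]; left; exists e; have /andP[] := key e e1 e2 e3.
  - by right; apply: leq_trans h (cut_size_le key).
(* Dually with the union of [U] and [U'], which [a] does not leave because its head is in [U']. *)
have sv2 : surv vul 1 S2 (H a) t.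
  move=> U' U's U't; pose U2 v := U v || U' v.
  have key e : e < N -> S e -> crosses U2 e -> S2 e && crosses U' e.
    move=> elt Se; rewrite /crosses negb_or => /andP[u1 /andP[u2 u3]].
    case u4: (U (T e)); last first.
      by move: u1; rewrite /U2 u4 /= => u5; rewrite /S2 Se u4 u2 u5.
    by move: u3; rewrite (uniq e elt Se) ?U's // /crosses u4.
  case: (sv U2) => [|||h].
  - by rewrite /U2 Us.
  - by rewrite /U2 (negPf Ut).
  - by case=> e [e1 e2 e3 e4]; left; exists e; have /andP[] := key e e1 e2 e3.
  - by right; apply: leq_trans h (cut_size_le key).
have w12 : wt W S1 + W a + wt W S2 <= wt W S.
  rewrite /wt [X in X + _ + _](bigD1 (Ordinal alt)) //= [X in _ + X](bigD1 (Ordinal alt)) //=.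
  rewrite [X in _ <= X](bigD1 (Ordinal alt)) //= /S1 /S2 aT (negPf aH) !andbF Sa.
  rewrite !mul0n !add0n mul1n [_ + W a]addnC -addnA leq_add2l -big_split.
  by apply: leq_sum => e _; case: (S e); case: (U _); case: (U _); rewrite /= ?mul0n ?addn0.
have SA1 e : e < N -> S1 e -> A e by move=> elt /and3P[/SA] ->.
have SA2 e : e < N -> S2 e -> A e by move=> elt /and3P[/SA] ->.
have b1 := IH _ lt1 S1 (leqnn _) s (T a) Vs VT SA1 sv1.
have b2 := IH _ lt2 S2 (leqnn _) (H a) t VH Vt SA2 sv2.
have b3 := hs a alt (SA a alt Sa) va.
apply: leq_trans b2 _; apply: (@leq_trans (d s + (wt W S1 + W a + wt W S2))).
  by rewrite !addnA leq_add2r (leq_trans b3) // leq_add2r.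
by rewrite leq_add2l.
Qed.

(** If [m <= k'], no cut of [S] can have more than [k'] arcs, so a safe arc crosses every cut and
    any number of faults is tolerated. *)
Lemma surv_weaken vul k k' m S s t : (forall e, e < N -> S e -> e < m) ->
  (k <= k') || (m <= k') -> surv vul k' S s t -> surv vul k S s t.
Proof.
move=> Sm kk sv U Us Ut; case: (sv U Us Ut) => [|h]; [by left|right].
case/orP: kk => [kk|mk]; first exact: leq_ltn_trans h.
suff : cut_size S U <= m by lia.
apply: (@leq_trans (\sum_(e < N) (e < m))).
  apply: leq_sum => e _; case: (boolP (S e)) => // Se.
  by rewrite (Sm e) ?ltn_ord // leq_b1.
rewrite (eq_bigr (fun e : 'I_N => (0 <= e < m) : nat)) // sum_between; lia.
Qed.

End Cuts.

(** * Dijkstra's algorithm on residual graphs *)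

Definition fupd (g : nat -> nat) (x v : nat) : nat -> nat :=
  fun y => if y == x then v else g y.

Lemma fupd_eq g x v : fupd g x v x = v.
Proof. by rewrite /fupd eqxx. Qed.

Lemma fupd_ne g x v y : y != x -> fupd g x v y = g y.
Proof. by rewrite /fupd => /negPf ->. Qed.

Lemma sum_fupd N (K : nat -> nat -> nat) g e v : e < N ->
  \sum_(y < N) K y (fupd g e v y) + K e (g e) = \sum_(y < N) K y (g y) + K e v.
Proof.
move=> elt; rewrite (bigD1 (Ordinal elt)) //= [X in _ = X + _](bigD1 (Ordinal elt)) //=.
rewrite fupd_eq (eq_bigr (fun y : 'I_N => K y (g y))); first by lia.
by move=> y ne; rewrite fupd_ne //; apply: contraNneq ne => ey; apply/eqP/val_inj.
Qed.

Section Dijkstra.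
Variables (N n B : nat) (T H f cap c : nat -> nat) (src : nat).
Hypothesis (nN : n < N) (srcn : src < n).
Hypothesis capV : forall e, e < N -> 0 < cap e -> T e < n /\ H e < n.
Hypothesis fcap : forall e, e < N -> f e <= cap e.

(* The residual arc [(e, b)] is the arc [e] if [b = false] and its reverse otherwise;
   reverse arcs are free. *)
Definition rok e (b : bool) := if b then 0 < f e else f e < cap e.
Definition rtail e (b : bool) := if b then H e else T e.
Definition rhead e (b : bool) := if b then T e else H e.
Definition rcost e (b : bool) := if b then 0 else c e.

Lemma rok_vertices e b : e < N -> rok e b -> rtail e b < n /\ rhead e b < n.
Proof.
move=> elt h; have [] : T e < n /\ H e < n; last by case: b {h}.
by apply: capV => //; have := fcap elt; case: b h => /=; lia.
Qed.

Definition enters (d p : nat -> nat) w u := exists e b,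
  [/\ e < N, rok e b, p w = 2 * e + b, rhead e b = w & rtail e b = u /\ d w = d u + rcost e b].

(** [vis w] is the round in which [w] was visited, 0 if it has not been; [done] tells which residual
    arcs of visited tails are already relaxed. Cells from [n] to [N] stay at distance [B], because
    the loops of the program run over them too. The order of visits in [di_pred] makes walks along
    predecessors terminate. *)
Record dinv (d p vis : nat -> nat) (i : nat) (done : nat -> bool -> bool) : Prop := Dinv {
  di_src : d src = 0;
  di_le : forall w, w < N -> d w <= B;
  di_out : forall w, w < N -> n <= w -> d w = B;
  di_mono : forall u w, u < n -> w < n -> 0 < vis u -> vis w = 0 -> d u <= d w;
  di_arc : forall e b, e < N -> rok e b -> done e b -> 0 < vis (rtail e b) ->
    d (rhead e b) <= d (rtail e b) + rcost e b;
  di_pred : forall w, w < n -> w != src -> d w < B ->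
    exists u, [/\ u < n, enters d p w u, 0 < vis u & 0 < vis w -> vis u < vis w];
  di_vis : forall w, w < n -> vis w <= i
}.

Lemma dinv_init d p vis : d src = 0 -> (forall w, w < N -> w != src -> d w = B) ->
  (forall w, w < N -> vis w = 0) -> dinv d p vis 0 (fun _ _ => true).
Proof.
move=> ds dB v0; have v0n w : w < n -> vis w = 0 by move=> /ltn_trans/(_ nN)/v0.
split=> //.
- by move=> w wN; case: (eqVneq w src) => [->|/(dB w wN)->]; rewrite ?ds.
- by move=> w wN nw; apply: dB => //; apply: contraTneq nw => ->; rewrite -ltnNge.
- by move=> u w /v0n ->.
- by move=> e b elt re _; have [/v0n ->] := rok_vertices elt re.
- by move=> w wn ws; rewrite dB ?ltnn // (ltn_trans wn).
- by move=> w /v0n ->.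
Qed.

Lemma dinv_choose d p vis i u : dinv d p vis i (fun _ _ => true) ->
  u < n -> vis u = 0 -> (forall w, w < n -> vis w = 0 -> d u <= d w) ->
  dinv d p (fupd vis u i.+1) i.+1 (fun e b => rtail e b != u).
Proof.
move=> [h1 h2 h3 h4 h5 h6 h7] un vu um; split=> //.
- move=> x w xn wn; rewrite {2}/fupd; case: eqP => // wu vx vw.
  by move: vx; rewrite /fupd; case: eqP => [-> _|_ vx]; [exact: um|exact: h4].
- by move=> e b elt re ne; rewrite fupd_ne // => v; apply: h5.
- move=> w wn ws dw; have [x [xn ex vx xw]] := h6 w wn ws dw.
  have xu : x != u by apply: contraTneq vx => ->; rewrite vu.
  exists x; split=> //; rewrite (fupd_ne _ _ xu) //.
  by rewrite /fupd; case: eqP => // _ _; rewrite ltnS h7.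
- by move=> w wn; rewrite /fupd; case: eqP => // _; apply: leqW; exact: h7.
Qed.

(** While [u] is scanned, every visited vertex is at distance at most [d u]; a strict improvement
    therefore only happens at an unvisited head. *)
Definition rinv d p vis i u done := [/\ dinv d p vis i done, u < n, 0 < vis u &
  forall w, w < n -> 0 < vis w -> d w <= d u].

Lemma rinv_choose d p vis i u : dinv d p vis i (fun _ _ => true) ->
  u < n -> vis u = 0 -> (forall w, w < n -> vis w = 0 -> d u <= d w) ->
  rinv d p (fupd vis u i.+1) i.+1 u (fun e b => rtail e b != u).
Proof.
move=> h un vu um; split=> //; [exact: dinv_choose|by rewrite fupd_eq|].
by move=> w wn; rewrite /fupd; case: eqP => [->//|_ vw]; apply: (di_mono h).
Qed.

Lemma rinv_skip d p vis i u (done done' : nat -> bool -> bool) e b : e < N ->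
  rinv d p vis i u done ->
  (forall e' b', done' e' b' -> done e' b' \/ (e' = e /\ b' = b)) ->
  ~~ [&& rok e b, rtail e b == u & d u + rcost e b < d (rhead e b)] ->
  (done e b || (rtail e b == u)) ->
  rinv d p vis i u done'.
Proof.
move=> elt [[h1 h2 h3 h4 h5 h6 h7] un vu um] dd nb db; split=> //; split=> //.
move=> e' b' elt' re' /dd[de'|[? ?]] vt; first exact: h5.
subst e' b'; case/orP: db => [de|/eqP tu]; first exact: h5.
by move: nb; rewrite re' tu eqxx /= -leqNgt.
Qed.

Lemma rinv_step d p vis i u (done done' : nat -> bool -> bool) e b : e < N ->
  rinv d p vis i u done ->
  (forall e' b', done' e' b' -> done e' b' \/ (e' = e /\ b' = b)) ->
  rok e b -> rtail e b = u -> d u + rcost e b < d (rhead e b) ->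
  rinv (fupd d (rhead e b) (d u + rcost e b)) (fupd p (rhead e b) (2 * e + b)) vis i u done'.
Proof.
move=> elt [[h1 h2 h3 h4 h5 h6 h7] un vu um] dd re tu lt.
set w := rhead e b in lt *; set dw := d u + _ in lt *.
have [_ wn] := rok_vertices elt re; rewrite -/w in wn.
have vw : vis w = 0.
  by apply/eqP; rewrite -leqn0 leqNgt; apply/negP => /(um _ wn); rewrite /dw in lt; lia.
have vne x : 0 < vis x -> x != w by apply: contraTneq => ->; rewrite vw.
have dle x : fupd d w dw x <= d x by rewrite /fupd; case: eqP => // ->; exact: ltnW.
have uw := vne u vu; split=> //; first split=> //.
- by have := dle src; rewrite h1 leqn0 => /eqP.
- by move=> x xN; apply: leq_trans (dle x) (h2 x xN).
- by move=> x xN nx; rewrite fupd_ne ?h3 //; apply: contraTneq nx => ->; rewrite -ltnNge.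
- move=> x y xn yn vx vy; rewrite fupd_ne ?vne // /fupd; case: eqP => [yw|_]; last exact: h4.
  by apply: leq_trans (um x xn vx) _; rewrite /dw leq_addr.
- move=> e' b' elt' re' /dd[de'|[? ?]] vt.
    by apply: leq_trans (dle _) _; rewrite fupd_ne ?vne //; exact: h5.
  by subst e' b'; rewrite fupd_eq fupd_ne ?vne // tu.
- move=> x xn xs; case: (eqVneq x w) => [->|xw].
    move=> _; exists u; split=> //; last by rewrite vw.
    exists e, b; rewrite !fupd_eq; split=> //; split=> //; rewrite fupd_ne //.
  rewrite fupd_ne // => dx; have [y [yn ey vy yx]] := h6 x xn xs dx.
  exists y; split=> //; have [e' [b' [q1 q2 q3 q4 [q5 q6]]]] := ey.
  by exists e', b'; rewrite (fupd_ne p _ xw) (fupd_ne d _ xw) (fupd_ne d _ (vne y vy)).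
- by move=> x xn vx; rewrite !fupd_ne ?vne //; exact: um.
Qed.

Lemma rinv_sub d p vis i u (done done' : nat -> bool -> bool) :
  (forall e b, e < N -> done' e b -> done e b) -> rinv d p vis i u done -> rinv d p vis i u done'.
Proof.
by move=> dd [[h1 h2 h3 h4 h5 h6 h7] ? ? ?]; split=> //; split=> // e b elt re /(dd e b elt); apply: h5.
Qed.

Lemma rinv_done d p vis i u (done : nat -> bool -> bool) :
  (forall e b, e < N -> done e b) -> rinv d p vis i u done -> dinv d p vis i (fun _ _ => true).
Proof. by move=> dd [[h1 h2 h3 h4 h5 h6 h7] _ _ _]; split=> // e b elt re _; apply: h5 => //; exact: dd. Qed.

Definition settled (d vis : nat -> nat) := forall w, w < n -> d w < B -> 0 < vis w.

(** A tail at distance [B] imposes nothing, as all distances are at most [B]; any other tail has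
    been visited. *)
Lemma dinv_feasible d p vis i : dinv d p vis i (fun _ _ => true) -> settled d vis ->
  forall e b, e < N -> rok e b -> d (rhead e b) <= d (rtail e b) + rcost e b.
Proof.
move=> h st e b elt re; have [tn hn] := rok_vertices elt re.
case: (ltnP (d (rtail e b)) B) => hd; first by apply: (di_arc h) => //; exact: st.
apply: leq_trans (di_le h _) _; first exact: ltn_trans nN.
by apply: leq_trans hd (leq_addr _ _).
Qed.

(** * Following predecessors back to the source *)

Section Trace.
Variables (d p vis : nat -> nat) (dst : nat).
Hypothesis dstn : dst < n.
Hypothesis dinvh : dinv d p vis N (fun _ _ => true).
Hypothesis settledh : settled d vis.
Hypothesis ddst : d dst < B.

(** [g] is [f] augmented along the part of the path from [v] to [dst]; [ti_flow] says without
    subtraction that [g - f] is a unit flow from [v] to [dst]. Stamps fall along predecessors, so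
    the arcs still ahead carry [f] and [src] is reached within [N] steps. *)
Record tinv (g : nat -> nat) (v i : nat) : Prop := Tinv {
  ti_v : v < n;
  ti_d : d v < B;
  ti_count : v = src \/ vis v + i <= N;
  ti_flow : forall q : nat -> nat,
    \sum_(e < N) g e * q (T e) + q dst + \sum_(e < N) f e * q (H e) =
    \sum_(e < N) g e * q (H e) + q v + \sum_(e < N) f e * q (T e);
  ti_same : forall e, e < N -> maxn (vis (T e)) (vis (H e)) <= vis v -> g e = f e;
  ti_cap : forall e, e < N -> g e <= minn (cap e) (f e).+1;
  ti_tight : forall e, e < N -> f e < g e -> d (H e) = d (T e) + c e;
  ti_cost : \sum_(e < N) c e * (g e - f e) + d v <= d dst
}.

Lemma tinv_init : tinv f dst 0.
Proof.
split=> //; first by right; rewrite addn0; exact: (di_vis dinvh).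
- by move=> q; lia.
- by move=> e elt; rewrite leq_min leqnSn fcap.
- by move=> e _; rewrite ltnn.
- by rewrite big1 // => e _; rewrite subnn muln0.
Qed.

Lemma tinv_stop g i : tinv g src i -> tinv g src i.+1.
Proof. by move=> [*]; split=> //; left. Qed.

Lemma tinv_step g v i : tinv g v i -> v != src -> exists e (b : bool),
  [/\ e < N, p v = 2 * e + b, g e = f e, rok e b &
      tinv (fupd g e (if b then (f e).-1 else (f e).+1)) (rtail e b) i.+1].
Proof.
move=> [h1 h2 h3 h4 h5 h6 h7 h8] vs.
have [u [un [e [b [elt re pe hw [tu de]]]] vu uv]] := di_pred dinvh h1 vs h2.
have {}uv := uv (settledh h1 h2).
have ge : g e = f e.
  by apply: h5 => //; case: b hw tu {re pe de} => /= -> ->; lia.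
exists e, b; split=> //; rewrite tu.
set x := if b then _ else _.
have vc : vis v + i <= N by case: h3 vs => // ->; rewrite eqxx.
split=> //.
- by apply: leq_ltn_trans h2; rewrite de leq_addr.
- by right; lia.
- move=> q; have := h4 q.
  have := sum_fupd (fun y a => a * q (T y)) g x elt.
  have := sum_fupd (fun y a => a * q (H y)) g x elt.
  rewrite /= ge /x; case: b re hw tu {pe de x} => /= re -> ->; last by lia.
  case: (f e) re => // k _ /=; lia.
- move=> e' elt' mx; rewrite fupd_ne; first by apply: h5 => //; lia.
  apply: contraTneq mx => ->; rewrite -ltnNge.
  by case: b hw tu {re pe de x} => /= -> ->; lia.
- move=> e' elt'; rewrite /fupd; case: eqP => [->|_]; last exact: h6.
  by have := fcap elt; rewrite /x leq_min; case: b re {hw tu pe de x} => /=; lia.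
- move=> e' elt'; rewrite /fupd; case: eqP => [->|_]; last exact: h7.
  by rewrite /x; case: b re hw tu de {pe x} => /= re hw tu de; [lia|rewrite hw tu].
- have := sum_fupd (fun y a => c y * (a - f y)) g x elt.
  rewrite /= ge subnn muln0 addn0 => ->.
  have : c e * (x - f e) <= rcost e b.
    by rewrite /x; case: b {re hw tu pe de x} => /=; nia.
  by move=> h; apply: leq_trans h8; rewrite de [d u + _]addnC addnA leq_add2r leq_add2l.
Qed.

End Trace.
End Dijkstra.

(** * One augmentation *)

Declare Scope aexp_scope.
Delimit Scope aexp_scope with AE.
Bind Scope aexp_scope with aexp.
Notation "a + b" := (Op Add a b) : aexp_scope.
Notation "a - b" := (Op Defs.Sub a b) : aexp_scope.
Notation "a * b" := (Op Mul a b) : aexp_scope.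
Notation "a / b" := (Op Div a b) : aexp_scope.
Notation "i .[ e ]" := (Arr i%N e) : aexp_scope.
Notation "$ i" := (Arr i%N (Cst 0)) (at level 1, format "$ i") : aexp_scope.
Notation "# n" := (Cst n%N) (at level 1, format "# n") : aexp_scope.

Definition asg i a e := CSet i a (clip e).
Arguments asg i%_N a%_AE e%_AE.
Definition asv i e := asg i (Cst 0) e.
Arguments asv i%_N e%_AE.
Arguments CIf e%_AE c1 c2 : rename.

(* Array 0 holds the bound on all values, array 1 the number of rounds of every loop,
   array 2 the common denominator of the weights; 26, 27 and 28 are loop counters. *)
Notation iT := 3 (only parsing).
Notation iH := 4 (only parsing).
Notation iW := 5 (only parsing).
Notation iVul := 6 (only parsing).
Notation iF := 7 (only parsing).
Notation iCap := 8 (only parsing).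
Notation iC := 9 (only parsing).
Notation iD := 10 (only parsing).
Notation iP := 11 (only parsing).
Notation iVis := 12 (only parsing).
Notation iS := 13 (only parsing).
Notation iSrc := 14 (only parsing).
Notation iDst := 15 (only parsing).
Notation iV := 16 (only parsing).
Notation iU := 17 (only parsing).
Notation iBd := 18 (only parsing).
Notation iOk := 19 (only parsing).
Notation iR1 := 20 (only parsing).
Notation iUse := 21 (only parsing).
Notation iM := 22 (only parsing).
Notation iE := 23 (only parsing).
Notation iR := 24 (only parsing).
Notation iArc := 25 (only parsing).

Definition eqE (a b : aexp) : aexp := (#1 - ((a - b) + (b - a)))%AE.

Lemma ev_eqE st a b : ev st (eqE a b) = (ev st a == ev st b).
Proof. by rewrite /eqE /=; case: eqP; lia. Qed.
Arguments eqE : simpl never.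

Definition init_dist := CFor 27 (CSeq (asg iD $27 $0) (asg iVis $27 #0)).

(* Vertices at distance [$0] count as unreachable and are never visited. *)
Definition find_min :=
  CSeq (asv iBd $0)
    (CFor 28 (CIf ((#1 - iVis.[$28]) * ($iBd - iD.[$28]))
       (CSeq (asv iU $28) (asv iBd iD.[$28])) CSkip)).

Definition relax_fwd :=
  CIf ((iCap.[$28] - iF.[$28]) * eqE (Arr iT $28) ($iU) * (iD.[iH.[$28]] - (iD.[$iU] + iC.[$28])))
    (CSeq (asg iD iH.[$28] (iD.[$iU] + iC.[$28])) (asg iP iH.[$28] (#2 * $28))) CSkip.
Definition relax_bwd :=
  CIf (iF.[$28] * eqE (Arr iH $28) ($iU) * (iD.[iT.[$28]] - iD.[$iU]))
    (CSeq (asg iD iT.[$28] iD.[$iU]) (asg iP iT.[$28] (#2 * $28 + #1))) CSkip.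
Definition relax := CFor 28 (CSeq relax_fwd relax_bwd).

Definition visit :=
  CSeq find_min
    (CIf ($0 - $iBd) (CSeq (asg iVis $iU ($27 + #1)) relax) CSkip).

Definition dijkstra := CSeq init_dist (CSeq (asg iD $iSrc #0) (CFor 27 visit)).

(* [iP] stores the residual arc [(e, b)] as [2 * e + b]. *)
Definition trace_step :=
  CSeq (asv iArc (iP.[$iV] / #2))
    (CIf (iP.[$iV] - #2 * $iArc)
       (CSeq (asg iF $iArc (iF.[$iArc] - #1)) (asv iV iH.[$iArc]))
       (CSeq (asg iF $iArc (iF.[$iArc] + #1)) (asv iV iT.[$iArc]))).

Definition trace :=
  CIf ($0 - iD.[$iDst])
    (CSeq (asv iV $iDst)
       (CFor 27 (CIf (#1 - eqE ($iV) ($iSrc)) trace_step CSkip))) CSkip.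

Definition augment := CSeq dijkstra trace.

(** * Correctness of one augmentation *)

Lemma sem_asg i a e st : sem (asg i a e) st = upd st i (ev st a) (minn (ev st e) (st 0 0)).
Proof. by rewrite -ev_clip. Qed.

Lemma ev_mul st a b : ev st (a * b)%AE = ev st a * ev st b.
Proof. by []. Qed.

Lemma ev_sub st a b : ev st (a - b)%AE = ev st a - ev st b.
Proof. by []. Qed.

Lemma sem_if e c1 c2 st :
  sem (CIf e c1 c2) st = if ev st e != 0 then sem c1 st else sem c2 st.
Proof. by []. Qed.

Lemma sem_seq c1 c2 st : sem (CSeq c1 c2) st = sem c2 (sem c1 st).
Proof. by []. Qed.

Section Augment.
Variables (N n B : nat) (T H cap c : nat -> nat) (src dst : nat).

Definition genv (s : store) := [/\ s 0 0 = B, s 1 0 = N, s iT = T & s iH = H] /\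
  [/\ s iCap = cap, s iC = c, s iSrc 0 = src & s iDst 0 = dst].

Lemma genv_frame cm s :
  all (fun j => j \notin writes cm) [:: 0; 1; iT; iH; iCap; iC; iSrc; iDst] ->
  genv s -> genv (sem cm s).
Proof.
case/and5P=> h0 h1 h2 h3 /and5P[h4 h5 h6 h7 _] [[? ? ? ?] [? ? ? ?]].
by rewrite /genv !sem_framef.
Qed.

Hypothesis (nN : n < N) (srcn : src < n) (dstn : dst < n) (NB : 2 * N < B).
Hypothesis capV : forall e, e < N -> 0 < cap e -> T e < n /\ H e < n.
Hypothesis capB : forall e, e < N -> cap e <= B.

Lemma init_distP s : genv s -> forall w, w < N ->
  sem init_dist s iD w = B /\ sem init_dist s iVis w = 0.
Proof.
move=> gs; have [[s0 s1 _ _] _] := gs; rewrite -s1.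
apply: (@for_rule 27 _ (fun x s => forall w, w < x -> s iD w = B /\ s iVis w = 0)) => //.
move=> x st xN fr sx IH w; rewrite sem_seq !sem_asg /= sx fr // s0 minnn min0n /upd /= sx.
by rewrite ltnS leq_eqVlt => /orP[/eqP->|/IH[h1 h2]]; [rewrite eqxx|case: eqP].
Qed.

Section Flow.
Variable f : nat -> nat.
Hypothesis fcap : forall e, e < N -> f e <= cap e.

Lemma find_minP s : genv s -> (forall v, v < N -> s iD v <= B) ->
  let s' := sem find_min s in
  (forall v, v < N -> s iVis v = 0 -> s' iBd 0 <= s iD v) /\
  (s' iBd 0 = B \/ [/\ s' iBd 0 < B, s' iU 0 < N, s iVis (s' iU 0) = 0
     & s iD (s' iU 0) = s' iBd 0]).
Proof.
move=> gs dB s'; have [[s0 s1 _ _] _] := gs.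
pose Q x (t : store) := [/\ t iD = s iD, t iVis = s iVis,
  (forall v, v < x -> s iVis v = 0 -> t iBd 0 <= s iD v) &
  (t iBd 0 = B \/ [/\ t iBd 0 < B, t iU 0 < N, s iVis (t iU 0) = 0
     & s iD (t iU 0) = t iBd 0])].
suff [] : Q N s' by [].
rewrite /s' /find_min sem_seq /asv sem_asg; set s2 := upd _ _ _ _.
have -> : N = s2 1 0 by rewrite -s1.
apply: (@for_rule 28 _ Q) => //.
  by split=> //; left; rewrite /s2 upd_eq /= s0 minnn.
move=> x t xN fr tx [q1 q2 q3 q4]; rewrite sem_if.
have t0 : t 0 0 = B by rewrite fr.
have {}xN : x < N by rewrite -s1.
have -> : (ev t ((#1 - iVis.[$28]) * ($iBd - iD.[$28]))%AE != 0) =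
    (s iVis x == 0) && (s iD x < t iBd 0).
  by rewrite /= tx q1 q2 muln_eq0 negb_or; lia.
have tB : t iBd 0 <= B by case: q4 => [->|[/ltnW]].
case: ifP => [/andP[/eqP vx dx]|nv]; rewrite ?sem_seq ?sem_asg.
  split=> //=.
  - rewrite /upd /= tx t0 q1 => v vx1 vv.
    rewrite (minn_idPl (dB _ xN)).
    move: vx1; rewrite ltnS leq_eqVlt => /orP[/eqP->//|vlt].
    by apply: leq_trans (ltnW dx) (q3 _ vlt vv).
  - right; rewrite /upd /= tx t0 q1.
    by rewrite (minn_idPl (dB _ xN)) (minn_idPl (_ : x <= B)) //; [split=> //; lia|lia].
split=> //= v; rewrite ltnS leq_eqVlt => /orP[/eqP->|/q3//] vx.
by move: nv; rewrite vx eqxx /= => /negbT; rewrite -leqNgt.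
Qed.

Definition rinvs s vis i u := rinv N n B T H f cap c src (s iD) (s iP) vis i u.

Lemma relax_fwdP s vis i u x : genv s -> s iF = f -> s 28 0 = x -> x < N -> s iU 0 = u ->
  rinvs s vis i u (fun e b => (rtail T H e b != u) || (e < x)) ->
  rinvs (sem relax_fwd s) vis i u
    (fun e b => (rtail T H e b != u) || (e < x) || ((e == x) && ~~ b)).
Proof.
move=> [[s0 s1 sT sH] [sc scc _ _]] sf s28 xN su ri; rewrite sem_if.
have -> : (ev s ((iCap.[$28] - iF.[$28]) * eqE (Arr iT $28) ($iU) *
    (iD.[iH.[$28]] - (iD.[$iU] + iC.[$28])))%AE != 0) =
  [&& rok f cap x false, rtail T H x false == u &
     s iD u + rcost c x false < s iD (rhead T H x false)].
  rewrite andbA !ev_mul !muln_eq0 !negb_or ev_eqE /=.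
  by rewrite s28 su sT sH sc scc sf; case: (T x == u); rewrite /= ?andbF //; lia.
have mono e' b' : (rtail T H e' b' != u) || (e' < x) || ((e' == x) && ~~ b') ->
   (rtail T H e' b' != u) || (e' < x) \/ e' = x /\ b' = false.
  by case/orP=> [->|/andP[/eqP-> /negPf->]]; [left|right].
case: ifP => [/and3P[h1 /eqP h2 h3]|nb]; last first.
  apply: (rinv_skip xN ri mono); first by rewrite nb.
  by rewrite /= ltnn orbF orNb.
have dB : s iD (rhead T H x false) <= B.
  case: ri => [di _ _ _]; apply: (di_le di).
  by have [_ /ltn_trans] := rok_vertices nN srcn capV fcap xN h1; apply.
have := rinv_step nN srcn capV fcap xN ri mono h1 h2 h3.
rewrite sem_seq !sem_asg /rinvs /upd /= s28 su s0 sH scc.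
rewrite /rcost /rhead in h3 dB *.
rewrite (minn_idPl (leq_trans (ltnW h3) dB)) (minn_idPl (_ : 2 * x <= B)) ?addn0 //; lia.
Qed.

Lemma relax_bwdP s vis i u x : genv s -> s iF = f -> s 28 0 = x -> x < N -> s iU 0 = u ->
  rinvs s vis i u
    (fun e b => (rtail T H e b != u) || (e < x) || ((e == x) && ~~ b)) ->
  rinvs (sem relax_bwd s) vis i u (fun e b => (rtail T H e b != u) || (e < x.+1)).
Proof.
move=> [[s0 s1 sT sH] [sc scc _ _]] sf s28 xN su ri; rewrite sem_if.
have -> : (ev s (iF.[$28] * eqE (Arr iH $28) ($iU) * (iD.[iT.[$28]] - iD.[$iU]))%AE != 0) =
  [&& rok f cap x true, rtail T H x true == u &
     s iD u + rcost c x true < s iD (rhead T H x true)].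
  rewrite andbA !ev_mul !muln_eq0 !negb_or ev_eqE /=.
  by rewrite s28 su sT sH sf; case: (H x == u); rewrite /= ?andbF //; lia.
have mono e' b' : (rtail T H e' b' != u) || (e' < x.+1) ->
   (rtail T H e' b' != u) || (e' < x) || ((e' == x) && ~~ b') \/ e' = x /\ b' = true.
  rewrite ltnS leq_eqVlt; case: (rtail T H e' b' != u) => /=; first by left.
  case: eqP => [->|_] /= h; last by left; rewrite h.
  by case: b'; [right|left; rewrite orbT].
case: ifP => [/and3P[h1 /eqP h2 h3]|nb]; last first.
  apply: (rinv_skip xN ri mono); first by rewrite nb.
  by rewrite /= ltnn andbF !orbF orNb.
have dB : s iD (rhead T H x true) <= B.
  case: ri => [di _ _ _]; apply: (di_le di).
  by have [_ /ltn_trans] := rok_vertices nN srcn capV fcap xN h1; apply.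
have := rinv_step nN srcn capV fcap xN ri mono h1 h2 h3.
rewrite sem_seq !sem_asg /rinvs /upd /= s28 su s0 sT.
rewrite /rcost /rhead addn0 in h3 dB *.
rewrite (minn_idPl (leq_trans (ltnW h3) dB)) (minn_idPl (_ : 2 * x + 1 <= B)) //; lia.
Qed.

Lemma relaxP s vis i u : genv s -> s iF = f -> s iU 0 = u ->
  rinvs s vis i u (fun e b => rtail T H e b != u) ->
  dinv N n B T H f cap c src (sem relax s iD) (sem relax s iP) vis i (fun _ _ => true).
Proof.
move=> gs sf su ri.
pose Q x (t : store) := [/\ genv t, t iF = f, t iU 0 = u &
  rinvs t vis i u (fun e b => (rtail T H e b != u) || (e < x))].
have [_ s1 _ _] := proj1 gs.
have [] : Q N (sem relax s); last first.
  by move=> _ _ _; apply: rinv_done => e b ->; rewrite orbT.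
rewrite -s1; apply: (@for_rule 28 _ Q) => //.
  by split=> //; apply: rinv_sub ri => e b _; rewrite ltn0 orbF.
move=> x t; rewrite s1 => xN fr tx [g1 tf tu tr]; rewrite sem_seq.
have g2 : genv (sem relax_fwd t) by apply: genv_frame g1.
split; first by apply: genv_frame g2.
- by rewrite !sem_framef.
- by rewrite !sem_framef.
apply: relax_bwdP => //; try by rewrite sem_framef.
exact: relax_fwdP.
Qed.

Definition dinvs s i := dinv N n B T H f cap c src (s iD) (s iP) (s iVis) i (fun _ _ => true).

(** The disjunction measures progress: a round marks a new vertex or finds none below [B]. After [N]
    rounds only the second case is left, as there are fewer than [N] vertices. *)
Lemma visitP s i : genv s -> s iF = f -> s 27 0 = i -> i < N -> dinvs s i ->
  settled n B (s iD) (s iVis) \/ i <= \sum_(v < n) (0 < s iVis v) ->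
  let s' := sem visit s in
  dinvs s' i.+1 /\
  (settled n B (s' iD) (s' iVis) \/ i.+1 <= \sum_(v < n) (0 < s' iVis v)).
Proof.
move=> gs sf si iN di pr s'; rewrite /s' /visit sem_seq.
have [h1 h2] := find_minP gs (di_le di).
set s1 := sem find_min s in h1 h2 *.
have g1 : genv s1 by apply: genv_frame gs.
have [[s10 s11 _ _] _] := g1.
have [eD eP eV eF e27] : [/\ s1 iD = s iD, s1 iP = s iP, s1 iVis = s iVis, s1 iF = f & s1 27 0 = i].
  by rewrite /s1 !sem_framef.
rewrite sem_if.
have -> : (ev s1 ($0 - $iBd)%AE != 0) = (s1 iBd 0 < B) by rewrite /= s10; lia.
case: h2 => [bB|[bB uN vu du]].
  rewrite bB ltnn [sem CSkip _]/= /dinvs eD eP eV; split.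
    by case: di => [*]; split=> // w wn; apply: leqW; auto.
  left=> w wn dw; rewrite lt0n; apply: contraL dw => /eqP vw.
  by rewrite -leqNgt -bB; apply: h1 => //; exact: ltn_trans nN.
rewrite bB sem_seq; set u := s1 iU 0 in uN vu du *.
(* The padding cells hold [B], and only a value strictly below [B] is selected. *)
have un : u < n.
  by rewrite ltnNge; apply/negP => nu; have := di_out di uN nu; lia.
have ru : rinvs s (fupd (s iVis) u i.+1) i.+1 u (fun e b => rtail T H e b != u).
  apply: rinv_choose => // w wn vw; rewrite du; apply: h1 => //; exact: ltn_trans nN.
set s2 := sem (asg iVis _ _) s1.
have g2 : genv s2 by apply: genv_frame g1.
have eV2 : s2 iVis = fupd (s iVis) u i.+1.
  by rewrite /s2 sem_asg /upd /= e27 s10 -/u eV addn1 (minn_idPl _) //; lia.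
have h := @relaxP s2 (fupd (s iVis) u i.+1) i.+1 u g2.
split; rewrite /dinvs.
  rewrite (_ : sem relax s2 iVis = s2 iVis); last by rewrite sem_framef.
  rewrite eV2; apply: h.
  - by rewrite /s2 sem_framef.
  - by rewrite /s2 sem_framef.
  - by rewrite /rinvs /s2 2?sem_framef // eD eP.
right; rewrite sem_framef // eV2.
have := sum_fupd (fun _ a => 0 < a : nat) (s iVis) i.+1 un; rewrite vu /= addn0 => ->.
case: pr => [st|]; last by rewrite addn1 ltnS.
have : 0 < s iVis u by apply: st => //; rewrite du.
by rewrite vu.
Qed.

Lemma dijkstraP s : genv s -> s iF = f ->
  let s' := sem dijkstra s in dinvs s' N /\ settled n B (s' iD) (s' iVis).
Proof.
move=> gs sf s'; rewrite /s' /dijkstra !sem_seq.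
have hi := init_distP gs.
set s1 := sem init_dist s in hi *; have g1 : genv s1 by apply: genv_frame gs.
have [[s10 s11 _ _] [_ _ ssrc _]] := g1.
set s2 := sem (asg iD _ _) s1; have g2 : genv s2 by apply: genv_frame g1.
have f2 : s2 iF = f by rewrite /s2 /s1 !sem_framef.
pose Q i (t : store) := [/\ genv t, t iF = f, dinvs t i &
  settled n B (t iD) (t iVis) \/ i <= \sum_(v < n) (0 < t iVis v)].
have [_ _ q1 q2] : Q N (sem (CFor 27 visit) s2); last first.
  split=> //; case: q2 => // le; suff : N <= n by lia.
  apply: leq_trans le _; rewrite -[X in _ <= X]card_ord -sum1_card.
  by apply: leq_sum => v _; rewrite leq_b1.
have [_ s21 _ _] := proj1 g2.
rewrite -{1}s21; apply: (@for_rule 27 _ Q) => //.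
  split=> //; last by right.
  have eD : s2 iD = fupd (s1 iD) src 0 by rewrite /s2 sem_asg /upd /= ssrc min0n.
  have eV : s2 iVis = s1 iVis by rewrite /s2 sem_framef.
  rewrite /dinvs eD eV; apply: dinv_init => //.
  - by rewrite fupd_eq.
  - by move=> w wN ne; rewrite fupd_ne //; case: (hi w wN).
  - by move=> w wN; case: (hi w wN).
move=> i t; rewrite s21 => iN fr ti [q1 q2 q3 q4].
have [v1 v2] := visitP q1 q2 ti iN q3 q4.
by split=> //; [exact: genv_frame q1|rewrite sem_framef].
Qed.

(** The interface of an augmentation for all later arguments: [d] is a feasible potential for the
    residual graph of the old flow [f], and [d dst = B] signals that no path was found. *)
Record aug_post (d g : nat -> nat) : Prop := AugPost {
  ap_src : d src = 0;
  ap_le : forall v, v < n -> d v <= B;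
  ap_fwd : forall e, e < N -> f e < cap e -> d (H e) <= d (T e) + c e;
  ap_bwd : forall e, e < N -> 0 < f e -> d (T e) <= d (H e);
  ap_fail : d dst = B -> g = f;
  ap_flow : d dst < B -> forall j, is_flow N T H f src dst j -> is_flow N T H g src dst j.+1;
  ap_cap : forall e, e < N -> g e <= minn (cap e) (f e).+1;
  ap_cost : d dst < B -> \sum_(e < N) c e * (g e - f e) <= d dst;
  ap_tight : forall e, e < N -> f e < g e -> d (H e) = d (T e) + c e
}.

Lemma traceP s : genv s -> s iF = f -> dinvs s N -> settled n B (s iD) (s iVis) ->
  s iD dst < B -> tinv N n B T H f cap c src (s iD) (s iVis) dst (sem trace s iF) src N.
Proof.
move=> gs sf di se dB; rewrite /trace sem_if.
have [[s0 s1 sT sH] [_ _ ssrc sdst]] := gs.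
have -> : ev s ($0 - iD.[$iDst])%AE != 0 by rewrite /= sdst s0; lia.
rewrite sem_seq; set s2 := sem (asv _ _) s.
have g2 : genv s2 by apply: genv_frame gs.
have [[_ s21 _ _] _] := g2.
pose Q i (t : store) := [/\ genv t, t iD = s iD, t iP = s iP &
  tinv N n B T H f cap c src (s iD) (s iVis) dst (t iF) (t iV 0) i].
have [_ _ _ q] : Q N (sem (CFor 27 (CIf (#1 - eqE ($iV) ($iSrc)) trace_step CSkip)) s2); last first.
  set t := sem _ s2 in q *; have e : t iV 0 = src; last by rewrite e in q.
  (* Any other vertex would have a positive stamp, which the [N] steps already made leave no room
     for. *)
  case: (ti_count q) => // h; have := se _ (ti_v q) (ti_d q); lia.
rewrite -{1}s21; apply: (@for_rule 27 _ Q) => //.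
  split=> //; try by rewrite /s2 sem_framef.
  rewrite {1}/s2 sem_framef // sf /s2 /asv sem_asg upd_eq /= sdst s0 (minn_idPl _); last by lia.
  exact: (tinv_init nN srcn fcap dstn di dB).
move=> i t; rewrite s21 => iN fr ti [q1 q2 q3 q4]; rewrite sem_if.
have [[t0 t1 tT tH] [_ _ tsrc _]] := q1.
have -> : (ev t (#1 - eqE ($iV) ($iSrc))%AE != 0) = (t iV 0 != src).
  by rewrite ev_sub ev_eqE /= tsrc; case: (t iV 0 == src).
case: (boolP (t iV 0 != src)) => [ne|/negPn/eqP e]; last first.
  by split=> //=; rewrite e in q4 *; exact: tinv_stop.
have [e [b [elt pe ge re q5]]] := tinv_step nN srcn fcap dstn di se dB q4 ne.
have gg : genv (sem trace_step t) by apply: genv_frame q1.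
split=> //; try by rewrite sem_framef.
rewrite /trace_step sem_seq /asv sem_asg.
have -> : minn (ev t (iP.[$iV] / #2)%AE) (t 0 0) = e.
  by rewrite /= q3 pe t0; case: (b); lia.
rewrite [ev t #0%AE]/=; set t2 := upd t iArc 0 e.
rewrite sem_if.
have -> : (ev t2 (iP.[$iV] - #2 * $iArc)%AE != 0) = b.
  by rewrite /t2 /upd /= q3 pe; case: (b); lia.
have fe := fcap elt; have cB := capB elt.
case: ifP => hb; rewrite {}hb /= in re q5; rewrite sem_seq !sem_asg /t2 /upd /= ?t0 ?tH ?tT ge.
  rewrite (minn_idPl (_ : f e - 1 <= B)) ?subn1; last by lia.
  have [_ hn] := capV elt (leq_trans re fe).
  by rewrite (minn_idPl (_ : H e <= B)) //; lia.
rewrite (minn_idPl (_ : f e + 1 <= B)) ?addn1; last by lia.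
have [hn _] := capV elt (leq_ltn_trans (leq0n _) re).
by rewrite (minn_idPl (_ : T e <= B)) //; lia.
Qed.

Lemma augmentP s : genv s -> s iF = f ->
  aug_post (sem augment s iD) (sem augment s iF).
Proof.
move=> gs sf; rewrite /augment sem_seq.
have [di se] := dijkstraP gs sf.
set s1 := sem dijkstra s in di se *.
have g1 : genv s1 by apply: genv_frame gs.
have f1 : s1 iF = f by rewrite /s1 sem_framef.
rewrite [sem trace s1 iD]sem_framef //.
have feas := dinv_feasible nN srcn capV fcap di se.
have [[s0 _ _ _] [_ _ _ sdst]] := g1.
have base : [/\ s1 iD src = 0, forall v, v < n -> s1 iD v <= B,
   forall e, e < N -> f e < cap e -> s1 iD (H e) <= s1 iD (T e) + c e &
   forall e, e < N -> 0 < f e -> s1 iD (T e) <= s1 iD (H e)].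
  split.
  - exact: (di_src di).
  - by move=> v vn; apply: (di_le di); exact: ltn_trans nN.
  - by move=> e elt re; exact: (feas e false elt re).
  - by move=> e elt re; have := feas e true elt re; rewrite addn0.
have [b1 b2 b3 b4] := base.
case: (ltnP (s1 iD dst) B) => dB.
  have tr := traceP g1 f1 di se dB.
  split=> //; try by case: tr.
  - by move=> h; rewrite h ltnn in dB.
  - move=> _ j hf q; have := ti_flow tr q; have := hf q; lia.
  - by move=> _; have := ti_cost tr; rewrite b1 addn0.
have tf : sem trace s1 iF = f.
  rewrite /trace sem_if.
  have -> : (ev s1 ($0 - iD.[$iDst])%AE != 0) = false by rewrite /= sdst s0; lia.
  exact: f1.
rewrite tf; split=> //.
- by move=> h; lia.
- by move=> e elt; rewrite leq_min leqnSn fcap.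
- by move=> h; lia.
- by move=> e _; rewrite ltnn.
Qed.
End Flow.
End Augment.

(** * The approximation algorithm *)

Definition posE (a : aexp) : aexp := (#1 - (#1 - a))%AE.

Lemma ev_posE st a : ev st (posE a) = (0 < ev st a).
Proof. by rewrite /posE /=; case: (ev st a) => [|[|x]]. Qed.
Arguments posE : simpl never.

Lemma for_asgP i e (F : nat -> nat) st : 1 < i -> i != 27 ->
  (forall s x, x < st 1 0 -> s 27 0 = x -> (forall j, j \notin [:: 27; i] -> s j = st j) ->
     ev s e = F x) ->
  forall x, x < st 1 0 -> sem (CFor 27 (asg i $27 e)) st i x = minn (F x) (st 0 0).
Proof.
move=> i1 i27 hF.
have ne0 : (0 == i) = false by case: i i1 {i27 hF} => [|[]].
apply: (@for_rule 27 _ (fun x s => forall y, y < x -> s i y = minn (F y) (st 0 0))) => //.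
  by move=> x s v h y yx; rewrite upd_id ?h.
move=> x s xN fr sx IH y; rewrite sem_asg.
have fr0 : s 0 0 = st 0 0 by rewrite fr // !inE ne0.
rewrite updE eqxx fr0 (hF s x) //.
have -> : ev s ($27)%AE = x by [].
by rewrite ltnS leq_eqVlt => /orP[/eqP->|/IH ->]; rewrite ?eqxx //; case: eqP => [->|].
Qed.

Definition zero_flow_cmd := CFor 27 (asg iF $27 #0).
Definition unit_cap := CFor 27 (asg iCap $27 (posE ($iM - $27))).
Definition load_cost := CFor 27 (asg iC $27 iW.[$27]).
(* Reduced costs vanish on the first path, so that its reversed arcs are free. *)
Definition reduced_cost := CFor 27 (asg iC $27 ((iW.[$27] + iD.[iT.[$27]]) - iD.[iH.[$27]])).
Definition save_dist := asv iR1 iD.[$iDst].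
(** Reduced costs make a path to the target cheaper by the first distance; adding it back for the
    second path gives the factor 2. *)
Definition sum_dist := asv iR (#2 * $iR1 + iD.[$iDst]).

Definition two_flow :=
  CSeq zero_flow_cmd (CSeq unit_cap (CSeq load_cost (CSeq augment
  (CSeq save_dist (CSeq reduced_cost (CSeq augment sum_dist)))))).

(* The arcs [m <= e < m + n * n] of the auxiliary graph stand for the pairs of vertices. *)
Definition set_pair := CSeq (asv iSrc iT.[$26]) (asv iDst iH.[$26]).
Definition pair_costs :=
  CFor 26 (CIf ((($26 + #1) - $iM) * ($iE - $26))
    (CSeq set_pair (CSeq two_flow (asg iW $26 $iR))) CSkip).

Definition set_ends := CSeq (asv iSrc (Low #2)) (asv iDst (Low #3)).
(** Vulnerable arcs enter the auxiliary graph only through the pair arcs, so their own capacity is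
    zero. *)
Definition aux_cap := CFor 27 (asg iCap $27
  (posE ($iM - $27) * (#1 - iVul.[$27]) + (#1 - posE ($iM - $27)) * posE ($iE - $27))).
Definition set_ok := asv iOk (posE ($0 - iD.[$iDst])).
Definition save_use := CFor 27 (asg iUse $27 iF.[$27]).
Definition clear_sol := CFor 27 (asg iS $27 #0).
(** The path is saved in [iUse], since the flow array is reused when its pair arcs are expanded. *)
Definition aux_path :=
  CSeq set_ends (CSeq zero_flow_cmd (CSeq aux_cap (CSeq load_cost (CSeq augment
  (CSeq set_ok (CSeq save_use clear_sol)))))).

Definition add_support := CFor 27 (CIf iF.[$27] (asg iS $27 #1) CSkip).
(** For pair arcs only costs were kept; the two paths are recomputed for the few pairs that are
    used. *)
Definition collect :=
  CFor 26 (CIf iUse.[$26]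
    (CIf ($iM - $26) (asg iS $26 #1) (CSeq set_pair (CSeq two_flow add_support))) CSkip).

Definition stage_cap := CFor 27 (asg iCap $27
  (posE ($iM - $27) * (iVul.[$27] + (#1 - iVul.[$27]) * $0))).
Definition stage_cost := CFor 27 (asg iC $27 ((#1 - iS.[$27]) * iW.[$27])).
Definition update_ok := asv iOk ($iOk * posE ($0 - iD.[$iDst])).
Definition stage := CSeq stage_cost (CSeq augment (CSeq update_ok add_support)).
(** Rounds with counter beyond [k] idle, and a large [k] is cut off by the number of rounds. *)
Definition stages := CFor 26 (CIf ((Low #4 + #1) - $26) stage CSkip).

(** * Correctness of the approximation *)

Section Main.
Variables (N n m B : nat) (T H vuln W : nat -> nat) (s0 t0 k : nat).
Let E := m + n * n.
Let vul : pred nat := fun e => vuln e != 0.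

Definition benv (s : store) :=
  [/\ s 0 0 = B, s 1 0 = N, s iT = T & s iH = H] /\
  [/\ s iM 0 = m, s iE 0 = E, s iVul = vuln & s 32 2 = s0 /\ s 32 3 = t0 /\ s 32 4 = k].

Definition wenv (s : store) :=
  (forall e, e < m -> s iW e = W e) /\ (forall e, e < N -> s iW e <= B).

Hypothesis (EnN : E + n < N) (NB : 2 * N < B) (n0 : 0 < n) (s0n : s0 < n) (t0n : t0 < n).
Hypothesis TH : forall e, e < E -> T e < n /\ H e < n.
Hypothesis pairE : forall x y, x < n -> y < n ->
  exists e, [/\ m <= e, e < E, T e = x & H e = y].
Hypothesis vul1 : forall e, e < N -> vuln e <= 1.
Hypothesis WB : \sum_(e < m) W e < B.

Lemma arcs_leE : m <= E. Proof. exact: leq_addr. Qed.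
Lemma arcs_ltN : m < N. Proof. by have := arcs_leE; lia. Qed.
Lemma vertices_ltN : n < N. Proof. by have := arcs_leE; lia. Qed.

Lemma benv_frame cm s :
  all (fun j => j \notin writes cm) [:: 0; 1; iT; iH; iM; iE; iVul; 32] ->
  benv s -> benv (sem cm s).
Proof.
case/and5P=> h0 h1 h2 h3 /and5P[h4 h5 h6 h7 _] [[? ? ? ?] [? ? ? [? [? ?]]]].
by rewrite /benv !sem_framef.
Qed.

Lemma wenv_frame cm s : iW \notin writes cm -> wenv s -> wenv (sem cm s).
Proof. by move=> h; rewrite /wenv sem_framef. Qed.

Definition inm (S : pred nat) := forall e, e < N -> S e -> e < m.

Lemma wt_lt S : inm S -> wt N W S < B.
Proof.
move=> Sm; apply: leq_ltn_trans WB.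
rewrite -(big_mkord predT W) (big_nat_widen 0 m N) ?(ltnW arcs_ltN) // big_mkord big_mkcond.
apply: leq_sum => e _; case: (boolP (S e)) => Se; last by [].
by rewrite (Sm e) ?ltn_ord // mul1n.
Qed.

(** * Two arc-disjoint paths of least weight *)

Lemma zero_flow f s t : (forall e, e < N -> f e = 0) -> is_flow N T H f s t 0.
Proof. by move=> h q; rewrite !mul0n !big1 // => e _; rewrite h ?ltn_ord. Qed.

Lemma two_flow_correct src dst (cap f0 c1 c2 d1 g1 d2 g2 : nat -> nat) :
  src < n -> dst < n ->
  (forall e, e < N -> cap e = (e < m)) -> (forall e, e < N -> f0 e = 0) ->
  (forall e, e < m -> c1 e = W e) ->
  (forall e, e < m -> c2 e = minn ((W e + d1 (T e)) - d1 (H e)) B) ->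
  aug_post N n B T H cap c1 src dst f0 d1 g1 ->
  aug_post N n B T H cap c2 src dst g1 d2 g2 ->
  let r := minn (2 * d1 dst + d2 dst) B in
  (forall S, inm S -> two_cut N T H S src dst -> r <= wt N W S) /\
  (r < B -> [/\ is_flow N T H g2 src dst 2,
     forall e, e < N -> g2 e <= (e < m) & \sum_(e < N) g2 e * W e <= r]).
Proof.
move=> srcn dstn hcap f1 c3W c6E p1 p2 r.
have fc6 e : e < N -> g1 e <= cap e.
  by move=> eN; have := ap_cap p1 eN; rewrite leq_min => /andP[].
have g1m e : e < N -> 0 < g1 e -> e < m.
  by move=> eN h; have := fc6 e eN; rewrite hcap //; case: (e < m) => //; lia.
have d1le e : e < m -> d1 (H e) <= d1 (T e) + W e.
  move=> em; have eN := ltn_trans em arcs_ltN.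
  by rewrite -c3W //; apply: (ap_fwd p1) => //; rewrite f1 // hcap // em.
have tight e : e < N -> 0 < g1 e -> d1 (H e) = d1 (T e) + W e.
  by move=> eN h; rewrite -c3W ?(g1m e) //; apply: (ap_tight p1) => //; rewrite f1.
rewrite /r; split.
  move=> S Sm tc; case: (ltnP (d1 dst) B) => dB; last first.
    (* Without a first path the level cuts of [d1] alone give the bound: this is the augmentation
       bound for zero flow and zero faults. *)
    have : d1 dst <= wt N W (fun e => S e && ~~ pred0 e).
      apply: (@stage_bound N T H pred0 W pred0 S f0 d1 src dst 0 0) => //.
      - by apply: zero_flow => e eN; rewrite f1.
      - exact: (ap_src p1).
      - by move=> e eN; rewrite f1.
      - by move=> e eN Se _; apply: d1le; exact: Sm eN Se.
      - by move=> U Us Ut; right; apply: ltn_trans (tc U Us Ut).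
    rewrite (_ : wt N W _ = wt N W S); first by lia.
    by apply: eq_bigr => e _; rewrite andbT.
  have : 2 * d1 dst + d2 dst <= wt N W S; last by lia.
  apply: (@two_flow_bound N T H W S g1 d1 d2 src dst) => //.
  - by apply: (ap_flow p1) => //; apply: zero_flow => e eN; rewrite f1.
  - exact: (ap_src p1).
  - exact: (ap_src p2).
  - by move=> e eN; apply: leq_trans (fc6 e eN) _; rewrite hcap // leq_b1.
  - exact: (ap_bwd p2).
  - move=> e eN Se ge; have em := Sm e eN Se.
    have := ap_fwd p2 eN; rewrite ge hcap // em => /(_ isT); rewrite c6E //.
    by have := d1le e em; lia.
move=> rB; have {}rB : 2 * d1 dst + d2 dst < B by lia.
rewrite (minn_idPl (ltnW rB)).
have d1B : d1 dst < B by lia.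
have d2B : d2 dst < B by lia.
have fl1 : is_flow N T H g1 src dst 1.
  by apply: (ap_flow p1) => //; apply: zero_flow => e eN; rewrite f1.
have fl2 : is_flow N T H g2 src dst 2 by apply: (ap_flow p2).
have g2m e : e < N -> g2 e <= (e < m).
  by move=> eN; have := ap_cap p2 eN; rewrite hcap // leq_min => /andP[].
split=> //.
(* On the first path the potential difference equals [W]; elsewhere the reduced cost makes up the
   rest. Summed up, conservation of [g2] tested against [d1] replaces the potentials by
   [2 * d1 dst]. *)
have key e : e < N ->
    g2 e * W e + g2 e * d1 (T e) <= g2 e * d1 (H e) + c2 e * (g2 e - g1 e).
  move=> eN; case: (posnP (g2 e)) => [->//|g20].
  have em : e < m by have := g2m e eN; case: (e < m) => //; lia.
  have -> : g2 e = 1 by have := g2m e eN; rewrite em; lia.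
  rewrite !mul1n; case: (posnP (g1 e)) => g10; last by rewrite (tight e) //; lia.
  have ge : g2 e - g1 e = 1 by have := g2m e eN; rewrite em; lia.
  rewrite g10 subn0 muln1.
  (* An arc newly used by the second path has reduced cost below [B], so clipping has left it
     unchanged. *)
  have : c2 e * (g2 e - g1 e) < B.
    apply: leq_ltn_trans (d2B); apply: leq_trans (ap_cost p2 d2B).
    exact: (@sum_ge N (fun e => c2 e * (g2 e - g1 e))).
  rewrite ge muln1 c6E //; have := d1le e em; lia.
have sk : \sum_(e < N) g2 e * W e + \sum_(e < N) g2 e * d1 (T e) <=
    \sum_(e < N) g2 e * d1 (H e) + \sum_(e < N) c2 e * (g2 e - g1 e).
  by rewrite -!big_split; apply: leq_sum => e _; exact: key.
have := fl2 d1; rewrite (ap_src p1) muln0 addn0.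
have := ap_cost p2 d2B; lia.
Qed.

Lemma two_flowP s : benv s -> wenv s -> s iSrc 0 < n -> s iDst 0 < n ->
  let r := sem two_flow s iR 0 in let f := sem two_flow s iF in
  (forall S, inm S -> two_cut N T H S (s iSrc 0) (s iDst 0) -> r <= wt N W S) /\
  (r < B -> [/\ is_flow N T H f (s iSrc 0) (s iDst 0) 2,
     forall e, e < N -> f e <= (e < m) & \sum_(e < N) f e * W e <= r]).
Proof.
move=> bs ws srcn dstn r f.
set src := s iSrc 0 in srcn *; set dst := s iDst 0 in dstn *.
rewrite /r /f {r f} /two_flow 7!sem_seq.
have esrc : s iSrc 0 = src by []. have edst : s iDst 0 = dst by [].
clearbody src dst.
set s1 := sem zero_flow_cmd s.
have b1 : benv s1 by apply: benv_frame bs.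
have w1 : wenv s1 by apply: wenv_frame ws.
have fr1 j : j \notin writes zero_flow_cmd -> s1 j = s j by exact: sem_framef.
have f1 e : e < N -> s1 iF e = 0.
  have [[q0 q1 _ _] _] := bs => eN.
  by rewrite /s1 (@for_asgP _ _ (fun _ => 0)) ?q1 // min0n.
clearbody s1; set s2 := sem unit_cap s1.
have b2 : benv s2 by apply: benv_frame b1.
have w2 : wenv s2 by apply: wenv_frame w1.
have fr2 j : j \notin writes unit_cap -> s2 j = s1 j by exact: sem_framef.
have c2 e : e < N -> s2 iCap e = (e < m).
  have [[q0 q1 _ _] [qm _ _ _]] := b1 => eN.
  rewrite /s2 (@for_asgP _ _ (fun x => x < m)) ?q1 //.
    by rewrite q0 (minn_idPl _) //; case: (_ < _); lia.
  by move=> t x _ tx fr; rewrite ev_posE /= tx fr // qm subn_gt0.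
clearbody s2; set s3 := sem load_cost s2.
have b3 : benv s3 by apply: benv_frame b2.
have w3 : wenv s3 by apply: wenv_frame w2.
have fr3 j : j \notin writes load_cost -> s3 j = s2 j by exact: sem_framef.
have c3 e : e < m -> s3 iC e = W e.
  have [[q0 q1 _ _] _] := b2 => em; have eN := ltn_trans em arcs_ltN.
  rewrite /s3 (@for_asgP _ _ (s2 iW)) ?q1 //; last by move=> t x _ tx fr /=; rewrite tx fr.
  by rewrite q0 (minn_idPl _) ?(proj1 w2) // -(proj1 w2) //; apply: (proj2 w2).
clearbody s3; set s4 := sem augment s3.
have e3s : s3 iSrc 0 = src by rewrite fr3 // fr2 // fr1.
have e3d : s3 iDst 0 = dst by rewrite fr3 // fr2 // fr1.
have f3 e : e < N -> s3 iF e = 0 by move=> eN; rewrite fr3 // fr2 // f1.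
have k3 e : e < N -> s3 iCap e = (e < m) by move=> eN; rewrite fr3 // c2.
have capV e : e < N -> 0 < s3 iCap e -> T e < n /\ H e < n.
  by move=> eN; rewrite k3 // lt0b => em; apply: TH; exact: leq_trans em arcs_leE.
have capB e : e < N -> s3 iCap e <= B by move=> eN; rewrite k3 //; case: (_ < _); lia.
have fc3 e : e < N -> s3 iF e <= s3 iCap e by move=> eN; rewrite f3.
have g3 : genv N B T H (s3 iCap) (s3 iC) src dst s3 by have [[? ? ? ?] _] := b3.
have p1 := augmentP vertices_ltN srcn dstn NB capV capB fc3 g3 erefl.
rewrite -/s4 in p1.
have b4 : benv s4 by apply: benv_frame b3.
have w4 : wenv s4 by apply: wenv_frame w3.
have fr4 j : j \notin writes augment -> s4 j = s3 j by exact: sem_framef.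
clearbody s4; set s5 := sem save_dist s4.
have b5 : benv s5 by apply: benv_frame b4.
have w5 : wenv s5 by apply: wenv_frame w4.
have fr5 j : j \notin writes save_dist -> s5 j = s4 j by exact: sem_framef.
have e4d : s4 iDst 0 = dst by rewrite fr4.
have r5 : s5 iR1 0 = s4 iD dst.
  have [[q0 _ _ _] _] := b4.
  rewrite /s5 /save_dist /asv sem_asg upd_eq /= e4d q0 (minn_idPl _) //.
  exact: ap_le p1 _ dstn.
clearbody s5; set s6 := sem reduced_cost s5.
have b6 : benv s6 by apply: benv_frame b5.
have fr6 j : j \notin writes reduced_cost -> s6 j = s5 j by exact: sem_framef.
have c6 e : e < m -> s6 iC e = minn ((W e + s4 iD (T e)) - s4 iD (H e)) B.
  have [[q0 q1 qT qH] _] := b5 => em; have eN := ltn_trans em arcs_ltN.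
  rewrite /s6 (@for_asgP _ _ (fun e => (s5 iW e + s4 iD (T e)) - s4 iD (H e))) ?q1 ?q0 //.
    by rewrite (proj1 w5).
  by move=> t x _ tx fr /=; rewrite tx !fr // qT qH [s5 iD]fr5.
clearbody s6; set s7 := sem augment s6.
have f6 : s6 iF = s4 iF by rewrite fr6 // fr5.
have k6 : s6 iCap = s3 iCap by rewrite fr6 // fr5 // fr4.
have e6s : s6 iSrc 0 = src by rewrite fr6 // fr5 // fr4.
have e6d : s6 iDst 0 = dst by rewrite fr6 // fr5 // fr4.
have fc6 e : e < N -> s4 iF e <= s3 iCap e.
  by move=> eN; have := ap_cap p1 eN; rewrite leq_min => /andP[].
have g6 : genv N B T H (s3 iCap) (s6 iC) src dst s6 by have [[? ? ? ?] _] := b6.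
have p2 := augmentP vertices_ltN srcn dstn NB capV capB fc6 g6 f6.
rewrite -/s7 in p2.
have b7 : benv s7 by apply: benv_frame b6.
have fr7 j : j \notin writes augment -> s7 j = s6 j by exact: sem_framef.
clearbody s7; set s8 := sem sum_dist s7.
have f8 : s8 iF = s7 iF by rewrite [s8 iF]sem_framef.
have r8 : s8 iR 0 = minn (2 * s4 iD dst + s7 iD dst) B.
  have [[q0 _ _ _] _] := b7.
  rewrite /s8 /sum_dist /asv sem_asg upd_eq /= q0 [s7 iR1]fr7 // [s6 iR1]fr6 // r5.
  by rewrite [s7 iDst]fr7 // e6d.
clearbody s8; rewrite f8 r8.
exact: (two_flow_correct srcn dstn k3 f3 c3 c6 p1 p2).
Qed.

Lemma two_cut_mono (S S' : pred nat) x y : (forall e, e < N -> S e -> S' e) ->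
  two_cut N T H S x y -> two_cut N T H S' x y.
Proof.
move=> h tc U Ux Uy; apply: leq_trans (tc U Ux Uy) _.
by apply: cut_size_le => e eN Se ->; rewrite h.
Qed.

(** Below [B] this makes [r] the optimum. A value of at least [B] rules out any such set, since
    every set of real arcs weighs less than [B]. *)
Definition c2ok r x y :=
  (forall S, inm S -> two_cut N T H S x y -> r <= wt N W S) /\
  (r < B -> exists S, [/\ inm S, two_cut N T H S x y & wt N W S <= r]).

Lemma support_wt (f : nat -> nat) : wt N W (fun e => f e != 0) <= \sum_(e < N) f e * W e.
Proof. by apply: leq_sum => e _; case: (f e) => [|x] //=; rewrite mul1n leq_pmull. Qed.

Lemma two_flow_c2ok s : benv s -> wenv s -> s iSrc 0 < n -> s iDst 0 < n ->
  c2ok (sem two_flow s iR 0) (s iSrc 0) (s iDst 0).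
Proof.
move=> bs ws srcn dstn; have [h1 h2] := two_flowP bs ws srcn dstn.
split=> // rB; have [fl f1 fw] := h2 rB.
exists (fun e => sem two_flow s iF e != 0); split.
- by move=> e eN; have := f1 e eN; case: (e < m) => //; case: (_ e).
- apply: two_cut_mono (flow_two_cut fl _) => [e _|e eN]; first by rewrite lt0n.
  by apply: leq_trans (f1 e eN) (leq_b1 _).
- exact: leq_trans (support_wt _) fw.
Qed.

Lemma set_pairP s e : benv s -> s 26 0 = e -> e < E ->
  sem set_pair s iSrc 0 = T e /\ sem set_pair s iDst 0 = H e.
Proof.
move=> [[q0 q1 qT qH] _] se eE; have [Tn Hn] := TH eE; have := vertices_ltN => vertices_ltN'.
rewrite /set_pair sem_seq /asv !sem_asg /upd /= se qT qH q0 !(minn_idPl _) //; lia.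
Qed.

Lemma pair_costsP s : benv s -> wenv s -> let s' := sem pair_costs s in
  [/\ benv s', wenv s' & forall e, m <= e -> e < E -> c2ok (s' iW e) (T e) (H e)].
Proof.
move=> bs ws s'; have [[q0 q1 _ _] _] := bs.
pose Q x (t : store) := [/\ benv t, wenv t &
  forall e, m <= e -> e < x -> e < E -> c2ok (t iW e) (T e) (H e)].
suff [h1 h2 h3] : Q N s' by split=> // e me eE; apply: h3 => //; lia.
rewrite /s' -q1; apply: (@for_rule 26 _ Q) => //.
move=> x t xN fr tx [bt wt' ht]; rewrite sem_if.
have [[t0' t1 _ _] [tm tE _ _]] := bt.
have {}xN : x < N by rewrite -q1.
have -> : (ev t ((($26 + #1) - $iM) * ($iE - $26))%AE != 0) = (m <= x < E).
  by rewrite /= tx tm tE muln_eq0 negb_or; lia.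
case: ifP => [/andP[mx xE]|nx]; last first.
  split=> // e me; rewrite ltnS leq_eqVlt => /orP[/eqP ex eE|]; last exact: ht.
  by rewrite -ex me eE in nx.
rewrite 2!sem_seq; have [psrc pdst] := set_pairP bt tx xE; have [Tn Hn] := TH xE.
set t2 := sem set_pair t in psrc pdst *.
have b2 : benv t2 by apply: benv_frame bt.
have w2 : wenv t2 by apply: wenv_frame wt'.
have fr2 j : j \notin writes set_pair -> t2 j = t j by exact: sem_framef.
clearbody t2.
have := @two_flow_c2ok t2 b2 w2; rewrite psrc pdst => /(_ Tn Hn).
set t3 := sem two_flow t2 => ck.
have b3 : benv t3 by apply: benv_frame b2.
have w3 : wenv t3 by apply: wenv_frame w2.
have fr3 j : j \notin writes two_flow -> t3 j = t2 j by exact: sem_framef.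
clearbody t3.
have [[t30 _ _ _] _] := b3.
have eW : sem (asg iW $26 $iR) t3 iW = fupd (t iW) x (minn (t3 iR 0) B).
  by rewrite sem_asg /upd /= t30 [t3 26]fr3 // [t2 26]fr2 // tx [t3 5]fr3 // fr2.
split.
- exact: benv_frame b3.
- rewrite /wenv eW; split=> e eN; rewrite /fupd; case: eqP => [ex|_].
  + by move: mx; rewrite -ex leqNgt eN.
  + exact: (proj1 wt').
  + exact: geq_minr.
  + exact: (proj2 wt').
move=> e me; rewrite eW ltnS leq_eqVlt => /orP[/eqP-> _|ex eE]; last first.
  by rewrite fupd_ne ?ltn_eqF //; exact: ht.
rewrite fupd_eq; case: ck => c1 c2; split.
  by move=> S Sm tc; apply: leq_trans (geq_minl _ _) (c1 S Sm tc).
move=> h; have rB : t3 iR 0 < B by lia.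
by rewrite (minn_idPl (ltnW rB)); exact: c2.
Qed.

(** * Optimal solution for a single fault *)

Lemma set_endsP s : benv s -> sem set_ends s iSrc 0 = s0 /\ sem set_ends s iDst 0 = t0.
Proof.
move=> [[q0 q1 qT qH] [_ _ _ [e1 [e2 e3]]]]; have := vertices_ltN => vertices_ltN'.
rewrite /set_ends sem_seq /asv !sem_asg /upd /= q0.
have h2 a : minn 2 (5 * a + 4) = 2 by lia.
have h3 a : minn 3 (5 * a + 4) = 3 by lia.
by rewrite h2 h3 e1 e2 !(minn_idPl _) //; lia.
Qed.

Lemma add_supportP s e : benv s -> e < N ->
  sem add_support s iS e = if s iF e != 0 then 1 else s iS e.
Proof.
move=> [[q0 q1 _ _] _] eN.
pose Q x (t : store) := t iF = s iF /\ forall e, t iS e = if (e < x) && (s iF e != 0) then 1 else s iS e.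
suff [_ ->] : Q N (sem add_support s) by rewrite eN.
rewrite -q1; apply: (@for_rule 27 _ Q) => //.
move=> x t xN fr tx [tf tS]; rewrite sem_if.
have -> : (ev t (iF.[$27])%AE != 0) = (s iF x != 0) by rewrite /= tx tf.
split; first by case: ifP => _ //; rewrite sem_framef.
move=> y; case: ifP => [fx|fx].
  rewrite sem_asg /upd /= tx fr // q0 (minn_idPl _); last by lia.
  by case: (eqVneq y x) => [->|ne]; [rewrite ltnSn fx|rewrite tS ltnS [y <= x]leq_eqVlt (negPf ne)].
rewrite /= tS ltnS [y <= x]leq_eqVlt; case: (eqVneq y x) => [->|] //=.
by rewrite ltnn fx.
Qed.

(** [D] is the auxiliary distance from [s0] to [t0]. It is a lower bound because the distances serve
    as the potential of [one_fault_bound]: safe arcs give its condition on single arcs, pair arcs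
    the one on two-cut sets. *)
Lemma aux_pathP s : benv s -> wenv s ->
  (forall e, m <= e -> e < E -> c2ok (s iW e) (T e) (H e)) ->
  let s' := sem aux_path s in exists D,
  [/\ [/\ benv s', wenv s', s' iW = s iW & s' iOk 0 = (D < B)],
      forall S, inm S -> surv N T H vul 1 S s0 t0 -> D <= wt N W S,
      forall e, e < N -> s' iS e = 0 &
      D < B -> [/\ is_flow N T H (s' iUse) s0 t0 1,
        forall e, e < N -> s' iUse e <= 1,
        forall e, e < N -> 0 < s' iUse e -> if e < m then ~~ vul e else e < E
        & \sum_(e < N) s' iUse e * s iW e <= D]].
Proof.
move=> bs ws pk s'; rewrite /s' /aux_path 7!sem_seq {s'}.
have [esrc edst] := set_endsP bs.
set s1 := sem set_ends s in esrc edst *.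
have b1 : benv s1 by apply: benv_frame bs.
have w1 : wenv s1 by apply: wenv_frame ws.
have fr1 j : j \notin writes set_ends -> s1 j = s j by exact: sem_framef.
clearbody s1; set s2 := sem zero_flow_cmd s1.
have b2 : benv s2 by apply: benv_frame b1.
have w2 : wenv s2 by apply: wenv_frame w1.
have fr2 j : j \notin writes zero_flow_cmd -> s2 j = s1 j by exact: sem_framef.
have f2 e : e < N -> s2 iF e = 0.
  have [[q0 q1 _ _] _] := b1 => eN.
  by rewrite /s2 (@for_asgP _ _ (fun _ => 0)) ?q1 // min0n.
clearbody s2; set s3 := sem aux_cap s2.
have b3 : benv s3 by apply: benv_frame b2.
have w3 : wenv s3 by apply: wenv_frame w2.
have fr3 j : j \notin writes aux_cap -> s3 j = s2 j by exact: sem_framef.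
have c3 e : e < N -> s3 iCap e = if e < m then ~~ vul e else e < E.
  have [[q0 q1 _ _] [qm qE qv _]] := b2 => eN.
  rewrite /s3 (@for_asgP _ _ (fun e => if e < m then ~~ vul e else e < E)) ?q1 //.
    by rewrite q0 (minn_idPl _) //; case: ifP => _; lia.
  move=> t x xN tx fr.
  rewrite (_ : ev t _ = ev t (posE ($iM - $27)) * (1 - t iVul (t 27 0)) +
     (1 - ev t (posE ($iM - $27))) * ev t (posE ($iE - $27))) // !ev_posE /= tx !fr // qm qE qv.
  rewrite !subn_gt0; have := vul1 xN; rewrite /vul.
  by case: (x < m); case: (vuln x) => [|[]] // _; rewrite /= ?mul1n ?mul0n ?addn0.
clearbody s3; set s4 := sem load_cost s3.
have b4 : benv s4 by apply: benv_frame b3.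
have w4 : wenv s4 by apply: wenv_frame w3.
have fr4 j : j \notin writes load_cost -> s4 j = s3 j by exact: sem_framef.
have c4 e : e < N -> s4 iC e = s iW e.
  have [[q0 q1 _ _] _] := b3 => eN.
  rewrite /s4 (@for_asgP _ _ (s iW)) ?q1 //.
    by rewrite q0 (minn_idPl _) //; apply: (proj2 ws).
  by move=> t x _ tx fr /=; rewrite tx fr // fr3 // fr2 // fr1.
clearbody s4; set s5 := sem augment s4.
have e4s : s4 iSrc 0 = s0 by rewrite fr4 // fr3 // fr2.
have e4d : s4 iDst 0 = t0 by rewrite fr4 // fr3 // fr2.
have f4 e : e < N -> s4 iF e = 0 by move=> eN; rewrite fr4 // fr3 // f2.
have k4 e : e < N -> s4 iCap e = if e < m then ~~ vul e else e < E.
  by move=> eN; rewrite fr4 // c3.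
have capV e : e < N -> 0 < s4 iCap e -> T e < n /\ H e < n.
  move=> eN; rewrite k4 //; case: ifP => em h; apply: TH; first exact: leq_trans em arcs_leE.
  by move: h; case: (e < E).
have capB e : e < N -> s4 iCap e <= B by move=> eN; rewrite k4 //; case: ifP => _; lia.
have fc e : e < N -> s4 iF e <= s4 iCap e by move=> eN; rewrite f4.
have g4 : genv N B T H (s4 iCap) (s4 iC) s0 t0 s4 by have [[? ? ? ?] _] := b4.
have p := augmentP vertices_ltN s0n t0n NB capV capB fc g4 erefl.
rewrite -/s5 in p.
have b5 : benv s5 by apply: benv_frame b4.
have w5 : wenv s5 by apply: wenv_frame w4.
have fr5 j : j \notin writes augment -> s5 j = s4 j by exact: sem_framef.
clearbody s5; set s6 := sem set_ok s5.
have b6 : benv s6 by apply: benv_frame b5.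
have fr6 j : j \notin writes set_ok -> s6 j = s5 j by exact: sem_framef.
have ok6 : s6 iOk 0 = (s5 iD t0 < B).
  have [[q0 _ _ _] _] := b5.
  rewrite /s6 /set_ok /asv sem_asg upd_eq ev_posE /= q0 [s5 15]fr5 // e4d subn_gt0.
  by rewrite (minn_idPl _) //; case: (_ < _); lia.
clearbody s6; set s7 := sem save_use s6.
have b7 : benv s7 by apply: benv_frame b6.
have fr7 j : j \notin writes save_use -> s7 j = s6 j by exact: sem_framef.
have u7 e : e < N -> s7 iUse e = s5 iF e.
  have [[q0 q1 _ _] _] := b6 => eN.
  rewrite /s7 (@for_asgP _ _ (s5 iF)) ?q1 //.
    rewrite q0 (minn_idPl _) //; have := ap_cap p eN; have := capB e eN; lia.
  by move=> t x _ tx fr /=; rewrite tx fr // fr6.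
clearbody s7; set s8 := sem clear_sol s7.
have b8 : benv s8 by apply: benv_frame b7.
have fr8 j : j \notin writes clear_sol -> s8 j = s7 j by exact: sem_framef.
have S8 e : e < N -> s8 iS e = 0.
  have [[q0 q1 _ _] _] := b7 => eN.
  by rewrite /s8 (@for_asgP _ _ (fun _ => 0)) ?q1 // min0n.
clearbody s8.
have W8 : s8 iW = s iW by rewrite fr8 // fr7 // fr6 // fr5 // fr4 // fr3 // fr2 // fr1.
exists (s5 iD t0); split.
- split=> //; first by rewrite /wenv W8.
  by rewrite fr8 // fr7.
- move=> S Sm sv.
  have := @one_fault_bound N T H (fun v => v < n) (fun e => e < m) vul W (s5 iD).
  rewrite -[X in X <= _]addn0 => /(_ _ _ _ S s0 t0).
  rewrite (ap_src p) addn0 add0n; apply=> //.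
  + by move=> e _ em; apply: TH; exact: leq_trans em arcs_leE.
  + move=> e eN em ve; rewrite -(proj1 ws) // -c4 //; apply: (ap_fwd p) => //.
    by rewrite f4 // k4 // em ve.
  + move=> x y S' xn yn S'm tc; have [e [me eE ex ey]] := pairE xn yn; subst x y.
    have eN : e < N by lia.
    apply: (@leq_trans (s5 iD (T e) + s4 iC e)).
      by apply: (ap_fwd p) => //; rewrite f4 // k4 // [e < m]ltnNge me /= eE.
    by rewrite c4 // leq_add2l; apply: (proj1 (pk e me eE)).
- by [].
- move=> DB.
  have fl := ap_flow p DB (zero_flow s0 t0 f4).
  have eU e : e < N -> s8 iUse e = s5 iF e by move=> eN; rewrite fr8 // u7.
  have fle e : e < N -> s5 iF e <= if e < m then ~~ vul e else e < E.
    by move=> eN; rewrite -k4 //; have := ap_cap p eN; rewrite leq_min => /andP[].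
  split.
  + move=> q; have := fl q; congr (_ + _ = _ + _).
      by apply: eq_bigr => e _; rewrite eU.
    by apply: eq_bigr => e _; rewrite eU.
  + by move=> e eN; rewrite eU //; apply: leq_trans (fle e eN) _; case: ifP => _; apply: leq_b1.
  + by move=> e eN; rewrite eU //; have := fle e eN; case: ifP => _; case: (X in _ <= nat_of_bool X) => //; lia.
  + apply: leq_trans (ap_cost p DB); apply: leq_sum => e _.
    by rewrite eU // c4 // f4 // subn0 mulnC.
Qed.

Definition sol (s : store) : pred nat := fun e => s iS e != 0.

Lemma wt_add (S S' : pred nat) (g : nat -> nat) :
  (forall e, e < N -> S' e -> ~~ S e -> W e <= g e) ->
  wt N W S' <= wt N W S + \sum_(e < N) g e.
Proof.
move=> h; rewrite -big_split; apply: leq_sum => e _ /=.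
case: (boolP (S' e)) => // S'e; rewrite mul1n.
case: (boolP (S e)) => Se; first by rewrite mul1n leq_addr.
by rewrite mul0n add0n h.
Qed.

(** Each arc of the auxiliary path is charged its own cost, and real arcs shared by several of them
    are paid once, so the union weighs at most [D]. *)
Lemma collectP s D : benv s -> wenv s ->
  (forall e, m <= e -> e < E -> c2ok (s iW e) (T e) (H e)) ->
  (forall e, e < N -> s iS e = 0) -> D < B ->
  is_flow N T H (s iUse) s0 t0 1 ->
  (forall e, e < N -> s iUse e <= 1) ->
  (forall e, e < N -> 0 < s iUse e -> if e < m then ~~ vul e else e < E) ->
  \sum_(e < N) s iUse e * s iW e <= D ->
  let S := sol (sem collect s) in
  [/\ inm S, surv N T H vul 1 S s0 t0 & wt N W S <= D].
Proof.
move=> bs ws pk S0 DB fl u1 uv uD; have [[q0 q1 _ _] _] := bs.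
have cB e : e < N -> 0 < s iUse e -> s iW e < B.
  move=> eN ue; apply: leq_ltn_trans DB; apply: leq_trans uD.
  apply: leq_trans (sum_ge (fun e => s iUse e * s iW e) eN).
  by rewrite leq_pmull.
pose Q x (t : store) := [/\ [/\ benv t, wenv t, t iW = s iW & t iUse = s iUse], inm (sol t),
  wt N W (sol t) <= \sum_(e < N) (e < x) * (s iUse e * s iW e) &
  forall e, e < x -> e < N -> 0 < s iUse e ->
    (sol t e /\ ~~ vul e) \/ two_cut N T H (sol t) (T e) (H e)].
suff [_ h1 h2 h3] : Q N (sem collect s).
  split=> //.
    by apply: path_surv fl _ => e eN; apply: h3.
  apply: leq_trans h2 _; apply: leq_trans uD; apply: leq_sum => e _.
  by rewrite ltn_ord mul1n.
rewrite -{1}q1; apply: (@for_rule 26 _ Q) => //.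
  split=> //; first by move=> e eN; rewrite /sol S0.
  by rewrite /wt big1 // => e _; rewrite /sol S0 ?ltn_ord.
move=> x t; rewrite q1 => xN fr tx [[bt wt' tW tU] Sm Sw Sc]; rewrite sem_if.
have [[t0' t1 _ _] [tm tE _ _]] := bt.
have -> : (ev t (iUse.[$26])%AE != 0) = (s iUse x != 0) by rewrite /= tx tU.
have up y : \sum_(e < N) (e < x) * (s iUse e * s iW e) + y * s iW x <=
    \sum_(e < N) (e < x.+1) * (s iUse e * s iW e) \/ y > s iUse x.
  case: (leqP y (s iUse x)) => hy; [left|by right].
  rewrite (bigD1 (Ordinal xN)) //= [X in _ <= X](bigD1 (Ordinal xN)) //=.
  rewrite ltnn mul0n add0n ltnSn mul1n addnC leq_add ?leq_mul2r ?hy ?orbT //.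
  apply: leq_sum => e _; rewrite leq_mul2r; apply/orP; right.
  by case: (ltnP e x) => // h; rewrite ltnS (ltnW h).
case: ifP => [ux|/negbFE/eqP ux]; last first.
  split=> //.
    by case: (up 0) => //; rewrite mul0n addn0; exact: leq_trans.
  move=> e; rewrite ltnS leq_eqVlt => /orP[/eqP->|]; [by rewrite ux|exact: Sc].
rewrite -lt0n in ux; have ux1 : s iUse x = 1 by have := u1 x xN; lia.
have {}up : \sum_(e < N) (e < x) * (s iUse e * s iW e) + s iW x <=
    \sum_(e < N) (e < x.+1) * (s iUse e * s iW e).
  by case: (up 1); [rewrite mul1n|rewrite ux1].
rewrite sem_if.
have -> : (ev t ($iM - $26)%AE != 0) = (x < m) by rewrite /= tx tm; lia.
have := uv x xN ux; case: ifP => [xm vx|xm xE].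
  have eS : sem (asg iS $26 #1) t iS = fupd (t iS) x 1.
    by rewrite sem_asg /upd /= tx t0' (minn_idPl _) //; lia.
  have sS e : sol (sem (asg iS $26 #1) t) e = (e == x) || sol t e.
    by rewrite /sol eS /fupd; case: (e == x).
  split.
  - split; [exact: benv_frame bt|exact: wenv_frame wt'| |]; by rewrite sem_framef.
  - by move=> e eN; rewrite sS => /orP[/eqP->//|]; exact: Sm.
  - apply: leq_trans up.
    apply: (@leq_trans (wt N W (sol t) + \sum_(e < N) (e == x :> nat) * W x)).
      apply: (@wt_add _ _ (fun e => (e == x) * W x)) => e eN.
      by rewrite sS => /orP[/eqP-> _|->//]; rewrite eqxx mul1n.
    rewrite leq_add // -(proj1 wt') // tW (bigD1 (Ordinal xN)) //= eqxx mul1n big1 ?addn0 //.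
    by move=> e ne; case: eqP => // ee; move: ne; rewrite -val_eqE /= ee eqxx.
  - move=> e; rewrite ltnS leq_eqVlt => /orP[/eqP-> _ _|ex eN ue].
      by left; rewrite sS eqxx.
    case: (Sc e ex eN ue) => [[h1 h2]|h]; first by left; rewrite sS h1 orbT.
    by right; apply: two_cut_mono h => y _ h; rewrite sS h orbT.
have mx : m <= x by rewrite leqNgt xm.
rewrite 2!sem_seq; have [psrc pdst] := set_pairP bt tx xE; have [Tn Hn] := TH xE.
set t2 := sem set_pair t in psrc pdst *.
have b2 : benv t2 by apply: benv_frame bt.
have w2 : wenv t2 by apply: wenv_frame wt'.
have fr2 j : j \notin writes set_pair -> t2 j = t j by exact: sem_framef.
clearbody t2.
have := @two_flowP t2 b2 w2; rewrite psrc pdst => /(_ Tn Hn).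
set t3 := sem two_flow t2 => -[r1 r2].
have b3 : benv t3 by apply: benv_frame b2.
have w3 : wenv t3 by apply: wenv_frame w2.
have fr3 j : j \notin writes two_flow -> t3 j = t2 j by exact: sem_framef.
clearbody t3.
(* The paths are recomputed; a set witnessing the stored cost shows that the new value is no
   larger. *)
have [Sx [Sx1 Sx2 Sx3]] := proj2 (pk x mx xE) (cB x xN ux).
have rW : t3 iR 0 <= s iW x by apply: leq_trans (r1 Sx Sx1 Sx2) Sx3.
have [f2 fm fW] := r2 (leq_ltn_trans rW (cB x xN ux)).
set t4 := sem add_support t3.
have sS e : e < N -> sol t4 e = (t3 iF e != 0) || sol t e.
  move=> eN; rewrite /sol /t4 add_supportP //.
  by case: ifP => //= _; rewrite [t3 13]fr3 // fr2.
have b4 : benv t4 by apply: benv_frame b3.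
have w4 : wenv t4 by apply: wenv_frame w3.
have fr4 j : j \notin writes add_support -> t4 j = t3 j by exact: sem_framef.
clearbody t4; split.
- by split=> //; rewrite fr4 // fr3 // fr2.
- move=> e eN; rewrite sS // => /orP[|]; last exact: Sm.
  by have := fm e eN; case: (e < m) => //; case: (_ e).
- apply: leq_trans up.
  apply: (@leq_trans (wt N W (sol t) + \sum_(e < N) t3 iF e * W e)).
    apply: (@wt_add _ _ (fun e => t3 iF e * W e)) => e eN; rewrite sS // => /orP[fe _|->//].
    by rewrite leq_pmull // lt0n.
  by rewrite leq_add // (leq_trans fW).
- move=> e; rewrite ltnS leq_eqVlt => /orP[/eqP-> _ _|ex eN ue].
    right; apply: two_cut_mono (flow_two_cut f2 _) => [y yN|y yN].
      by rewrite lt0n sS // => ->.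
    by apply: leq_trans (fm y yN) (leq_b1 _).
  case: (Sc e ex eN ue) => [[h1 h2]|h]; first by left; rewrite sS // h1 orbT.
  by right; apply: two_cut_mono h => y yN h; rewrite sS // h orbT.
Qed.

(** * Augmentation stages *)

Definition scap e := if e < m then (if vul e then 1 else B) else 0.

(** The factor is 1 up to two units and grows by 1 with each further one. [so_le] keeps safe arcs
    below their capacity [B], as a stage starts with [j < N] units. *)
Record stage_ok (j : nat) (f : nat -> nat) (S : pred nat) : Prop := StageOk {
  so_flow : is_flow N T H f s0 t0 j;
  so_inm : inm S;
  so_supp : forall e, e < N -> 0 < f e -> S e;
  so_le : forall e, e < N -> f e <= j;
  so_surv : surv N T H vul 1 S s0 t0;
  so_wt : forall S', inm S' -> surv N T H vul k S' s0 t0 ->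
    wt N W S <= maxn 1 j.-1 * wt N W S'
}.

Lemma stage_correct j (f c cap d g : nat -> nat) (S : pred nat) :
  j <= k -> j < N ->
  (forall e, e < N -> cap e = scap e) -> (forall e, e < N -> f e <= cap e) ->
  (forall e, e < m -> c e = if S e then 0 else W e) ->
  aug_post N n B T H cap c s0 t0 f d g -> stage_ok j f S ->
  (forall S', inm S' -> surv N T H vul k S' s0 t0 -> d t0 <= wt N W S') /\
  (d t0 < B -> stage_ok j.+1 g (fun e => (g e != 0) || S e)).
Proof.
move=> jk jN hcap fcap hc p [fl Sm fS fj sv bw].
have fv e : e < N -> vul e -> f e <= 1.
  by move=> eN ve; have := fcap e eN; rewrite hcap // /scap ve; case: ifP => // _; lia.
have hS e : e < N -> S e -> ~~ vul e || (f e == 0) -> d (H e) <= d (T e).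
  move=> eN Se h; have em := Sm e eN Se.
  have := ap_fwd p eN; rewrite hc // Se addn0; apply.
  rewrite hcap // /scap em; have := fj e eN; case: (vul e) h => /=; lia.
have low i S' : j <= i -> inm S' -> surv N T H vul i S' s0 t0 ->
    d t0 <= wt N W (fun e => S' e && ~~ S e).
  move=> ji S'm; apply: (stage_bound fl ji (ap_src p) (ap_bwd p) hS) => e eN S'e nS.
  have em := S'm e eN S'e.
  have fe : f e = 0 by apply/eqP; rewrite -leqn0 leqNgt; apply: contra nS; exact: fS.
  have := ap_fwd p eN; rewrite hc // (negPf nS); apply.
  by rewrite hcap // /scap em fe; case: (vul e) => //; lia.
have low' S' : inm S' -> surv N T H vul k S' s0 t0 -> d t0 <= wt N W S'.
  move=> S'm sv'; apply: leq_trans (low k S' jk S'm sv') _.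
  by apply: leq_sum => e _; case: (S' e) => //; rewrite leq_mul2r leq_b1 orbT.
split=> // dB.
have gcap e : e < N -> g e <= scap e.
  by move=> eN; have := ap_cap p eN; rewrite hcap // leq_min => /andP[].
have gm e : e < N -> g e != 0 -> e < m.
  by move=> eN; have := gcap e eN; rewrite /scap; case: ifP => // _; lia.
have wS : wt N W (fun e => (g e != 0) || S e) <= wt N W S + d t0.
  apply: (@leq_trans (wt N W S + \sum_(e < N) c e * (g e - f e))); last first.
    by rewrite leq_add2l; exact: (ap_cost p).
  apply: (@wt_add _ _ (fun e => c e * (g e - f e))) => e eN; case: (boolP (S e)) => // nS.
  rewrite orbF => ge _; have fe : f e = 0.
    by apply/eqP; rewrite -leqn0 leqNgt; apply: contra nS; exact: fS.
  by rewrite hc ?gm // (negPf nS) fe subn0 leq_pmulr // lt0n.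
split.
- exact: (ap_flow p).
- by move=> e eN /orP[/gm|/Sm]; apply.
- by move=> e eN; rewrite lt0n => ->.
- by move=> e eN; have := ap_cap p eN; have := fj e eN; lia.
- move=> U Us Ut; case: (sv U Us Ut) => [[e [e1 e2 e3 e4]]|h].
    by left; exists e; split=> //; rewrite e2 orbT.
  by right; apply: leq_trans h _; apply: cut_size_le => e _ Se ce; rewrite Se orbT.
- move=> S' S'm sv'; have b1 := bw S' S'm sv'; have b2 := low' S' S'm sv'.
  apply: leq_trans wS _; case: (leqP j 1) => j1.
    (* Here [S] is its own competitor: it survives one fault and contains no arc that is still to be
       bought. *)
    have : d t0 <= 0.
      apply: leq_trans (low 1 S j1 Sm sv) _; rewrite leqn0 /wt big1 // => e _.
      by rewrite andbN.
    by move: b1; rewrite (_ : maxn 1 j.-1 = 1) ?(_ : maxn 1 j = 1); lia.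
  rewrite (_ : maxn 1 j.-1 = j.-1) in b1; last by lia.
  by rewrite -(prednK (ltnW j1)) mulSn addnC leq_add.
Qed.

(** [si_complete] makes failure conclusive: a distance of [B] exceeds the weight of every set of
    real arcs, so a failed stage shows that nothing is feasible. *)
Record sinv (j : nat) (s : store) : Prop := Sinv {
  si_benv : benv s;
  si_wenv : wenv s;
  si_ends : s iSrc 0 = s0 /\ s iDst 0 = t0;
  si_cap : forall e, e < N -> s iCap e = scap e;
  si_fcap : forall e, e < N -> s iF e <= s iCap e;
  si_ok1 : s iOk 0 <= 1;
  si_ok : s iOk 0 = 1 -> stage_ok j (s iF) (sol s);
  si_complete : forall S, inm S -> surv N T H vul k S s0 t0 -> s iOk 0 = 1
}.

Lemma stage_ok_ext j f (S S' : pred nat) : (forall e, e < N -> S e = S' e) ->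
  stage_ok j f S -> stage_ok j f S'.
Proof.
move=> eS [h1 h2 h3 h4 h5 h6].
have cE U : cut_size N T H S' U = cut_size N T H S U.
  by apply: eq_bigr => e _; rewrite eS.
have wE : wt N W S' = wt N W S by apply: eq_bigr => e _; rewrite eS.
split=> //.
- by move=> e eN; rewrite -eS //; exact: h2.
- by move=> e eN; rewrite -eS //; exact: h3.
- move=> U Us Ut; rewrite cE; case: (h5 U Us Ut) => [[e [e1 e2 e3 e4]]|]; last by right.
  by left; exists e; split=> //; rewrite -eS.
- by rewrite wE.
Qed.

Lemma scapV e : e < N -> 0 < scap e -> T e < n /\ H e < n.
Proof. by rewrite /scap => eN; case: ifP => // em _; apply: TH; exact: leq_trans em arcs_leE. Qed.

Lemma stageP j s : sinv j s -> j <= k -> j < N -> sinv j.+1 (sem stage s).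
Proof.
move=> [bs ws [es ed] hc fc ok1 ok comp] jk jN; rewrite /stage 3!sem_seq.
set s1 := sem stage_cost s.
have b1 : benv s1 by apply: benv_frame bs.
have w1 : wenv s1 by apply: wenv_frame ws.
have fr1 j' : j' \notin writes stage_cost -> s1 j' = s j' by exact: sem_framef.
have c1 e : e < m -> s1 iC e = if sol s e then 0 else W e.
  have [[q0 q1 _ _] _] := bs => em; have eN := ltn_trans em arcs_ltN.
  rewrite /s1 (@for_asgP _ _ (fun e => (1 - s iS e) * s iW e)) ?q1 //.
    rewrite q0 /sol (proj1 ws) //; have := proj2 ws e eN; rewrite (proj1 ws) //.
    by case: (s iS e) => [|x] /= h; rewrite ?subn0 ?mul1n ?(minn_idPl h) // subSS sub0n min0n.
  by move=> t x _ tx fr /=; rewrite tx !fr.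
clearbody s1.
have es1 : s1 iSrc 0 = s0 by rewrite fr1.
have ed1 : s1 iDst 0 = t0 by rewrite fr1.
have f1 : s1 iF = s iF by rewrite fr1.
have k1 : s1 iCap = s iCap by rewrite fr1.
have capV e : e < N -> 0 < s iCap e -> T e < n /\ H e < n.
  by move=> eN; rewrite hc //; exact: scapV.
have capB e : e < N -> s iCap e <= B.
  by move=> eN; rewrite hc // /scap; case: ifP => // _; case: ifP => // _; lia.
have g1 : genv N B T H (s iCap) (s1 iC) s0 t0 s1 by have [[? ? ? ?] _] := b1.
have p := augmentP vertices_ltN s0n t0n NB capV capB fc g1 f1.
set s2 := sem augment s1 in p *.
have b2 : benv s2 by apply: benv_frame b1.
have w2 : wenv s2 by apply: wenv_frame w1.
have fr2 j' : j' \notin writes augment -> s2 j' = s1 j' by exact: sem_framef.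
clearbody s2; set s3 := sem update_ok s2.
have b3 : benv s3 by apply: benv_frame b2.
have w3 : wenv s3 by apply: wenv_frame w2.
have fr3 j' : j' \notin writes update_ok -> s3 j' = s2 j' by exact: sem_framef.
have ok3 : s3 iOk 0 = s iOk 0 * (s2 iD t0 < B).
  have [[q0 _ _ _] _] := b2.
  rewrite /s3 /update_ok /asv sem_asg upd_eq ev_mul ev_posE /= q0 subn_gt0.
  rewrite [s2 iOk]fr2 // [s1 iOk]fr1 // [s2 iDst]fr2 // ed1 (minn_idPl _) //.
  by move: ok1; case: (_ < _); lia.
clearbody s3; set s4 := sem add_support s3.
have b4 : benv s4 by apply: benv_frame b3.
have w4 : wenv s4 by apply: wenv_frame w3.
have fr4 j' : j' \notin writes add_support -> s4 j' = s3 j' by exact: sem_framef.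
have sS e : e < N -> sol s4 e = (s2 iF e != 0) || sol s e.
  move=> eN; rewrite /sol /s4 add_supportP // [s3 iF]fr3 //.
  by case: ifP => //= _; rewrite [s3 iS]fr3 // fr2 // fr1.
clearbody s4.
have ok4 : s4 iOk 0 = s iOk 0 * (s2 iD t0 < B) by rewrite fr4.
split=> //.
- by rewrite !fr4 // !fr3 // !fr2.
- by move=> e eN; rewrite fr4 // fr3 // fr2 // k1 hc.
- move=> e eN; rewrite [s4 iF]fr4 // fr3 // fr4 // fr3 // [s2 iCap]fr2 // k1.
  by have := ap_cap p eN; rewrite leq_min => /andP[].
- by rewrite ok4; move: ok1; case: (_ < _); lia.
- rewrite ok4 => h; have [oks dB] : s iOk 0 = 1 /\ s2 iD t0 < B.
    by move: h; case: (_ < _); rewrite ?muln1 ?muln0.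
  have [_ h2] := stage_correct jk jN hc fc c1 p (ok oks).
  rewrite [s4 iF]fr4 // [s3 iF]fr3 //; apply: stage_ok_ext (h2 dB) => e eN.
  by rewrite sS.
- move=> S Sm sv; have oks := comp S Sm sv; rewrite ok4 oks mul1n.
  have [h1 _] := stage_correct jk jN hc fc c1 p (ok oks).
  by rewrite (leq_ltn_trans (h1 S Sm sv) (wt_lt Sm)).
Qed.

Lemma stagesP s : sinv 0 s -> sinv (minn N k.+1) (sem stages s).
Proof.
move=> si; have [[q0 q1 _ _] _] := si_benv si.
pose Q i t := sinv (minn i k.+1) t.
suff : Q N (sem stages s) by [].
rewrite -{1}q1; apply: (@for_rule 26 _ Q) => //.
  by move=> x t v [h1 h2 h3 h4 h5 h6 h7 h8].
move=> i t; rewrite q1 => iN fr ti; rewrite /Q => st; rewrite sem_if.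
have -> : (ev t ((Low #4 + #1) - $26)%AE != 0) = (i <= k).
  have [_ [_ _ _ [_ [_ e4]]]] := si_benv st.
  have h a : minn 4 (5 * a + 4) = 4 by lia.
  by rewrite /= h e4 ti; lia.
case: (leqP i k) => ik.
  rewrite (minn_idPl (ik : i < k.+1)); rewrite (minn_idPl (leqW ik)) in st.
  exact: stageP.
by rewrite (minn_idPr (leqW ik)); rewrite (minn_idPr ik) in st.
Qed.

Lemma stage_capP s e : benv s -> e < N -> sem stage_cap s iCap e = scap e.
Proof.
move=> [[q0 q1 _ _] [qm qE qv _]] eN.
rewrite (@for_asgP _ _ scap) ?q1 //.
  by rewrite q0 (minn_idPl _) // /scap; case: ifP => // _; case: ifP => // _; lia.
move=> t x xN tx fr; rewrite ev_mul ev_posE /= tx !fr // qm qv q0 subn_gt0 /scap.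
have := vul1 xN; rewrite /vul.
by case: (x < m); case: (vuln x) => [|[]] //= _; rewrite ?mul1n ?mul0n ?add0n ?addn0.
Qed.

Definition main := CSeq pair_costs (CSeq aux_path (CSeq collect
  (CSeq set_ends (CSeq zero_flow_cmd (CSeq stage_cap stages))))).

Lemma mainP s : 0 < k -> benv s -> wenv s -> let s' := sem main s in
  benv s' /\
  (s' iOk 0 != 0 -> [/\ surv N T H vul k (sol s') s0 t0, inm (sol s') &
     forall S, inm S -> surv N T H vul k S s0 t0 -> wt N W (sol s') <= k * wt N W S]) /\
  (forall S, inm S -> surv N T H vul k S s0 t0 -> s' iOk 0 != 0).
Proof.
move=> k0 bs ws s'; rewrite /s' /main 6!sem_seq {s'}.
have [b1 w1 pk] := pair_costsP bs ws.
set s1 := sem pair_costs s in b1 w1 pk *; clearbody s1.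
have [D [[b2 w2 eW ok2] low S2 hD]] := aux_pathP b1 w1 pk.
set s2 := sem aux_path s1 in b2 w2 eW ok2 S2 hD *; clearbody s2.
have hc : D < B -> [/\ inm (sol (sem collect s2)), surv N T H vul 1 (sol (sem collect s2)) s0 t0
    & wt N W (sol (sem collect s2)) <= D].
  move=> DB; have [h1 h2 h3 h4] := hD DB.
  by rewrite -eW in h4 pk; exact: collectP.
set s3 := sem collect s2 in hc *.
have b3 : benv s3 by apply: benv_frame b2.
have w3 : wenv s3.
  by apply: wenv_frame w2.
have ok3 : s3 iOk 0 = (D < B) by rewrite -ok2 /s3 sem_framef.
clearbody s3.
have [es ed] := set_endsP b3.
set s4 := sem set_ends s3 in es ed *.
have b4 : benv s4 by apply: benv_frame b3.
have w4 : wenv s4 by apply: wenv_frame w3.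
have fr4 j : j \notin writes set_ends -> s4 j = s3 j by exact: sem_framef.
clearbody s4; set s5 := sem zero_flow_cmd s4.
have b5 : benv s5 by apply: benv_frame b4.
have w5 : wenv s5 by apply: wenv_frame w4.
have fr5 j : j \notin writes zero_flow_cmd -> s5 j = s4 j by exact: sem_framef.
have f5 e : e < N -> s5 iF e = 0.
  have [[q0 q1 _ _] _] := b4 => eN.
  by rewrite /s5 (@for_asgP _ _ (fun _ => 0)) ?q1 // min0n.
clearbody s5; set s6 := sem stage_cap s5.
have b6 : benv s6 by apply: benv_frame b5.
have w6 : wenv s6 by apply: wenv_frame w5.
have fr6 j : j \notin writes stage_cap -> s6 j = s5 j by exact: sem_framef.
have k6 e (eN : e < N) : s6 iCap e = scap e := stage_capP b5 eN.
clearbody s6.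
have ok6 : s6 iOk 0 = (D < B) by rewrite fr6 // fr5 // fr4.
have sol6 : sol s6 = sol s3 by rewrite /sol fr6 // fr5 // fr4.
have f6 e : e < N -> s6 iF e = 0 by move=> eN; rewrite fr6 // f5.
have sv1 S : inm S -> surv N T H vul k S s0 t0 -> surv N T H vul 1 S s0 t0.
  by move=> Sm; apply: (surv_weaken Sm); rewrite k0.
have si : sinv 0 s6.
  split=> //.
  - by rewrite !fr6 // !fr5.
  - by move=> e eN; rewrite f6.
  - by rewrite ok6; case: (_ < _).
  - rewrite ok6 => h; have DB : D < B by case: (D < B) h.
    have [h1 h2 h3] := hc DB; rewrite sol6; split=> //.
    + exact: zero_flow.
    + by move=> e eN; rewrite f6.
    + by move=> e eN; rewrite f6.
    + by move=> S Sm sv; rewrite mul1n (leq_trans h3) // low //; exact: sv1.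
  - move=> S Sm sv; rewrite ok6 (leq_ltn_trans (low S Sm _) (wt_lt Sm)) //; exact: sv1.
have := stagesP si; set s7 := sem stages s6 => -[h1 h2 h3 h4 h5 h6 h7 h8].
split=> //; split; last by move=> S Sm /(h8 S Sm) ->.
move=> ok; have {}ok : s7 iOk 0 = 1 by lia.
have [q1 q2 q3 q4 q5 q6] := h7 ok.
have arcs_ltN' := arcs_ltN.
split=> //.
(* Either [k + 1] units were sent, or [N > m] of them, which amounts to surviving at least [m]
   faults. *)
- apply: (@surv_weaken N T H vul k (minn N k.+1).-1 m) => //; first by lia.
  apply: (@flow_surv N T H vul (s7 iF)) => //.
    by rewrite prednK //; lia.
  move=> e eN ve; have := h5 e eN; rewrite h4 // /scap ve.
  by case: ifP => // _; lia.
- move=> S Sm sv; apply: leq_trans (q6 S Sm sv) _.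
  by rewrite leq_mul2r; apply/orP; right; lia.
Qed.
End Main.

(** * Instances and their encoding *)

Lemma path_crosses (X : eqType) (e : rel X) (U : pred X) x p :
  path e x p -> U x -> ~~ U (last x p) -> exists u v, [/\ e u v, U u & ~~ U v].
Proof.
elim: p x => [|y p IH] x /=; first by move=> _ ->.
case/andP=> exy pp Ux Ul; case: (boolP (U y)) => Uy; first exact: IH pp Uy Ul.
by exists x, y.
Qed.

(** * Feasibility in terms of cuts *)

Section Bridge.
Variables (I : instance) (N : nat) (T H vuln : nat -> nat).
Local Notation m := (nA I).
Local Notation n := (nV I).
Hypothesis mN : m < N.
Hypothesis hT : forall a : 'I_m, T a = arc_tail a.
Hypothesis hH : forall a : 'I_m, H a = arc_head a.
Hypothesis hv : forall a : 'I_m, vuln a = (a \in vulnerable I).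
Let vul : pred nat := fun e => vuln e != 0.

Definition arcs_of (S : {set 'I_m}) : pred nat :=
  fun e => if insub e is Some a then (a : 'I_m) \in S else false.

Lemma arcs_ofE S (a : 'I_m) : arcs_of S a = (a \in S).
Proof. by rewrite /arcs_of valK. Qed.

Lemma arcs_of_inm S : inm N m (arcs_of S).
Proof. by move=> e _; rewrite /arcs_of; case: insubP. Qed.

Lemma sum_arcs (F : nat -> nat) : (forall e, m <= e -> F e = 0) ->
  \sum_(e < N) F e = \sum_(a < m) F a.
Proof.
move=> F0; rewrite (big_ord_widen N F (ltnW mN)) [RHS]big_mkcond.
by apply: eq_bigr => e _; case: ltnP => // /F0.
Qed.

Lemma arcs_of_out S e : m <= e -> arcs_of S e = false.
Proof. by move=> me; rewrite /arcs_of; case: insubP => // a; rewrite ltnNge me. Qed.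

Lemma cut_size_arcs S U :
  cut_size N T H (arcs_of S) U = #|[set a in S | crosses T H U a]|.
Proof.
rewrite /cut_size (@sum_arcs (fun e => arcs_of S e && crosses T H U e)).
  rewrite -sum1_card [RHS]big_mkcond; apply: eq_bigr => a _.
  by rewrite inE arcs_ofE; case: (_ && _).
by move=> e me; rewrite arcs_of_out.
Qed.

(** A violated cut would itself be an admissible fault set: all its arcs are vulnerable, there are
    at most [faults I] of them, and removing them leaves no path. *)
Lemma feasible_surv S : feasible S ->
  surv N T H vul (faults I) (arcs_of S) (source I) (target I).
Proof.
move=> fS U Us Ut; set F := [set a in S | crosses T H U a].
case: (boolP (F \subset vulnerable I)) => [Fv|/subsetPn[a]]; last first.
  rewrite inE => /andP[aS ca] va; left; exists (a : nat).
  by rewrite arcs_ofE (ltn_trans (ltn_ord a) mN) /vul hv (negPf va).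
right; rewrite cut_size_arcs ltnNge; apply/negP => Fk.
have [p [pp _ pl]] := fS F Fv Fk; rewrite -pl in Ut.
have [u [v [/existsP[a /and3P[]]]]] :=
  @path_crosses _ _ (fun x : 'I_n => U x) _ _ pp Us Ut.
rewrite inE => /andP[aF aS] /eqP tu /eqP hw Uu Uv; move: aF.
by rewrite inE aS /crosses hT hH tu hw Uu Uv.
Qed.

(** The cut to use is the set of vertices still reachable after the faults; every arc of [S] that
    leaves it is faulty. *)
Lemma surv_feasible S :
  surv N T H vul (faults I) (arcs_of S) (source I) (target I) -> feasible S.
Proof.
move=> sv F Fv Fk; set e := adjacent (S :\: F).
case: (boolP (connect e (source I) (target I))) => [/connectP[p pp pl]|nc].
  move: pl; case/shortenP: pp => p' pp' up' _ pl.
  by exists p'; split.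
pose U v := [exists x : 'I_n, (x == v :> nat) && connect e (source I) x].
have UE (x : 'I_n) : U x = connect e (source I) x.
  apply/existsP/idP => [[y /andP[/eqP/val_inj ->]] //|c].
  by exists x; rewrite eqxx.
have no a : a \in S -> a \notin F -> crosses T H U a -> False.
  move=> aS aF /andP[]; rewrite hT hH !UE => ct /negP; apply.
  apply: connect_trans ct (connect1 _); apply/existsP; exists a.
  by rewrite inE aS aF !eqxx.
case: (sv U); rewrite ?UE // ?connect0 //.
  case=> x [_ Sx cx vx]; move: Sx cx vx; rewrite /arcs_of; case: insubP => // a _ <- aS cx.
  rewrite /vul hv; case: (boolP (a \in vulnerable I)) => // va _.
  by case: (no a aS) => //; apply: contra va; exact: (subsetP Fv).
rewrite cut_size_arcs => h.
have /subsetPn[a] : ~~ ([set a in S | crosses T H U a] \subset F).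
  by apply: contraL h => /subset_leq_card le; rewrite -leqNgt (leq_trans le).
by rewrite inE => /andP[aS ca] aF; case: (no a aS aF ca).
Qed.

Lemma wt_arcs (W : nat -> nat) S : wt N W (arcs_of S) = \sum_(a in S) W a.
Proof.
rewrite /wt (@sum_arcs (fun e => arcs_of S e * W e)).
  by rewrite [RHS]big_mkcond; apply: eq_bigr => a _; rewrite arcs_ofE; case: (a \in S); rewrite ?mul1n.
by move=> e me; rewrite arcs_of_out.
Qed.
End Bridge.

(** * Clearing denominators *)

Definition num (I : instance) (a : 'I_(nA I)) := `|numq (weight a)|%N.
Definition den (I : instance) (a : 'I_(nA I)) := `|denq (weight a)|%N.

Import Order.TTheory GRing.Theory Num.Theory.

Lemma den_gt0 I (a : 'I_(nA I)) : 0 < den a.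
Proof. by rewrite /den absz_gt0 denq_neq0. Qed.

Lemma weightE I (a : 'I_(nA I)) : weight a = ((num a)%:R / (den a)%:R)%R.
Proof.
rewrite -[LHS]divq_num_den /num /den !pmulrn.
by rewrite !gez0_abs ?numq_ge0 ?weight_ge0 ?denq_ge0.
Qed.

(** Any common multiple would do; the product needs no gcd, and its length is at most the sum of the
    lengths of its factors. *)
Definition denprod (I : instance) := \prod_(a < nA I) den a.

Lemma denprod_gt0 I : 0 < denprod I.
Proof. by apply: prodn_gt0 => a; exact: den_gt0. Qed.

Lemma total_weight_scaled I (S : {set 'I_(nA I)}) :
  (total_weight S * (denprod I)%:R =
    (\sum_(a in S) num a * (denprod I %/ den a))%N%:R)%R.
Proof.
rewrite /total_weight mulr_suml natr_sum; apply: eq_bigr => a _.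
have dv : den a %| denprod I by rewrite /denprod (bigD1 a) //= dvdn_mulr.
rewrite weightE natrM -{1}(divnK dv) natrM [((_ %/ _)%:R * _)%R]mulrC mulrA divfK //.
by rewrite pnatr_eq0 -lt0n den_gt0.
Qed.

(** The expanded product contains 1 and every [F x]. Hence a bound on all sums of scaled weights can
    be built by multiplication while the common denominator is still being computed. *)
Lemma sum_lt_prod (X : Type) (r : seq X) (F : X -> nat) :
  \sum_(x <- r) F x < \prod_(x <- r) (F x).+1.
Proof.
elim: r => [|x r IH]; rewrite ?big_nil // !big_cons mulSn.
set p := \prod_(_ <- _) _ in IH *; have : 0 < p by apply: leq_ltn_trans IH.
nia.
Qed.

(** * Layout and size of the input *)

Lemma nth_flatten5 (X : Type) (x0 : X) (g : X -> seq nat) (l : seq X) i j :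
  (forall x, size (g x) = 5) -> i < size l -> j < 5 ->
  nth 0 (flatten [seq g x | x <- l]) (5 * i + j) = nth 0 (g (nth x0 l i)) j.
Proof.
move=> g5; elim: l i => //= x l IH [|i] il j5; rewrite nth_cat g5.
  by rewrite muln0 add0n j5.
have -> : (5 * i.+1 + j < 5) = false by lia.
have -> : 5 * i.+1 + j - 5 = 5 * i + j by lia.
exact: IH.
Qed.

Lemma size_flatten5 (X : Type) (g : X -> seq nat) (l : seq X) :
  (forall x, size (g x) = 5) -> size (flatten [seq g x | x <- l]) = 5 * size l.
Proof. by move=> g5; elim: l => //= x l IH; rewrite size_cat g5 IH; lia. Qed.

Section Encoding.
Variable I : instance.
Local Notation m := (nA I).

Lemma size_encode : size (encode I) = 5 + 5 * m.
Proof. by rewrite /encode size_cat /= size_flatten5 // size_enum_ord. Qed.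

Lemma encode_arcE (a : 'I_m) j : j < 5 ->
  nth 0 (encode I) (5 + (5 * a + j)) = nth 0 (encode_arc a) j.
Proof.
move=> j5; rewrite /encode nth_cat [size _]/=.
have -> : (5 + (5 * a + j) < 5) = false by lia.
have -> : 5 + (5 * a + j) - 5 = 5 * a + j by lia.
by rewrite (@nth_flatten5 _ a) ?size_enum_ord // nth_ord_enum.
Qed.

Lemma input_arc_bits :
  nV I + \sum_(a < m) (bitlen (num a) + bitlen (den a)) <= input_size I.
Proof.
rewrite /input_size leq_add2l /encode big_cat /= big_flatten big_map big_enum /=.
apply: leq_trans (leq_addl _ _); apply: leq_sum => a _.
by rewrite /encode_arc !big_cons big_nil /num /den; lia.
Qed.

Lemma input_arcs : m <= input_size I.
Proof.
apply: leq_trans input_arc_bits; apply: leq_trans (leq_addl _ _).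
rewrite -[X in X <= _]card_ord -sum1_card; apply: leq_sum => a _.
by rewrite /bitlen; lia.
Qed.

Lemma input_entry y : nth 0 (encode I) y < 2 ^ input_size I.
Proof.
case: (ltnP y (size (encode I))) => h; last by rewrite nth_default // expn_gt0.
apply: leq_trans (ltn_bitlen _) _; rewrite leq_exp2l //.
apply: leq_trans (leq_addl _ _).
by rewrite (big_nth 0) big_mkord (bigD1 (Ordinal h)) //= leq_addr.
Qed.

End Encoding.

(** * Reading the input *)

Lemma safe_seq M b c1 c2 st :
  safe M b c1 st -> safe M b c2 (sem c1 st) -> safe M b (CSeq c1 c2) st.
Proof. by []. Qed.

Definition fieldE j (a : aexp) : aexp := Low (#5 + (#5 * a + Cst j))%AE.

(** These assignments compute the clipping bound, so they cannot be clipped themselves. *)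
Definition bound_loop :=
  CFor 26 (CIf (Low #1 - $26)
    (CSeq (CSet 2 #0 ($2 * fieldE 3 $26))
          (CSet 0 #0 ($0 * (fieldE 3 $26 * (fieldE 2 $26 + #1))))) CSkip).
Definition bounds :=
  CSeq (CSet 1 #0 (Low #1 + Low #0 * Low #0 + Low #0 + #1))
  (CSeq (CSet 0 #0 (#2 * $1 + #1)) (CSeq (CSet 2 #0 #1) bound_loop)).

Definition load_sizes := CSeq (asv iM (Low #1)) (asv iE (Low #1 + Low #0 * Low #0)).
(** Cell [m + (x * n + y)] represents the pair [(x, y)]; quotient and remainder by [n] recover its
    ends. *)
Definition load_tail := CFor 27 (asg iT $27
  (posE ($iM - $27) * fieldE 0 $27 + (#1 - posE ($iM - $27)) * (($27 - $iM) / Low #0))).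
Definition load_head := CFor 27 (asg iH $27
  (posE ($iM - $27) * fieldE 1 $27 +
   (#1 - posE ($iM - $27)) * (($27 - $iM) - ($27 - $iM) / Low #0 * Low #0))).
Definition load_weight := CFor 27 (asg iW $27
  (posE ($iM - $27) * (fieldE 2 $27 * ($2 / fieldE 3 $27)))).
Definition load_vul := CFor 27 (asg iVul $27 (posE ($iM - $27) * fieldE 4 $27)).
Definition load :=
  CSeq load_sizes (CSeq load_tail (CSeq load_head (CSeq load_weight load_vul))).

(** Arc 0 is left out: its answer belongs in register 1, which still locates the arrays. *)
Definition output :=
  CFor 26 (CIf ($26 * ($iM - $26)) (CLow ($26 - #1) (clip iS.[$26])) CSkip).

Definition algorithm := CSeq bounds (CSeq load (CSeq main output)).

Lemma ev_sel s a e1 e2 : ev s (posE a * e1 + (#1 - posE a) * e2)%AE =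
  if 0 < ev s a then ev s e1 else ev s e2.
Proof.
rewrite (_ : ev s _ = ev s (posE a) * ev s e1 + (1 - ev s (posE a)) * ev s e2) // ev_posE.
by case: (0 < ev s a); rewrite ?mul1n ?mul0n ?addn0.
Qed.

(** * The value bound and the loaded arrays *)

Section Instance.
Variable I : instance.
Local Notation m := (nA I).
Local Notation n := (nV I).
(** One loop length for real arcs, pairs and vertices alike. *)
Let N := m + n * n + n + 1.
Let low := input_memory I.

Definition numN i := low (5 + (5 * i + 2)).
Definition denN i := low (5 + (5 * i + 3)).

Lemma numN_num (a : 'I_m) : numN a = num a.
Proof. by rewrite /numN /low /input_memory encode_arcE. Qed.

Lemma denN_den (a : 'I_m) : denN a = den a.
Proof. by rewrite /denN /low /input_memory encode_arcE. Qed.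

Lemma low_values : [/\ low 0 = n, low 1 = m, low 2 = source I, low 3 = target I & low 4 = faults I].
Proof. by []. Qed.

Lemma ev_low (s : store) e : s 32 = low -> ev s e <= 5 * m + 4 -> ev s (Low e) = low (ev s e).
Proof. by move=> hs he; rewrite /= hs [low 1]/=; congr low; apply/minn_idPl. Qed.

Lemma ev_low_small (s : store) j : s 32 = low -> j < 5 -> ev s (Low (Cst j)) = low j.
Proof. by move=> hs hj; rewrite ev_low //=; lia. Qed.

Lemma ev_field (s : store) j a : s 32 = low -> j < 5 -> ev s a < m ->
  ev s (fieldE j a) = low (5 + (5 * ev s a + j)).
Proof. by move=> hs j5 am; rewrite /fieldE ev_low //=; lia. Qed.

Definition dprod x := \prod_(i < x) denN i.
(** The first factor puts the bound above all indices and the codes [2 * e + b] of residual arcs;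
    the product, at [x = m], puts it above the sum of the scaled weights. *)
Definition bprod x := (2 * N + 1) * \prod_(i < x) (denN i * (numN i).+1).

(** The factor [2 * N + 1] is generously given as many bits as its value; this is polynomial because
    the vertices count in unary. *)
Definition bits := input_size I + (2 * N + 1).

Lemma bprod_bound x : x <= m -> bprod x < 2 ^ bits.
Proof.
move=> xm; rewrite /bprod /bits [input_size I + _]addnC expnD.
have h : \prod_(i < x) (denN i * (numN i).+1) <= 2 ^ input_size I.
  have h1 : \prod_(i < x) (denN i * (numN i).+1) <=
      2 ^ \sum_(i < x) (bitlen (numN i) + bitlen (denN i)).
    elim: x {xm} => [|x IH]; first by rewrite !big_ord0.
    rewrite !big_ord_recr /= expnD leq_mul // expnD mulnC leq_mul ?ltn_bitlen //.
    exact: ltnW (ltn_bitlen _).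
  apply: leq_trans h1 _; rewrite leq_exp2l //.
  apply: leq_trans (input_arc_bits I); apply: leq_trans (leq_addl _ _).
  rewrite (big_ord_widen m (fun i => bitlen (numN i) + bitlen (denN i)) xm) big_mkcond.
  by apply: leq_sum => a _; case: ifP => // _; rewrite numN_num denN_den.
apply: (@leq_ltn_trans ((2 * N + 1) * 2 ^ input_size I)); first by rewrite leq_mul2l h orbT.
by rewrite ltn_mul2r expn_gt0 /= ltn_expl.
Qed.

Lemma dprod_bound x : x <= m -> dprod x < 2 ^ bits.
Proof.
move=> xm; apply: leq_ltn_trans (bprod_bound xm); rewrite /dprod /bprod.
apply: (@leq_trans (\prod_(i < x) (denN i * (numN i).+1))).
  by apply: leq_prod => i _; rewrite leq_pmulr.
by rewrite leq_pmull // addn1.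
Qed.

Definition bound_inv x (s : store) :=
  s 2 0 = dprod (minn x m) /\ s 0 0 = bprod (minn x m).

Lemma bound_step x s : s 32 = low -> s 26 0 = x ->
  bound_inv x s -> bound_inv x.+1 (sem (CIf (Low #1 - $26)
    (CSeq (CSet 2 #0 ($2 * fieldE 3 $26))
          (CSet 0 #0 ($0 * (fieldE 3 $26 * (fieldE 2 $26 + #1))))) CSkip) s).
Proof.
move=> sl sx [h1 h2]; rewrite sem_if.
have -> : (ev s (Low #1 - $26)%AE != 0) = (x < m).
  rewrite ev_sub ev_low_small //; have [_ -> _ _ _] := low_values.
  by rewrite (_ : ev s $26 = x) //; lia.
case: (ltnP x m) => xm; last first.
  by rewrite /bound_inv (minn_idPr (leqW xm)); rewrite (minn_idPr xm) in h1 h2.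
rewrite (minn_idPl (ltnW xm)) in h1 h2.
rewrite sem_seq /bound_inv (minn_idPl xm).
have e26 : ev s ($26)%AE = x by [].
have eD : ev s ($2 * fieldE 3 $26)%AE = dprod x.+1.
  by rewrite ev_mul ev_field // ?e26 // /dprod big_ord_recr /= -/(dprod x) -h1.
have -> : sem (CSet 2 #0 ($2 * fieldE 3 $26)) s = upd s 2 0 (dprod x.+1) by rewrite -eD.
set s2 := upd s 2 0 (dprod x.+1).
have sl2 : s2 32 = low by [].
have e26' : ev s2 ($26)%AE = x by [].
split.
  by rewrite [sem _ _]/= upd_id // upd_eq.
rewrite -[sem _ s2 0 0]/(ev s2 ($0 * (fieldE 3 $26 * (fieldE 2 $26 + #1)))%AE).
rewrite !ev_mul ev_field // ?e26' //.
rewrite (_ : ev s2 (fieldE 2 $26 + #1)%AE = ev s2 (fieldE 2 $26) + 1) // ev_field // ?e26' //.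
rewrite (_ : ev s2 $0 = bprod x); last by rewrite -h2.
by rewrite /bprod big_ord_recr /= -mulnA [low _ + 1]addn1.
Qed.

Definition init_store : store := fun i x => if Nat.eqb i 32 then low x else 0.

(** Registers behind the input read 0, the default value of [nth], so all arrays start out zero. *)
Lemma init_rep : rep (input_memory I) init_store.
Proof.
split=> [y _|i x ilt]; first by [].
have -> : init_store i x = 0 by rewrite /init_store nat_eqbE (ltn_eqF ilt).
have -> : init_store 32 1 = m by [].
by rewrite /input_memory nth_default // size_encode; lia.
Qed.

Lemma init_bound : sbnd bits init_store.
Proof.
move=> i x; rewrite /init_store; case: ifP => _; last by rewrite expn_gt0.
apply: leq_trans (input_entry I x) _.
by rewrite leq_exp2l // leq_addr.
Qed.

Definition sized := upd (upd (upd init_store 1 0 N) 0 0 (2 * N + 1)) 2 0 1.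

Lemma ev_N : ev init_store (Low #1 + Low #0 * Low #0 + Low #0 + #1)%AE = N.
Proof.
rewrite (_ : ev _ _ = ev init_store (Low #1) +
  ev init_store (Low #0) * ev init_store (Low #0) + ev init_store (Low #0) + 1) //.
by rewrite !ev_low_small.
Qed.

Lemma set_N : sem (CSet 1 #0 (Low #1 + Low #0 * Low #0 + Low #0 + #1)) init_store =
  upd init_store 1 0 N.
Proof. by rewrite -ev_N. Qed.

Lemma boundsE : sem bounds init_store = sem bound_loop sized.
Proof. by rewrite /bounds 3!sem_seq set_N. Qed.

Lemma sized_inv : bound_inv 0 sized.
Proof. by rewrite /bound_inv min0n /dprod /bprod !big_ord0 muln1. Qed.

Lemma arcs_lt_loops : m < N. Proof. by rewrite /N; lia. Qed.

Lemma boundsP : let s := sem bounds init_store in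
  [/\ s 32 = low, s 1 0 = N, s 2 0 = denprod I & s 0 0 = bprod m].
Proof.
move=> s; rewrite /s boundsE {s}; have [] : bound_inv N (sem bound_loop sized).
  apply: (@for_rule 26 _ bound_inv sized) => //; first exact: sized_inv.
  by move=> x s _ fr sx; apply: bound_step => //; rewrite fr.
rewrite (minn_idPr (ltnW arcs_lt_loops)) => -> ->; split=> //; try by rewrite sem_framef.
by apply: eq_bigr => a _; rewrite denN_den.
Qed.

Lemma bounds_safe : safe N bits bounds init_store.
Proof.
have hN : 2 * N + 1 < 2 ^ bits.
  have := @bprod_bound 0 (leq0n _); rewrite /bprod big_ord0 muln1; exact.
apply: safe_seq; first by rewrite /safe ev_N; lia.
rewrite set_N; apply: safe_seq; first by rewrite /safe.
apply: safe_seq; first by rewrite /safe [ev _ _]/=; lia.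
rewrite (_ : sem _ _ = sized) //.
apply: (@for_safe 26 _ bound_inv sized) => //.
- exact: sized_inv.
- by move=> x s _ fr sx; apply: bound_step => //; rewrite fr.
move=> x s xN fr sx inv.
have sl : s 32 = low by rewrite fr.
have step := bound_step sl sx inv; move: step; rewrite sem_if /safe -/safe.
have -> : (ev s (Low #1 - $26)%AE != 0) = (x < m).
  rewrite ev_sub ev_low_small //; have [_ -> _ _ _] := low_values.
  by rewrite (_ : ev s $26 = x) //; lia.
case: (ltnP x m) => // xm [h1 h2].
by split; [have := dprod_bound (geq_minr x.+1 m); rewrite -h1
          |have := bprod_bound (geq_minr x.+1 m); rewrite -h2].
Qed.

Let B := bprod m.
Definition scaled e := if e < m then numN e * (denprod I %/ denN e) else 0.

Lemma n_gt0 : 0 < n.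
Proof. exact: leq_ltn_trans (ltn_ord (source I)). Qed.

Lemma prod_gt0 x : x <= m -> 0 < \prod_(i < x) (denN i * (numN i).+1).
Proof.
move=> xm; apply: prodn_gt0 => i; rewrite muln_gt0 /= andbT.
by rewrite (denN_den (widen_ord xm i)) den_gt0.
Qed.

Lemma N2B : 2 * N < B.
Proof. by rewrite /B /bprod; have := prod_gt0 (leqnn m); nia. Qed.

Lemma vertices_lt_loops : n < N. Proof. by rewrite /N; lia. Qed.

Lemma scaled_sum : \sum_(e < m) scaled e < B.
Proof.
apply: (@leq_ltn_trans (\sum_(e < m) denprod I * num e)).
  apply: leq_sum => e _; rewrite /scaled ltn_ord numN_num mulnC leq_mul2r.
  by rewrite leq_div orbT.
rewrite -big_distrr /=; apply: (@leq_trans (denprod I * \prod_(e < m) (num e).+1)).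
  by rewrite ltn_mul2l denprod_gt0 sum_lt_prod.
rewrite /denprod -big_split /= /B /bprod addn1 mulSn; apply: leq_trans (leq_addr _ _).
by apply: leq_prod => e _; rewrite numN_num denN_den.
Qed.

Definition loaded (s : store) := [/\ s 32 = low, s 1 0 = N, s 2 0 = denprod I & s 0 0 = B].

Lemma loaded_frame c s : all (fun j => j \notin writes c) [:: 0; 1; 2; 32] ->
  loaded s -> loaded (sem c s).
Proof. by case/and5P=> *; rewrite /loaded !sem_framef. Qed.

Lemma for_loadP i e (F : nat -> nat) s : 1 < i -> i != 27 -> i != 2 -> i != 22 -> i != 32 ->
  loaded s -> s iM 0 = m ->
  (forall t x, x < N -> t 27 0 = x -> loaded t -> t iM 0 = m -> ev t e = F x) ->
  (forall x, x < N -> F x <= B) ->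
  forall x, x < N -> sem (CFor 27 (asg i $27 e)) s i x = F x.
Proof.
move=> i1 i27 i2 i22 i32 [l32 l1 l2 l0] sm hF FB x xN.
rewrite (@for_asgP i e F) ?l1 ?l0 //; first by apply/minn_idPl; exact: FB.
have ne j : j != i -> j != 27 -> j \notin [:: 27; i].
  by rewrite !inE negb_or => -> ->.
move=> t y yN ty fr; apply: hF => //; last by rewrite fr // ne // eq_sym.
split; rewrite fr // ne // 1?eq_sym //; by apply/eqP; lia.
Qed.

Lemma tail_low (a : 'I_m) : low (5 + (5 * a + 0)) = arc_tail a.
Proof. by rewrite /low /input_memory encode_arcE. Qed.
Lemma head_low (a : 'I_m) : low (5 + (5 * a + 1)) = arc_head a.
Proof. by rewrite /low /input_memory encode_arcE. Qed.
Lemma vul_low (a : 'I_m) : low (5 + (5 * a + 4)) = (a \in vulnerable I).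
Proof. by rewrite /low /input_memory encode_arcE. Qed.

Definition tailN x := if x < m then low (5 + (5 * x + 0)) else (x - m) %/ n.
Definition headN x := if x < m then low (5 + (5 * x + 1)) else (x - m) %% n.
Definition vulN x := if x < m then low (5 + (5 * x + 4)) else 0.

Lemma tailN_le x : x < N -> tailN x <= B.
Proof.
move=> xN; have := N2B; rewrite /tailN; case: (ltnP x m) => xm; last first.
  by have := leq_div (x - m) n; lia.
by rewrite (tail_low (Ordinal xm)); have := ltn_ord (arc_tail (Ordinal xm)); have := vertices_lt_loops; lia.
Qed.

Lemma headN_le x : x < N -> headN x <= B.
Proof.
move=> xN; have := N2B; rewrite /headN; case: (ltnP x m) => xm; last first.
  by have := leq_mod (x - m) n; lia.
by rewrite (head_low (Ordinal xm)); have := ltn_ord (arc_head (Ordinal xm)); have := vertices_lt_loops; lia.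
Qed.

Lemma vulN_le x : vulN x <= 1.
Proof. by rewrite /vulN; case: (ltnP x m) => // xm; rewrite (vul_low (Ordinal xm)) leq_b1. Qed.

Lemma scaled_le x : scaled x <= B.
Proof.
case: (ltnP x m) => xm; last by rewrite /scaled ltnNge xm.
apply: leq_trans (ltnW scaled_sum).
by rewrite (bigD1 (Ordinal xm)) //= leq_addr.
Qed.

Lemma loadP s : loaded s -> let s' := sem load s in
  [/\ loaded s', s' iM 0 = m, s' iE 0 = m + n * n &
   forall x, x < N -> [/\ s' iT x = tailN x, s' iH x = headN x, s' iW x = scaled x
     & s' iVul x = vulN x]].
Proof.
move=> ls s'; rewrite /s' /load 4!sem_seq {s'}.
have [v0 v1 _ _ _] := low_values; have B2 := N2B.
have [m1 e1] : sem load_sizes s iM 0 = m /\ sem load_sizes s iE 0 = m + n * n.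
  have [l32 l1 l2 l0] := ls.
  rewrite /load_sizes sem_seq /asv !sem_asg.
  set s1 := upd s 22 _ _.
  have l32' : s1 32 = low by rewrite -l32.
  have eM : ev s (Low #1) = m by rewrite ev_low_small.
  have eE : ev s1 (Low #1 + Low #0 * Low #0)%AE = m + n * n.
    rewrite (_ : ev _ _ = ev s1 (Low #1) + ev s1 (Low #0) * ev s1 (Low #0)) //.
    by rewrite !ev_low_small.
  have l0' : s1 0 0 = B by rewrite -l0.
  have lB : m + n * n <= B by move: B2; rewrite /N; lia.
  split.
    by rewrite upd_id // /s1 upd_eq eM l0 (minn_idPl _) //; lia.
  by rewrite upd_eq eE l0' (minn_idPl _).
have l1 : loaded (sem load_sizes s) by apply: loaded_frame ls.
set s1 := sem load_sizes s in m1 e1 l1 *; clearbody s1.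
have selE t x e1' e2' : t 27 0 = x -> t iM 0 = m ->
    ev t (posE ($iM - $27) * e1' + (#1 - posE ($iM - $27)) * e2')%AE =
    if x < m then ev t e1' else ev t e2'.
  by move=> tx tm; rewrite ev_sel /= tx tm subn_gt0.
have mulE t x e : t 27 0 = x -> t iM 0 = m ->
    ev t (posE ($iM - $27) * e)%AE = if x < m then ev t e else 0.
  by move=> tx tm; rewrite ev_mul ev_posE /= tx tm subn_gt0; case: (_ < _); rewrite ?mul1n.
have T2 x : x < N -> sem load_tail s1 iT x = tailN x.
  apply: for_loadP => //; last exact: tailN_le.
  move=> t y yN ty [t32 _ _ _] tm; rewrite (selE t y) // /tailN; case: ifP => ym.
    by rewrite ev_field //= ty.
  by rewrite (_ : ev t _ = (t 27 0 - t iM 0) %/ ev t (Low #0)) // ev_low_small // ty tm.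
set s2 := sem load_tail s1 in T2 *.
have l2 : loaded s2 by apply: loaded_frame l1.
have fr2 j : j \notin writes load_tail -> s2 j = s1 j by exact: sem_framef.
clearbody s2.
have m2 : s2 iM 0 = m by rewrite fr2.
have H3 x : x < N -> sem load_head s2 iH x = headN x.
  apply: for_loadP => //; last exact: headN_le.
  move=> t y yN ty [t32 _ _ _] tm; rewrite (selE t y) // /headN; case: ifP => ym.
    by rewrite ev_field //= ty.
  rewrite (_ : ev t _ = (t 27 0 - t iM 0) - (t 27 0 - t iM 0) %/ ev t (Low #0) * ev t (Low #0)) //.
  rewrite ev_low_small // ty tm v0 {1}(divn_eq (y - m) n); lia.
set s3 := sem load_head s2 in H3 *.
have l3 : loaded s3 by apply: loaded_frame l2.
have fr3 j : j \notin writes load_head -> s3 j = s2 j by exact: sem_framef.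
clearbody s3.
have m3 : s3 iM 0 = m by rewrite fr3.
have W4 x : x < N -> sem load_weight s3 iW x = scaled x.
  apply: for_loadP => //; last by move=> y _; exact: scaled_le.
  move=> t y yN ty [t32 _ t2 _] tm; rewrite (mulE t y) // /scaled; case: ifP => ym //.
  rewrite ev_mul (_ : ev t ($2 / _)%AE = t 2 0 %/ ev t (fieldE 3 $27)) //.
  by rewrite !ev_field //= ty // t2.
set s4 := sem load_weight s3 in W4 *.
have l4 : loaded s4 by apply: loaded_frame l3.
have fr4 j : j \notin writes load_weight -> s4 j = s3 j by exact: sem_framef.
clearbody s4.
have m4 : s4 iM 0 = m by rewrite fr4.
have V5 x : x < N -> sem load_vul s4 iVul x = vulN x.
  apply: for_loadP => //; last by move=> y _; have := vulN_le y; lia.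
  move=> t y yN ty [t32 _ t2 _] tm; rewrite (mulE t y) // /vulN; case: ifP => ym //.
  by rewrite ev_field //= ty.
set s5 := sem load_vul s4 in V5 *.
have l5 : loaded s5 by apply: loaded_frame l4.
have fr5 j : j \notin writes load_vul -> s5 j = s4 j by exact: sem_framef.
clearbody s5.
split=> //; try by rewrite fr5 // fr4 // fr3 // fr2.
move=> x xN; rewrite -T2 // -H3 // -W4 // V5 //.
by rewrite !fr5 // [s4 iH]fr4 // [s4 iT]fr4 // fr3.
Qed.
End Instance.

(** * Correctness and running time *)

Ltac solve_clipped := repeat split; by move=> ?; rewrite ev_clip geq_minr.

Lemma main_clipped : clipped main. Proof. solve_clipped. Qed.
Lemma load_clipped : clipped load. Proof. solve_clipped. Qed.
Lemma output_clipped : clipped output. Proof. solve_clipped. Qed.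

Lemma algorithm_wf : wfc algorithm. Proof. by []. Qed.

Lemma outputP m B s : m < s 1 0 -> s iM 0 = m -> s 32 1 = m -> s 0 0 = B ->
  sem output s 32 1 = m /\
  forall a, 0 < a < m -> sem output s 32 a.+1 = minn (s iS a) B.
Proof.
move=> arcs_lt_loops sm s1 s0.
pose Q x (t : store) := t 32 1 = m /\
  forall a, 0 < a < minn x m -> t 32 a.+1 = minn (s iS a) B.
have [h1 h2] : Q (s 1 0) (sem output s); last by split=> // a; rewrite -{1}(minn_idPr (ltnW arcs_lt_loops)); exact: h2.
apply: (@for_rule 26 _ Q) => //.
  by split=> // a; rewrite min0n ltn0 andbF.
move=> x t xN fr tx [q1 q2]; rewrite sem_if.
have -> : (ev t ($26 * ($iM - $26))%AE != 0) = (0 < x < m).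
  by rewrite /= tx fr // sm muln_eq0; lia.
case: ifP => [/andP[x0 xm]|nx]; last first.
  split=> // a ha; apply: q2; case: (eqVneq a x) => [e|]; last by lia.
  by move: ha nx; rewrite e; lia.
have eS : sem (CLow ($26 - #1) (clip iS.[$26])) t = upd t 32 x.+1 (minn (s iS x) B).
  rewrite [sem _ _](_ : _ = upd t 32 (2 + minn (t 26 0 - 1) (5 * t 32 1 + 2))
    (ev t (clip iS.[$26]))) // ev_clip /= tx [t 13]fr // [t 0]fr // s0 q1; congr upd; lia.
rewrite eS /Q; split; first by rewrite updE andbC; case: eqP => [e|//]; lia.
move=> a ha; rewrite updE andbC eqSS; case: eqP => [->//|ne]; apply: q2; lia.
Qed.

Lemma surv_ext N T H vul k (S S' : pred nat) s t : (forall e, e < N -> S e = S' e) ->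
  surv N T H vul k S s t -> surv N T H vul k S' s t.
Proof.
move=> eS sv U Us Ut; case: (sv U Us Ut) => [[e [e1 e2 e3 e4]]|h].
  by left; exists e; split=> //; rewrite -eS.
by right; apply: leq_trans h _; apply: cut_size_le => e eN; rewrite eS // => -> ->.
Qed.

Lemma wt_eq N W (S S' : pred nat) : (forall e, e < N -> S e = S' e) -> wt N W S = wt N W S'.
Proof. by move=> eS; apply: eq_bigr => e _; rewrite eS. Qed.

Lemma leq_expn_base a b e : a <= b -> a ^ e <= b ^ e.
Proof. by move=> ab; elim: e => // e IH; rewrite !expnS leq_mul. Qed.

Lemma time_bound C C1 C2 M b x dp T1 X Y :
  M.+1 <= 5 * x ^ 2 -> b <= 10 * x ^ 2 ->
  T1 <= C * M.+1 ^ dp * b -> X <= C1 * b -> Y <= C2 * b ->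
  T1 + (X + Y) <= (C + C1 + C2) * (5 ^ dp * 10) * x ^ (2 * dp + 2) +
    (C + C1 + C2) * (5 ^ dp * 10).
Proof.
move=> n5 b10 tm1 t2 t3; apply: leq_trans (leq_addr _ _).
have -> : (C + C1 + C2) * (5 ^ dp * 10) * x ^ (2 * dp + 2) =
    (C + C1 + C2) * ((5 * x ^ 2) ^ dp * (10 * x ^ 2)).
  by rewrite expnMn -expnM expnD; lia.
have PP := leq_expn_base dp n5; move: ((5 * x ^ 2) ^ dp) PP => P PP.
have P0 : 0 < P by apply: leq_trans PP; rewrite expn_gt0.
have bP : b <= P * (10 * x ^ 2) by apply: leq_trans b10 _; rewrite leq_pmull.
rewrite 2!mulnDl -addnA; apply: leq_add; last apply: leq_add.
- by apply: leq_trans tm1 _; rewrite -mulnA leq_mul2l leq_mul ?orbT.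
- by apply: leq_trans t2 _; rewrite leq_mul2l bP orbT.
- by apply: leq_trans t3 _; rewrite leq_mul2l bP orbT.
Qed.

Section Correctness.
Variable I : instance.
Hypothesis k1 : 1 <= faults I.
Local Notation m := (nA I).
Local Notation n := (nV I).
Let N := m + n * n + n + 1.

Definition loaded_store := sem load (sem bounds (init_store I)).
Definition solved_store := sem main loaded_store.
Definition final_store := sem output solved_store.

Lemma loaded_storeP : [/\ loaded I loaded_store, loaded_store iM 0 = m, loaded_store iE 0 = m + n * n &
   forall x, x < N -> [/\ loaded_store iT x = tailN I x, loaded_store iH x = headN I x,
     loaded_store iW x = scaled I x & loaded_store iVul x = vulN I x]].
Proof. exact: loadP (boundsP I). Qed.

(** Only [bounds] needs an argument about the values it computes; the later phases are clipped at
    the bound it leaves behind. *)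
Lemma algorithm_safe : safe N (bits I) algorithm (init_store I).
Proof.
have [l32 l1 l2 l0] := boundsP I.
have hB : bprod I m < 2 ^ bits I by exact: bprod_bound.
apply: safe_seq; first exact: bounds_safe.
apply: safe_seq; first by apply: (clipped_safe load_clipped); rewrite ?l0 ?l1.
have [[q32 q1 q2 q0] _ _ _] := loaded_storeP; rewrite -/loaded_store.
apply: safe_seq; first by apply: (clipped_safe main_clipped); rewrite ?q0 ?q1.
by apply: (clipped_safe output_clipped); rewrite (clipped_frame _ _ main_clipped) // ?q0 ?q1.
Qed.

Let vul : pred nat := fun e => loaded_store iVul e != 0.
Let T := loaded_store iT.
Let H := loaded_store iH.

Lemma loaded_arcs (a : 'I_m) : [/\ T a = arc_tail a, H a = arc_head a,
  loaded_store iVul a = (a \in vulnerable I) & scaled I a = num a * (denprod I %/ den a)].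
Proof.
have [_ _ _ h] := loaded_storeP; have aN : a < N := ltn_trans (ltn_ord a) (arcs_lt_loops I).
have [h1 h2 _ h3] := h a aN.
rewrite /T /H h1 h2 h3 /tailN /headN /vulN /scaled ltn_ord numN_num denN_den.
by rewrite tail_low head_low vul_low.
Qed.

Lemma loaded_main : 
  [/\ (solved_store iOk 0 != 0 -> [/\ surv N T H vul (faults I) (sol solved_store) (source I) (target I),
       inm N m (sol solved_store) &
     forall S, inm N m S -> surv N T H vul (faults I) S (source I) (target I) ->
       wt N (scaled I) (sol solved_store) <= faults I * wt N (scaled I) S]),
  (forall S, inm N m S -> surv N T H vul (faults I) S (source I) (target I) ->
     solved_store iOk 0 != 0) & solved_store iM 0 = m].
Proof.
have [[q32 q1 q2 q0] qm qE qf] := loaded_storeP.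
have n0 := n_gt0 I.
have TH e : e < m + n * n -> T e < n /\ H e < n.
  move=> eE; have eN : e < N by rewrite /N; lia.
  have [eT eH _ _] := qf e eN; rewrite /T /H eT eH /tailN /headN; case: (ltnP e m) => em.
    by rewrite (tail_low (Ordinal em)) (head_low (Ordinal em)) !ltn_ord.
  by rewrite ltn_pmod // ltn_divLR //; split=> //; lia.
have pairE x y : x < n -> y < n -> exists e, [/\ m <= e, e < m + n * n, T e = x & H e = y].
  move=> xn yn; have lt : x * n + y < n * n.
    by apply: (@leq_trans (x.+1 * n)); [rewrite mulSn addnC ltn_add2r|rewrite leq_mul2r xn orbT].
  exists (m + (x * n + y)); have eN : m + (x * n + y) < N by rewrite /N; lia.
  have [eT eH _ _] := qf _ eN; rewrite /T /H eT eH /tailN /headN.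
  have -> : (m + (x * n + y) < m) = false by lia.
  have -> : m + (x * n + y) - m = x * n + y by lia.
  by rewrite divnMDl // divn_small // addn0 modnMDl modn_small // leq_addr ltn_add2l.
have vul1 e : e < N -> loaded_store iVul e <= 1.
  by move=> eN; have [_ _ _ ->] := qf e eN; exact: vulN_le.
have EN : m + n * n + n < N by rewrite /N; lia.
have be : benv N n m (bprod I m) T H (loaded_store iVul) (source I) (target I) (faults I) loaded_store.
  by split; split=> //; rewrite q32.
have we : wenv N m (bprod I m) (scaled I) loaded_store.
  split=> e he; first by have [_ _ -> _] := qf e (ltn_trans he (arcs_lt_loops I)).
  by have [_ _ -> _] := qf e he; exact: scaled_le.
have [b' [h1 h2]] := mainP EN (N2B I) n0 (ltn_ord _) (ltn_ord _) TH pairE vul1 (scaled_sum I) k1 be we.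
by split=> //; have [_ []] := b'.
Qed.

Lemma final_storeP : [/\ final_store 32 1 = m, final_store iOk 0 = solved_store iOk 0,
  final_store iS = solved_store iS &
  forall a, 0 < a < m -> (final_store 32 a.+1 != 0) = sol solved_store a].
Proof.
have [[q32 q1 q2 q0] qm qE qf] := loaded_storeP; have [_ _ sm] := loaded_main.
have s1 : solved_store 1 0 = N by rewrite [solved_store 1]sem_framef.
have s0 : solved_store 0 0 = bprod I m by rewrite [solved_store 0]sem_framef.
have s32 : solved_store 32 1 = m by rewrite [solved_store 32]sem_framef // q32.
have arcs_lt_loops' : m < solved_store 1 0 by rewrite s1; exact: arcs_lt_loops.
have [h1 h2] := outputP arcs_lt_loops' sm s32 s0.
split=> //; try by rewrite /final_store sem_framef.
move=> a ha; rewrite /final_store h2 // /sol; have := N2B I; lia.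
Qed.

(** Multiplying by the common denominator turns the comparison of weights into one of natural
    numbers; the answer [None] rests on the completeness of the flag [iOk]. *)
Lemma answer_correct mem : (mem 0 != 0) = (solved_store iOk 0 != 0) ->
  (forall a : 'I_m, (mem a.+1 != 0) = sol solved_store a) ->
  approx_answer ((faults I)%:R)%R (answer I mem).
Proof.
move=> m0 ma; have [h1 h2 _] := loaded_main.
have hT a := let: And4 h _ _ _ := loaded_arcs a in h.
have hH a := let: And4 _ h _ _ := loaded_arcs a in h.
have hv a := let: And4 _ _ h _ := loaded_arcs a in h.
have hW (S : {set 'I_m}) : (total_weight S * (denprod I)%:R = (wt N (scaled I) (arcs_of S))%:R)%R.
  rewrite total_weight_scaled (wt_arcs (arcs_lt_loops I)); congr (_%:R)%R.
  by apply: eq_bigr => a _; have [_ _ _ ->] := loaded_arcs a.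
rewrite /answer; case: ifP => [/eqP z|/negbT nz] /=.
  move=> S fS; have := h2 _ (@arcs_of_inm I N S) (feasible_surv (arcs_lt_loops I) hT hH hv fS).
  by rewrite -m0 z.
rewrite m0 in nz; have [sv Sm wb] := h1 nz.
set R := [set a | _].
have eR e : e < N -> sol solved_store e = arcs_of R e.
  move=> eN; rewrite /arcs_of; case: insubP => [a _ <-|]; first by rewrite inE ma.
  by move=> nem; apply: contraNF nem; exact: Sm.
split; first by apply: (surv_feasible (arcs_lt_loops I) hT hH hv); apply: surv_ext sv.
move=> S [fS _].
have D0 : (0 < (denprod I)%:R :> rat)%R by rewrite ltr0n denprod_gt0.
rewrite -(ler_pM2r D0) -mulrA !hW -natrM ler_nat -(wt_eq _ eR).
by apply: wb; [exact: arcs_of_inm|exact: (feasible_surv (arcs_lt_loops I) hT hH hv fS)].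
Qed.

(** With [x] the input size, the quantities are at most [x^2 + 2x + 2] and [2x^2 + 5x + 3]; the
    coefficients add up to 5 and 10, and [x] is positive because the source is a vertex. *)
Lemma bits_bound : N.+1 <= 5 * input_size I ^ 2 /\ bits I <= 10 * input_size I ^ 2.
Proof.
have h1 : n <= input_size I by apply: leq_trans (leq_addr _ _) (input_arc_bits I).
have h2 := input_arcs I; have h3 := n_gt0 I.
have h4 : n * n <= input_size I * input_size I by rewrite leq_mul.
rewrite /bits -/N /N !expnS expn0 muln1; move: (input_size I) h1 h2 h4 => x; nia.
Qed.

End Correctness.

(** * The final program *)

Lemma update_eq mem x v : update mem x v x = v.
Proof. by rewrite /update eqxx. Qed.

Lemma update_ne mem x v y : y != x -> update mem x v y = mem y.
Proof. by rewrite /update => /negPf ->. Qed.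

(* Register 1 is overwritten last, because it locates the arrays. *)
Definition ftp_program :=
  Seq (compc algorithm)
    (Seq (Write (Const 0) (compe ($iOk)%AE)) (Write (Const 1) (compe (iS.[#0])%AE))).

Theorem theorem14 :
  exists alg : program,
    polytime_approximation (fun I => 1 <= faults I)
                           (fun I => ((faults I)%:R)%R) alg.
Proof.
have [C hC] := compc_correct algorithm_wf.
have [C1 hC1] := write_bound (Const 0) (compe ($iOk)%AE).
have [C2 hC2] := write_bound (Const 1) (compe (iS.[#0])%AE).
exists ftp_program, ((C + C1 + C2) * (5 ^ depth algorithm * 10)), (2 * depth algorithm + 2).
move=> I k1.
have b0 : 0 < bits I by rewrite /bits; lia.
have [mem1 [T1 [ex1 rp1 sb1 tm1]]] :=
  hC _ _ _ _ b0 (init_rep I) (@init_bound I) (algorithm_safe I).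
have eF : sem algorithm (init_store I) = final_store I 
  by rewrite /final_store /solved_store /loaded_store /algorithm 3!sem_seq.
rewrite {}eF in rp1 sb1.
have [f1 fok fS fout] := final_storeP k1.
(* Register 0 is part of the input and does not locate the arrays, so the second output can still be
   read through [rep]. *)
have rp2 : rep (update mem1 0 (final_store I iOk 0)) (upd (final_store I) 32 0 (final_store I iOk 0)).
  by apply: rep_low => //; lia.
have sb2 : sbnd (bits I) (upd (final_store I) 32 0 (final_store I iOk 0)).
  exact: sbnd_upd sb1 (sb1 _ _).
have v1 : value mem1 (compe ($iOk)%AE) = final_store I iOk 0 by rewrite (value_comp rp1).
set mem2 := update mem1 0 (final_store I iOk 0) in rp2.
have v2 : value mem2 (compe (iS.[#0])%AE) = final_store I iS 0 by rewrite (value_comp rp2).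
set mem3 := update mem2 1 (final_store I iS 0).
have ok : (mem3 0 != 0) = (solved_store I iOk 0 != 0).
  by rewrite -fok /mem3 update_ne // /mem2 update_eq.
have arcs (a : 'I_(nA I)) : (mem3 a.+1 != 0) = sol (solved_store I) a.
  (* Arc 0 is answered by the last write, all others by [output]. *)
  case: (posnP a) => a0; first by rewrite /sol a0 /mem3 update_eq fS.
  rewrite -fout; last by rewrite a0 ltn_ord.
  rewrite /mem3 update_ne; last by rewrite eqSS -lt0n.
  by rewrite /mem2 update_ne // (proj1 rp1) // f1; have := ltn_ord a; lia.
exists mem3; eexists; split.
- apply: exec_seq ex1 _; apply: (@exec_seq _ _ _ mem2).
    by rewrite /mem2 -v1; exact: exec_write.
  by rewrite /mem3 -v2; exact: exec_write.
- have t2 := hC1 _ _ b0 (rep_bound rp1 sb1).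
  have t3 := hC2 _ _ b0 (rep_bound rp2 sb2).
  have [n5 b10] := bits_bound k1.
  exact: time_bound n5 b10 tm1 t2 t3.
- exact (answer_correct k1 ok arcs).
Qed.
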